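(* If $\varphi \in \mathrm{QS}(\mathbb{S}^1)$, then the welding Grunsky matrix $\mathbf{\Lambda}_\varphi$ defines a bounded self-adjoint operator on $\ell^2_{\mathbb{Z}^*}$ by matrix multiplication. Moreover, for $\varphi_1,\varphi_2\in \mathrm{QS}(\mathbb{S}^1)$, $\mathbf{\Lambda}_{\varphi_1} = \mathbf{\Lambda}_{\varphi_2}$ if and only if there exists $\mu \in \mathrm{M\ddot{o}b}(\mathbb{S}^1)$ such that $\varphi_1 = \mu \circ \varphi_2$; hence $\varphi \mapsto \mathbf{\Lambda}_\varphi$ descends to an injective map on $T(1) = \mathrm{M\ddot{o}b}(\mathbb{S}^1)\backslash \mathrm{QS}(\mathbb{S}^1)$.
   Context: All circle homeomorphisms are orientation-preserving. $\mathrm{QS}(\mathbb{S}^1)$ is the group of quasisymmetric homeomorphisms of the unit circle $\mathbb{S}^1$: those $\varphi$ for which there is $C<\infty$ with $\frac1C \le \left|\frac{\varphi(e^{i(s+t)})-\varphi(e^{is})}{\varphi(e^{is})-\varphi(e^{i(s-t)})}\right|\le C$ for all $s\in[0,2\pi]$, $t\in(0,2\pi)$. $\mathrm{M\ddot{o}b}(\mathbb{S}^1)$ is the group of M\''obius transformations preserving $\mathbb{S}^1$. Welding Grunsky matrix: for $\varphi\in\mathrm{QS}(\mathbb S^1)$ the function $\log\left|\frac{\varphi(z)-\varphi(w)}{z-w}\right|$ is in $L^1(\mathbb S^1\times\mathbb S^1)$. For $k,\ell\in\mathbb Z$ put $\widehat\lambda_{k,\ell}=\frac1{(2\pi)^2}\iint_{[0,2\pi]^2}\log\left|\frac{\varphi(e^{is})-\varphi(e^{it})}{e^{is}-e^{it}}\right|e^{-i(ks+\ell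 t)}\,ds\,dt$, and for $k,\ell\in\mathbb Z^*=\mathbb Z\setminus\{0\}$ put $\lambda_{k,\ell}=\sqrt{|k\ell|}\,\widehat\lambda_{k,\ell}$. Then $\mathbf\Lambda_\varphi=\begin{pmatrix}M&N\\ \overline N&\overline M\end{pmatrix}$ with $M=(\lambda_{k,-\ell})_{k,\ell\ge1}$, $N=(\lambda_{k,\ell})_{k,\ell\ge1}$; equivalently $\mathbf\Lambda_\varphi=(\lambda_{k,-\ell})_{k,\ell\in\mathbb Z^*}$. It acts on $\mathbf h=((h_k)_{k\ge1},(h_{-k})_{k\ge1})\in\ell^2_{\mathbb Z^*}$ by $(\mathbf\Lambda_\varphi\mathbf h)_k=\lim_{m\to\infty}\sum_{1\le|\ell|\le m}\lambda_{k,-\ell}h_\ell$. *)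

(* Defs.v *)
From HB Require Import structures.
From mathcomp Require Import all_boot all_order all_algebra.
From mathcomp Require Import all_classical all_reals all_analysis.
From mathcomp.real_closed Require Import complex.

Set Implicit Arguments.
Unset Strict Implicit.
Unset Printing Implicit Defensive.

Import Order.TTheory GRing.Theory Num.Theory.
Import numFieldNormedType.Exports.
Import ComplexField.Normc.

Local Open Scope classical_set_scope.
Local Open Scope complex_scope.
Local Open Scope ring_scope.

Section Circle.
Variable R : realType.

(* The alias R[i]^o carries the usual topology of the complex plane, and
   set_type the induced one. *)
Definition circle := set_type [set z : R[i]^o | `|z| = 1].

Definition cval (z : circle) : R[i] := set_val z.

Definition expi (t : R) : R[i] := cos t +i* sin t.

Lemma expi_circle (t : R) : expi t \in [set z : R[i]^o | `|z| = 1].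
Proof.
by apply/mem_set; rewrite /= normc_def /= cos2Dsin2 sqrtr1.
Qed.

Definition cis (t : R) : circle := exist _ (expi t) (expi_circle t).

Definition circle_homeo (phi : circle -> circle) : Prop :=
  continuous phi /\
  exists psi : circle -> circle,
    [/\ cancel phi psi, cancel psi phi & continuous psi].

(* A lift of phi through the universal covering cis. *)
Definition lift (phi : circle -> circle) (f : R -> R) : Prop :=
  continuous f /\ forall t : R, phi (cis t) = cis (f t).

Definition orientation_preserving (phi : circle -> circle) : Prop :=
  exists2 f : R -> R, lift phi f & {homo f : x y / x < y}.

Definition homeo_plus : set (circle -> circle) :=
  [set phi | circle_homeo phi /\ orientation_preserving phi].

Definition quasisymmetric (phi : circle -> circle) : Prop :=
  exists2 C : R, 0 < C & forall s t : R,
    0 <= s <= 2 * pi -> 0 < t < 2 * pi ->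
    C^-1 <= normc ((cval (phi (cis (s + t))) - cval (phi (cis s))) /
                     (cval (phi (cis s)) - cval (phi (cis (s - t))))) <= C.

Definition QS : set (circle -> circle) :=
  [set phi | homeo_plus phi /\ quasisymmetric phi].

(* Membership in homeo_plus rules out the Moebius transformations that
   preserve the circle but exchange its two sides, such as z |-> 1 / z. *)
Definition Mob : set (circle -> circle) :=
  [set mu | homeo_plus mu /\
    exists a b c d : R[i], a * d - b * c != 0 /\
      forall z : circle, c * cval z + d != 0 /\
        cval (mu z) = (a * cval z + b) / (c * cval z + d)].

Definition Mob_coset (phi : circle -> circle) : set (circle -> circle) :=
  [set mu \o phi | mu in Mob].

(* The universal Teichmueller space Mob \ QS. *)
Definition T1 : set (set (circle -> circle)) := [set Mob_coset phi | phi in QS].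

End Circle.

Section EllTwo.
Variable R : realType.

Definition Zstar := {k : int | k != 0}.

Definition bounded_index (m : nat) : set Zstar :=
  [set k | (`|val k| <= m)%N].

Implicit Types (h g : Zstar -> R[i]) (T : (Zstar -> R[i]) -> Zstar -> R[i]).

Definition ell2 : set (Zstar -> R[i]) :=
  [set h | summable [set: Zstar] (fun k => (normc (h k) ^+ 2)%:E)].

Definition ell2_norm h : R :=
  Num.sqrt (fine (\esum_(k in [set: Zstar]) (normc (h k) ^+ 2)%:E)).

(* On ell2 the series converges absolutely, so the order of summation is
   immaterial. *)
Definition ell2_inner h g : R[i] :=
  lim ((\sum_(k \in bounded_index m) h k * (g k)^* : R[i]^o) @[m --> \oo]).

Definition bounded_operator T : Prop :=
  [/\ forall h, ell2 h -> ell2 (T h),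
      forall (a : R[i]) h g, ell2 h -> ell2 g ->
        T (fun k => a * h k + g k) = (fun k => a * T h k + T g k) &
      exists C : R, forall h, ell2 h -> ell2_norm (T h) <= C * ell2_norm h].

Definition self_adjoint T : Prop :=
  forall h g, ell2 h -> ell2 g -> ell2_inner (T h) g = ell2_inner h (T g).

Implicit Type A : Zstar -> Zstar -> R[i].

Definition row_partial_sum A h (k : Zstar) (m : nat) : R[i]^o :=
  \sum_(l \in bounded_index m) A k l * h l.

Definition matrix_action A h : Zstar -> R[i] :=
  fun k => lim (row_partial_sum A h k m @[m --> \oo]).

Definition acts_as_bounded_self_adjoint A : Prop :=
  [/\ forall h, ell2 h -> forall k, cvg (row_partial_sum A h k m @[m --> \oo]),
      bounded_operator (matrix_action A) &
      self_adjoint (matrix_action A)].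

End EllTwo.

Section Welding.
Variable R : realType.
Implicit Type phi : circle R -> circle R.

Definition torus_integral (f : R * R -> R[i]) : R[i] :=
  let mu := (lebesgue_measure \x lebesgue_measure)%E in
  let D := `[0, 2 * pi] `*` `[0, 2 * pi] in
  (\int[mu]_(x in D) complex.Re (f x)) +i* (\int[mu]_(x in D) complex.Im (f x)).

(* On the diagonal, a null set, this takes the conventional value ln 0 = 0. *)
Definition log_quotient phi (s t : R) : R :=
  ln (normc ((cval (phi (cis s)) - cval (phi (cis t))) / (expi s - expi t))).

Definition log_fourier phi (k l : int) : R[i] :=
  (((2 * pi) ^+ 2)^-1)%:C *
  torus_integral (fun x =>
    (log_quotient phi x.1 x.2)%:C * expi (- (k%:~R * x.1 + l%:~R * x.2))).

Definition welding_coef phi (k l : int) : R[i] :=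
  (Num.sqrt `|k * l|%:~R)%:C * log_fourier phi k l.

Definition welding_grunsky phi : Zstar -> Zstar -> R[i] :=
  fun k l => welding_coef phi (val k) (- val l).

End Welding.

(* Main.v *)
(* Let f be an increasing lift of phi and g its inverse. The kernel is
   log |(phi(z) - phi(w)) / (z - w)| = K_id - K_f with
   K_f(s, t) = - log |sin ((f s - f t) / 2)|, and - 2 log |sin ((x - y) / 2)| is the
   integral over arcs, against dr dz / sin^2 r, of the product of the indicators at
   x and y of the arc with centre z and half-length r. By Fubini, the quadratic form
   of K_f at p = P' is therefore, up to a factor, the energy
   int int (P (g (z + r)) - P (g (z - r)))^2 / sin^2 r dz dr >= 0.
   Quasisymmetry makes g doubling, hence the lengths of the g-images of dyadic arcs
   contract geometrically; telescoping the averages of P along these images and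
   summing their variances over all scales bounds the energy by
   C int int (P t - P t')^2 / (t - t')^2 dt dt', which is comparable to
   sum |k| |P_k|^2. So the Hermitian form of the matrix is bounded on finitely
   supported vectors, and polarization gives a bounded self-adjoint operator.

   If two matrices agree, the difference v of the kernels annihilates all products
   of nonconstant exponentials. Testing v against differences of translates of
   ((1 + cos t) / 2)^n in each variable gives v(a,c) - v(a,d) - v(b,c) + v(b,d) = 0:
   phi1 and phi2 have the same cross ratios, hence differ by a Moebius map.
   Conversely |mu z - mu w| = |det mu| |z - w| / (|cz + d| |cw + d|) changes the
   kernel by a sum of functions of one variable, invisible to the matrix. *)

From HB Require Import structures.
Require Import Defs.
From mathcomp Require Import all_boot all_order all_algebra.
From mathcomp Require Import all_classical all_reals all_analysis.
From mathcomp.real_closed Require Import complex.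
From mathcomp Require Import measurable_realfun.
From mathcomp Require Import ring lra.

Set Implicit Arguments.
Unset Strict Implicit.
Unset Printing Implicit Defensive.

Import Order.TTheory GRing.Theory Num.Theory.
Import numFieldNormedType.Exports.

Local Open Scope classical_set_scope.
Local Open Scope ring_scope.

(** * Circle homeomorphisms and their lifts *)

(** The energy is a seminorm of [P] composed with the inverse lift, so the hypothesis on [phi] first
    has to be transferred to [g]. A quasisymmetric [g] may be singular, so no change of variables
    through a derivative is available: only the lengths of image arcs can be used. Two geometric
    rates then compete. Telescoping along the images loses a factor 1 / beta per scale, where beta =
    M / (1 + M) is the contraction ratio, while the weight 1 / sin^2 r, integrated over dyadic
    ranges of r, gains a factor 2 per scale. The surviving ratio 1 / (2 beta) is below 1 exactly
    because M > 1. The identity lift is a case of the same estimate, so both kernels have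
    nonnegative bounded forms and their difference is bounded without any cancellation. Periodic
    primitives exist because the frequency 0 is excluded, which is the analytic meaning of the index
    set. In the recovery of cross ratios the kernels are merely integrable near the diagonal, so the
    bumps must decay away from their centre faster than the square of their mass. *)

Section Shift.
Variable R : realType.
Local Notation mu := (@lebesgue_measure R).
Implicit Types (a b c : R).

(** Translation preserves the length of half-open intervals, and this characterizes Lebesgue
    measure. *)
Lemma lebesgue_measure_shift a (A : set R) : measurable A ->
  mu ((fun x => x + a) @^-1` A) = mu A.
Proof.
have ma : measurable_fun [set: measurableTypeR R] (fun x : measurableTypeR R => (x + a : measurableTypeR R)).
  exact: measurable_realfun.measurable_funD.
move=> mA; apply/esym.
rewrite (@lebesgue_measure_unique R (@pushforward _ _ (measurableTypeR R) (measurableTypeR R) R mu (fun x => x + a)))// => X.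
case=> -[x y] _ <-; rewrite /pushforward.
rewrite [X in _ = mu X](_ : _ = `]x - a, y - a]%classic).
  rewrite !lebesgue_measure_itv/= !lte_fin ltrD2r/=.
  by case: ifPn => // _; rewrite !EFinN -!EFinB; congr (_ %:E); ring.
by apply/seteqP; split => z /=; rewrite !in_itv/= => /andP[h1 h2]; apply/andP; split; lra.
Qed.

Lemma ge0_integral_shift a (D : set R) (f : R -> \bar R) : measurable D ->
  measurable_fun D f -> (forall x, 0 <= f x)%E ->
  (\int[mu]_(x in (fun x => x + a)%R @^-1` D) f (x + a)%R = \int[mu]_(x in D) f x)%E.
Proof.
move=> mD mf f0.
have ma : measurable_fun [set: measurableTypeR R] (fun x : measurableTypeR R => (x + a : measurableTypeR R)).
  exact: measurable_realfun.measurable_funD.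
rewrite -(@ge0_integral_pushforward _ _ _ _ R _ ma mu D f)//.
apply: eq_measure_integral => A mA _.
exact: lebesgue_measure_shift.
Qed.

Lemma ge0_integral_itvco_cat a b c (f : R -> \bar R) : a <= b -> b <= c ->
  measurable_fun setT f -> (forall x, 0 <= f x)%E ->
  (\int[mu]_(x in `[a, c[) f x =
   \int[mu]_(x in `[a, b[) f x + \int[mu]_(x in `[b, c[) f x)%E.
Proof.
move=> ab bc mf f0.
rewrite (@itv_bndbnd_setU _ _ _ (BLeft b)) ?bnd_simp//.
rewrite ge0_integral_setU//.
- exact: measurable_funTS.
- apply/disj_setPS => y [/=]; rewrite 2!in_itv/= => /andP[_ yx] /andP[].
  by rewrite leNgt yx.
Qed.

Lemma periodic_intmul (V : Type) (T : R) (f : R -> V) : (forall x, f (x + T) = f x) ->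
  forall (n : int) x, f (x + n%:~R * T) = f x.
Proof.
move=> fT.
have H (n : nat) x : f (x + n%:R * T) = f x.
  elim: n x => [|n IH] x; first by rewrite mul0r addr0.
  by rewrite -(IH x) -(fT (x + n%:R * T)) -natr1; congr f; ring.
case=> n x; first exact: H.
by rewrite -(H n.+1 (x + _)) NegzE mulrNz; congr f; ring.
Qed.

Lemma ge0_integral_itvco_shift a b c (f : R -> \bar R) :
  measurable_fun setT f -> (forall x, 0 <= f x)%E ->
  (\int[mu]_(x in `[(a + c)%R, (b + c)%R[) f x =
   \int[mu]_(x in `[a, b[) f (x + c)%R)%E.
Proof.
move=> mf f0; rewrite -(@ge0_integral_shift c) //; last exact: measurable_funTS.
congr (integral _ _ _); apply/seteqP; split => z /=; rewrite !in_itv/= => /andP[h1 h2]; apply/andP; split; lra.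
Qed.

Lemma ge0_integral_periodic_co (T a b : R) (f : R -> \bar R) : 0 < T ->
  measurable_fun setT f -> (forall x, 0 <= f x)%E -> (forall x, f (x + T) = f x) ->
  (\int[mu]_(x in `[a, (a + T)%R[) f x = \int[mu]_(x in `[b, (b + T)%R[) f x)%E.
Proof.
move=> T0 mf f0 fT.
(* Moving by [n] periods makes the window start in [[b, b + T[]; it is then cut at [b + T] and the
   overhang is moved back by one more period. *)
pose n := Num.floor ((a - b) / T).
have /andP[n1 n2] := floor_itv ((a - b) / T).
rewrite -/n in n1 n2.
have b1 : b <= a - n%:~R * T by move: n1; rewrite ler_pdivlMr//; lra.
have b2 : a - n%:~R * T <= b + T.
  by move: n2; rewrite ltr_pdivrMr// intrD; lra.
rewrite -[a in LHS](subrK (n%:~R * T)) [in LHS](addrAC _ _ T).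
rewrite ge0_integral_itvco_shift//.
under eq_integral do rewrite periodic_intmul//.
rewrite (@ge0_integral_itvco_cat (a - n%:~R * T) (b + T))//; last lra.
rewrite (addeC (integral _ _ _)) ge0_integral_itvco_shift//.
under eq_integral do rewrite fT.
by rewrite -ge0_integral_itvco_cat.
Qed.

Lemma integral_periodic (T a b : R) (f : R -> \bar R) : 0 < T ->
  measurable_fun setT f -> (forall x, f (x + T) = f x) ->
  (\int[mu]_(x in `[a, (a + T)%R]) f x = \int[mu]_(x in `[b, (b + T)%R]) f x)%E.
Proof.
move=> T0 mf fT; rewrite -!integral_itv_bndo_bndc; try exact: measurable_funTS.
rewrite integralE [RHS]integralE.
rewrite (@ge0_integral_periodic_co T a b f^\+%E)//; last 2 first.
- exact: measurable_funepos.
- by move=> x; rewrite !funeposE fT.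
rewrite (@ge0_integral_periodic_co T a b f^\-%E)//.
- exact: measurable_funeneg.
- by move=> x; rewrite !funenegE fT.
Qed.

End Shift.

Section Trig.
Variable R : realType.
Implicit Types (x y t a b : R).

Lemma pi_lt4 : pi < 4 :> R.
Proof. by have := @pihalf_lt2 R; lra. Qed.

Lemma cosD2pi' x : cos (x + 2 * pi) = cos x.
Proof. by rewrite mulr_natl cosD2pi. Qed.

Lemma sinD2pi' x : sin (x + 2 * pi) = sin x.
Proof. by rewrite mulr_natl sinD2pi. Qed.

Lemma sin_half_gt0 x : 0 < x < 2 * pi -> 0 < sin (x / 2).
Proof. by move=> /andP[h1 h2]; apply: sin_gt0_pi; apply/andP; split; lra. Qed.

Lemma cos_half x : cos x = 1 - 2 * sin (x / 2) ^+ 2.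
Proof.
have -> : cos x = cos ((x / 2) *+ 2) by congr cos; rewrite mulr2n; field.
by rewrite cos_mulr2n cos2sin2; ring.
Qed.

Lemma cos_eq1_intmul x : cos x = 1 -> exists n : int, x = n%:~R * (2 * pi).
Proof.
move=> cx; have p0 := @pi_gt0 R.
have p20 : 0 < 2 * pi :> R by lra.
pose n := Num.floor (x / (2 * pi)); exists n.
have /andP[] := floor_itv (x / (2 * pi)).
rewrite -/n ler_pdivlMr// ltr_pdivrMr// intrD => n1 n2.
have c1 : cos (x - n%:~R * (2 * pi)) = 1.
  rewrite -[RHS]cx -[RHS](@periodic_intmul _ _ (2 * pi) (@cos R) (cosD2pi') (- n)).
  by congr (cos _); rewrite mulrNz; ring.
have [h|h] := eqVneq x (n%:~R * (2 * pi)); first exact h.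
have /sin_half_gt0 s0 : 0 < x - n%:~R * (2 * pi) < 2 * pi.
  by rewrite subr_gt0 lt_neqAle eq_sym h n1/=; lra.
by move: c1; rewrite cos_half; have := exprn_gt0 2 s0; lra.
Qed.

Lemma abs_sin_le x : `|sin x| <= `|x|.
Proof.
wlog x0 : x / 0 < x.
  move=> H; have [x0|x0|<-] := ltgtP 0 x; [exact: H| |by rewrite sin0].
  by rewrite -(normrN x) -(normrN (sin x)) -sinN; apply: H; lra.
rewrite -[sin x]subr0 -(sin0 R).
have [|c _ ->] := @MVT R sin cos 0 x x0 (fun z _ => is_derive_sin z).
  by apply: continuous_subspaceT => z; exact: continuous_sin.
by rewrite !subr0 normrM ler_piMl// cos_max.
Qed.

(** A crude slope suffices. Up to pi / 4 the mean value theorem gives a slope of at least cos (pi /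
    4) >= 1 / 2; beyond, sin x >= 1 / 2 while x <= pi / 2 < 2. *)
Lemma sin_ge_quarter x : 0 <= x <= pi / 2 -> x / 4 <= sin x.
Proof.
have p4 := pi_lt4; have p0 := pi_gt0 R.
have c4 : cos (pi / 4) ^+ 2 = 2^-1 :> R.
  have : cos (pi / 4 *+ 2) = 0 :> R by rewrite -cos_pihalf; congr (cos _); rewrite mulr2n; field.
  by rewrite cos_mulr2n; lra.
have s4 : sin (pi / 4) ^+ 2 = 2^-1 :> R by rewrite sin2cos2 c4; lra.
have cge : 2^-1 <= cos (pi / 4) :> R.
  have : 0 <= cos (pi / 4) :> R by apply: cos_ge0_pihalf; lra.
  by move=> h; nra.
have sge : 2^-1 <= sin (pi / 4) :> R.
  have : 0 <= sin (pi / 4) :> R by apply: sin_ge0_pi; lra.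
  by move=> h; nra.
move=> /andP[x0 x2].
have [->|xn0] := eqVneq x 0; first by rewrite sin0 mul0r.
have {}x0 : 0 < x by rewrite lt_neqAle eq_sym xn0.
have [x4|x4] := leP x (pi / 4).
  rewrite -[sin x]subr0 -(sin0 R).
  have [|c + ->] := @MVT R sin cos 0 x x0 (fun z _ => is_derive_sin z).
    by apply: continuous_subspaceT => z; exact: continuous_sin.
  rewrite in_itv/= => /andP[c0 cx].
  have : cos (pi / 4) <= cos c.
    by rewrite leNgt ltr_cos ?in_itv/=; last 2 [by lra|by lra]; lra.
  by rewrite subr0 => h; nra.
apply: (@le_trans _ _ (2^-1)); first lra.
apply: (le_trans sge).
rewrite leNgt; apply/negP; rewrite ltr_sin ?in_itv/=; lra.
Qed.

End Trig.

Section CirclePoints.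
Variable R : realType.
Implicit Types (a b t : R).

Lemma normc_expiB a b : Normc.normc (expi a - expi b) = 2 * `|sin ((a - b) / 2)|.
Proof.
rewrite /expi /=.
have -> : (cos a - cos b) ^+ 2 + (sin a - sin b) ^+ 2 = (2 * sin ((a - b) / 2)) ^+ 2.
  have := cos_half (a - b); rewrite cosB.
  have := cos2Dsin2 a; have := cos2Dsin2 b; move: (sin ((a - b)/2)) => z.
  by move=> h1 h2 h3; lra.
by rewrite sqrtr_sqr normrM ger0_norm.
Qed.

Lemma expiD2pi t : expi (t + 2 * pi) = expi t.
Proof. by rewrite /expi cosD2pi' sinD2pi'. Qed.

Lemma cis_inj_expi a b : expi a = expi b -> cis a = cis b.
Proof. by move=> h; apply/val_inj. Qed.

Lemma cisD2pi t : cis (t + 2 * pi) = cis t.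
Proof. by apply: cis_inj_expi; exact: expiD2pi. Qed.

Lemma cisD2piZ t (n : int) : cis (t + n%:~R * (2 * pi)) = cis t.
Proof. exact: (periodic_intmul cisD2pi). Qed.

Lemma cis_eqP a b : cis a = cis b -> exists n : int, a = b + n%:~R * (2 * pi).
Proof.
move=> /(congr1 (@cval R)); rewrite /cval/= => -[ca sa].
have : cos (a - b) = 1 by rewrite cosB ca sa -!expr2 cos2Dsin2.
by move=> /cos_eq1_intmul[n hn]; exists n; lra.
Qed.

Lemma cis_surj (z : circle R) : exists2 t, 0 <= t < 2 * pi & z = cis t.
Proof.
have p0 := pi_gt0 R.
suff [t ->] : exists t, z = cis t.
  pose n := Num.floor (t / (2 * pi)).
  have /andP[] := floor_itv (t / (2 * pi)).
  have p20 : 0 < 2 * pi :> R by lra.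
  rewrite -/n ler_pdivlMr// ltr_pdivrMr// intrD => n1 n2.
  exists (t - n%:~R * (2 * pi)); first by lra.
  by rewrite -[RHS](cisD2piZ _ n); congr cis; ring.
case: z => -[x y] zP; have := set_mem zP => /=; rewrite normc_def => -[] /=.
move=> /(congr1 (fun u => u ^+ 2)); rewrite sqr_sqrtr ?addr_ge0 ?sqr_ge0// expr1n => xy.
have x1 : -1 <= x <= 1 by apply/andP; split; nra.
suff [t [tx ty]] : exists t, cos t = x /\ sin t = y.
  by exists t; apply/val_inj; rewrite /= /expi tx ty.
have [y0|y0] := leP 0 y.
  exists (acos x); rewrite acosK ?in_itv//; split => //.
  rewrite sin_acos// (_ : 1 - x ^+ 2 = y ^+ 2); last lra.
  by rewrite sqrtr_sqr ger0_norm.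
exists (- acos x); rewrite cosN sinN acosK ?in_itv//; split => //.
rewrite sin_acos// (_ : 1 - x ^+ 2 = y ^+ 2); last lra.
by rewrite sqrtr_sqr ltr0_norm// opprK.
Qed.

End CirclePoints.

Section CircleLift.
Variable R : realType.
Implicit Types (f g : R -> R).

(** Degree one is part of this notion, whereas [orientation_preserving] only asks for a monotone
    lift; [homeo_lift] supplies the degree. *)
Definition circle_lift f : Prop :=
  [/\ continuous f, {homo f : x y / x < y} & forall t, f (t + 2 * pi) = f t + 2 * pi].

Lemma circle_lift_id : circle_lift id.
Proof. by split => // x; exact: cvg_id. Qed.

Lemma circle_lift_mono f : circle_lift f -> {mono f : x y / x <= y}.
Proof. by case=> _ fi _; exact: le_mono. Qed.

Lemma circle_liftD2piZ f (n : int) t : circle_lift f ->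
  f (t + n%:~R * (2 * pi)) = f t + n%:~R * (2 * pi).
Proof.
case=> _ _ fT; have H x : f (x + 2 * pi) - (x + 2 * pi) = f x - x by rewrite fT; ring.
by have := periodic_intmul H n t; lra.
Qed.

(** The degree [n] is positive by monotonicity. Were it at least 2, the lift would already gain 2 pi
    at some [c] inside the period; injectivity of [phi] would then make [c] equal to [t] modulo 2
    pi, which is impossible. *)
Lemma homeo_lift (phi : circle R -> circle R) : homeo_plus phi ->
  exists2 f, circle_lift f & forall t, phi (cis t) = cis (f t).
Proof.
move=> [[cphi [psi [phiK psiK _]]] [f [cf fphi] fi]]; exists f => //; split => // t.
have p0 := pi_gt0 R.
have : cis (f (t + 2 * pi)) = cis (f t) by rewrite -!fphi cisD2pi.
move=> /cis_eqP[n hn].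
have ftlt : f t < f (t + 2 * pi) by apply: fi; lra.
have n0 : (0 < n)%R.
  rewrite -(ltr0z R); rewrite hn in ftlt.
  have : 0 < n%:~R * (2 * pi) :> R by lra.
  by rewrite pmulr_lgt0//; lra.
have [n1|n1] := leP n 1.
  have n1' : n = 1 by apply/eqP; rewrite eq_le n1 -gtz0_ge1.
  by rewrite hn n1'; congr (_ + _); lra.
exfalso.
have n2 : 2 <= n%:~R :> R by rewrite -[2](_ : 2%:~R = _)// ler_int.
have [|||c] := @IVT R f t (t + 2 * pi) (f t + 2 * pi).
- lra.
- exact: continuous_subspaceT.
- rewrite min_l ?max_r ?(ltW ftlt)// hn; apply/andP; split; nra.
rewrite in_itv/= => /andP[tc ct] fc.
have cct : cis c = cis t.
  by rewrite -(phiK (cis c)) -(phiK (cis t)) !fphi fc cisD2pi.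
have [m cm] := cis_eqP cct.
have m0 : (0 < m)%R.
  rewrite -(ltr0z R) -(pmulr_lgt0 (m%:~R : R) (_ : 0 < 2 * pi)); last lra.
  suff : t != c by move/eqP; rewrite lt_neqAle; lra.
  by apply/eqP => tc'; rewrite -tc' in fc; lra.
have m1 : (m < 1)%R.
  rewrite -(ltr_int R) ltNge; apply/negP => m1.
  have {}cm : c = t + 2 * pi by nra.
  by rewrite cm hn in fc; nra.
by move: m0; rewrite -lezD1 => /le_lt_trans/(_ m1); rewrite ltxx.
Qed.

Lemma increasing_inverse_continuous f g : {homo f : x y / x < y} -> {homo g : x y / x < y} ->
  cancel g f -> continuous g.
Proof.
move=> fi gi gK x; apply/cvgrPdist_lt => e e0.
have fm := le_mono gi.
have h1 : x < f (g x + e) by rewrite -{1}(gK x); apply: fi; lra.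
have h2 : f (g x - e) < x by rewrite -{2}(gK x); apply: fi; lra.
have fl := le_mono fi.
near=> y.
have [y1 y2] : y < f (g x + e) /\ f (g x - e) < y.
  by split; near: y; [exact: lt_nbhsl|exact: lt_nbhsr].
have g1 : g y < g x + e by rewrite -(leW_mono fl) gK.
have g2 : g x - e < g y by rewrite -(leW_mono fl) gK.
by rewrite ltr_norml; apply/andP; split; lra.
Unshelve. all: by end_near. Qed.

Lemma circle_lift_inv f : circle_lift f ->
  exists g, [/\ circle_lift g, cancel f g & cancel g f].
Proof.
move=> lf; have [cf fi fT] := lf; have p0 := pi_gt0 R.
have surj y : exists x, f x = y.
  pose n := Num.floor ((y - f 0) / (2 * pi)).
  have /andP[] := floor_itv ((y - f 0) / (2 * pi)).
  have p20 : 0 < 2 * pi :> R by lra.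
  rewrite -/n ler_pdivlMr// ltr_pdivrMr// intrD => n1 n2.
  have := circle_liftD2piZ n 0 lf; have := circle_liftD2piZ (n + 1) 0 lf.
  set a := 0 + _; set b := 0 + _ => fa fb.
  have ba : b <= a by rewrite /a /b intrD; lra.
  have [||x _ <-] := @IVT R f b a y ba.
  - exact: continuous_subspaceT.
  - have := fb; have := fa; rewrite intrD => fa' fb'.
    by rewrite min_l ?max_r; [lra|lra|lra].
  by exists x.
pose g y := sval (cid (surj y)).
have gK : cancel g f by move=> y; rewrite /g; case: cid.
have fl := le_mono fi.
have fK : cancel f g by move=> x; apply/le_anti/andP; split; rewrite -fl gK.
have gi : {homo g : x y / x < y}.
  by move=> x y xy; rewrite -(leW_mono fl) !gK.
exists g; split => //; split => //; first exact: increasing_inverse_continuous gK.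
by move=> t; rewrite -[t in LHS]gK -fT fK.
Qed.

(** The increment is a continuous, positive, periodic function of [x], so compactness of one period
    makes its lower bound uniform. *)
Lemma circle_lift_gap f h : circle_lift f -> 0 < h ->
  exists2 c, 0 < c & forall x, c <= f (x + h) - f x.
Proof.
move=> lf h0; have [cf fi fT] := lf; have p0 := pi_gt0 R.
have cg : continuous (fun x => f (x + h) - f x).
  move=> x; apply: cvgB; last exact: cf.
  by apply: continuous_comp; [apply: cvgD; [exact: cvg_id|exact: cvg_cst]|exact: cf].
have [||c _ cmin] := @EVT_min R (fun x => f (x + h) - f x) 0 (2 * pi).
- lra.
- exact: continuous_subspaceT.
exists (f (c + h) - f c); first by rewrite subr_gt0; apply: fi; lra.
move=> x; pose n := Num.floor (x / (2 * pi)).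
have /andP[] := floor_itv (x / (2 * pi)).
have p20 : 0 < 2 * pi :> R by lra.
rewrite -/n ler_pdivlMr// ltr_pdivrMr// intrD => n1 n2.
have := cmin (x - n%:~R * (2 * pi)); rewrite in_itv/= => /(_ _)/le_trans; apply; first lra.
have := circle_liftD2piZ (-n) x lf; have := circle_liftD2piZ (-n) (x + h) lf.
rewrite mulrNz (addrAC x h) !mulNr; lra.
Qed.

(** The Beurling-Ahlfors condition on adjacent intervals, restricted to steps up to [H]. *)
Definition doubling f (M H : R) : Prop := forall x h, 0 < h <= H ->
  f (x + h) - f x <= M * (f x - f (x - h)) /\
  f x - f (x - h) <= M * (f (x + h) - f x).

Lemma doubling_opp f M H : doubling f M H -> doubling (fun x => - f (- x)) M H.
Proof.
move=> fd x h hH; have [h1 h2] := fd (- x) h hH.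
by rewrite !opprD !opprK; split; lra.
Qed.

(** Passes from chords to arcs: sin (b / 2) >= b / 8 because b <= pi, and |sin (a / 2)| <= a / 2,
    whence the factor 4. *)
Lemma sin_chord_le a b (C : R) : 0 < C -> 0 <= a -> 0 <= b <= pi ->
  `|sin (b / 2)| <= C * `|sin (a / 2)| -> b <= (4 * C) * a.
Proof.
move=> C0 a0 /andP[b0 bpi] h.
have : b / 2 / 4 <= sin (b / 2) by apply: sin_ge_quarter; apply/andP; split; lra.
have := abs_sin_le (a / 2); rewrite (ger0_norm (_ : 0 <= a / 2)); last lra.
have := ler_norm (sin (b / 2)).
by move=> *; nra.
Qed.

(** Quasisymmetry compares chords, which control arcs only up to length pi. Hence two regimes: for
    small steps both images have length at most pi and [sin_chord_le] applies; for larger steps both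
    increments lie between a positive gap [c] and 2 pi. *)
Lemma qs_lift_doubling (phi : circle R -> circle R) f :
  circle_lift f -> (forall t, phi (cis t) = cis (f t)) -> quasisymmetric phi ->
  exists2 M, 1 < M & doubling f M (2 * pi).
Proof.
move=> lf fphi [C C0 qs]; have [cf fi fT] := lf; have p0 := pi_gt0 R.
have [g [lg fK gK]] := circle_lift_inv lf.
(* [t0] bounds the gaps [g (y + pi) - g y] from below, so [f] stretches a step of at most [t0] to at
   most pi. *)
have [t0 t00 t0P] := circle_lift_gap lg p0.
have fl := circle_lift_mono lf.
have ft0 x t : t <= t0 -> f (x + t) - f x <= pi.
  move=> tt0; rewrite lerBlDl -(gK (f x + pi)) fl.
  by have := t0P (f x); rewrite fK; lra.
have lhs x h : 0 < h -> 0 < f (x + h) - f x by move=> h0; rewrite subr_gt0; apply: fi; lra.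
pose t1 := Num.min t0 pi.
have t10 : 0 < t1 by rewrite lt_min t00.
have t1t0 : t1 <= t0 by rewrite ge_min lexx.
have t1pi : t1 <= pi by rewrite ge_min lexx orbT.
have small x h : 0 < h <= t1 ->
    f (x + h) - f x <= 4 * C * (f x - f (x - h)) /\
    f x - f (x - h) <= 4 * C * (f (x + h) - f x).
  move=> /andP[h0 ht1].
  (* Quasisymmetry is stated for base points in a single period. *)
  wlog x0 : x / 0 <= x <= 2 * pi.
    move=> W; pose n := Num.floor (x / (2 * pi)).
    have /andP[] := floor_itv (x / (2 * pi)).
    have p20 : 0 < 2 * pi :> R by lra.
    rewrite -/n ler_pdivlMr// ltr_pdivrMr// intrD => n1 n2.
    have := W (x + (- n)%:~R * (2 * pi)); rewrite (addrAC x _ h) (addrAC x _ (- h)) !(circle_liftD2piZ _ _ lf).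
    by case; [rewrite mulrNz; lra|move=> w1 w2; split; lra].
  have A0 := lhs x h h0; have B0 := lhs (x - h) h h0; rewrite subrK in B0.
  have A1 := ft0 x h (le_trans ht1 t1t0); have B1 := ft0 (x - h) h (le_trans ht1 t1t0).
  rewrite subrK in B1.
  have := qs x h x0; rewrite h0/= => /(_ _)/andP[]; first lra.
  rewrite !fphi !(_ : forall t, cval (cis t) = expi t)// Normc.normcM Normc.normcV !normc_expiB.
  have sB : 0 < `|sin ((f x - f (x - h)) / 2)| by rewrite normr_gt0 gt_eqF// sin_half_gt0//; lra.
  have sA : 0 < `|sin ((f (x + h) - f x) / 2)| by rewrite normr_gt0 gt_eqF// sin_half_gt0//; lra.
  rewrite ler_pdivlMr; last lra.
  rewrite ler_pdivrMr; last lra.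
  rewrite ler_pdivrMl// => q1 q2.
  by split; apply: sin_chord_le => //; lra.
have [c c0 cP] := circle_lift_gap lf t10.
have fincr x y : x <= y -> f x <= f y by rewrite fl.
exists (1 + 4 * C + 2 * pi / c); first by have := divr_gt0 (_ : 0 < 2 * pi) c0; lra.
move=> x h /andP[h0 h2].
have q0 : 0 < 2 * pi / c by apply: divr_gt0 => //; lra.
have A0 := lhs x h h0; have B0 := lhs (x - h) h h0; rewrite subrK in B0.
have [ht1|ht1] := leP h t1.
  by have [|s1 s2] := small x h; [lra|split; nra].
have e : 2 * pi / c * c = 2 * pi by rewrite divfK// gt_eqF.
have A1 : c <= f (x + h) - f x.
  by apply: le_trans (cP x) _; rewrite lerD2r fl; lra.
have B1 : c <= f x - f (x - h).
  by have := cP (x - t1); rewrite subrK => /le_trans; apply; rewrite lerD2l lerN2 fl; lra.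
have A2 : f (x + h) - f x <= 2 * pi.
  by rewrite lerBlDl -fT fl; lra.
have B2 : f x - f (x - h) <= 2 * pi.
  by rewrite lerBlDl -fT fl; lra.
by split; nra.
Qed.

(** By contradiction: if the right image were more than [K] times the left one, of length [d], then
    [d] could be doubled [n] times from [g x] without reaching [g (x + h)]. The increment of [f]
    over the doubled interval starts from at least h / M and grows each time by a factor 1 + 1 / M,
    so once (1 + 1 / M)^n > M it exceeds [h], against [f (g (x + h)) = x + h]. *)
Lemma doubling_inv_step f g M H : {mono f : x y / x <= y} -> cancel f g -> cancel g f ->
  1 < M -> doubling f M (2 * pi) -> (forall x, g (x + H) - g x <= 2 * pi) ->
  exists2 K, 1 < K & forall x h, 0 < h <= H -> g (x + h) - g x <= K * (g x - g (x - h)).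
Proof.
move=> fl fK gK M1 fd gH.
have gl : {mono g : x y / x <= y} by move=> x y; rewrite -fl !gK.
have M0 : 0 < M^-1 by rewrite invr_gt0; lra.
(* Bernoulli's inequality: any [n] above M^2 works. *)
have [n nP] : exists n, M < (1 + M^-1) ^+ n.
  have [n nM] : exists n : nat, M * M < n%:R.
    by exists (Num.truncn (M * M)).+1; rewrite truncnS_gt.
  exists n; suff : 1 + n%:R * M^-1 <= (1 + M^-1) ^+ n.
    apply: lt_le_trans; rewrite -ltrBlDl ltr_pdivlMr; [nra|lra].
  elim: n {nM} => [|n IH]; first by rewrite mul0r addr0.
  rewrite exprS -natr1 mulrDl; have := ler0n R n; nra.
exists (2 ^+ n + 1); first by have := exprn_gt0 n (@ltr0Sn R 1); lra.
move=> x h /andP[h0 hH].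
set a := g (x - h); set b := g x; set c := g (x + h).
have fa : f a = x - h by rewrite /a gK.
have fb : f b = x by rewrite /b gK.
have fc : f c = x + h by rewrite /c gK.
have glt := leW_mono gl.
have ab : a < b by rewrite glt; lra.
have bc : b < c by rewrite glt; lra.
have cb : c - b <= 2 * pi by apply: le_trans (gH x); rewrite lerD2r gl; lra.
rewrite leNgt; apply/negP => bad.
set d := b - a in bad *.
have d0 : 0 < d by rewrite /d; lra.
have bad' : 2 ^+ n * d < c - b by lra.
have gk k : (k <= n)%N -> (1 + M^-1) ^+ k * (h * M^-1) <= f (b + 2 ^+ k * d) - f b.
  have dk i : (i <= n)%N -> 2 ^+ i * d <= 2 * pi.
    move=> hi; apply: le_trans cb; apply: ltW; apply: le_lt_trans bad'.
    by rewrite ler_pM2r// ler_weXn2l// ler1n.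
  elim: k => [|k IH] kn.
    rewrite !expr0 !mul1r ler_pdivrMr; last lra.
    have [|_] := fd b d; first by rewrite d0 -[d]mul1r -(expr0 2) dk.
    rewrite /d (_ : b - (b - a) = a); last ring.
    by rewrite fa fb; lra.
  have := IH (ltnW kn); set G := f (b + 2 ^+ k * d) - f b => G1.
  have [|_] := fd (b + 2 ^+ k * d) (2 ^+ k * d).
    by rewrite mulr_gt0 ?exprn_gt0//= dk// ltnW.
  rewrite addrK (_ : b + _ + _ = b + 2 ^+ k.+1 * d); last by rewrite exprS; ring.
  move=> G2; rewrite exprS.
  have G3 : M^-1 * G <= f (b + 2 ^+ k.+1 * d) - f (b + 2 ^+ k * d).
    by rewrite ler_pdivrMl//; lra.
  rewrite /G in G1 G3 *; nra.
have := gk n (leqnn _).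
have : f (b + 2 ^+ n * d) < f c by rewrite (leW_mono fl); lra.
rewrite fc fb => h1 h2.
have : M * (h * M^-1) < (1 + M^-1) ^+ n * (h * M^-1).
  by rewrite ltr_pM2r// mulr_gt0.
by rewrite mulrCA mulfV ?mulr1; [lra|rewrite gt_eqF//; lra].
Qed.

(** The second inequality is the one-sided step applied to the conjugates of both lifts by x |-> -
    x. *)
Lemma doubling_inv f g M : circle_lift f -> circle_lift g -> cancel f g -> cancel g f ->
  1 < M -> doubling f M (2 * pi) -> exists2 K, 1 < K & doubling g K pi.
Proof.
move=> lf lg fK gK M1 fd; have p0 := pi_gt0 R.
have gl := circle_lift_mono lg; have [_ _ gT] := lg.
have gpi x : g (x + pi) - g x <= 2 * pi.
  by rewrite lerBlDl -gT gl; lra.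
have [K1 K11 K1P] := doubling_inv_step (circle_lift_mono lf) fK gK M1 fd gpi.
have [K2 K21 K2P] : exists2 K, 1 < K & forall x h, 0 < h <= pi ->
    - g (- (x + h)) - - g (- x) <= K * (- g (- x) - - g (- (x - h))).
  apply: (@doubling_inv_step (fun x => - f (- x)) (fun x => - g (- x)) M pi).
  - by move=> x y; rewrite lerN2 (circle_lift_mono lf) lerN2.
  - by move=> x; rewrite opprK fK opprK.
  - by move=> x; rewrite opprK gK opprK.
  - exact: M1.
  - exact: doubling_opp.
  - by move=> x; rewrite opprD; have := gpi (- x - pi); rewrite subrK; lra.
exists (K1 + K2); first lra.
move=> x h hH; have /andP[h0 _] := hH.
have k1 := K1P x h hH; have := K2P (- x) h hH.
rewrite !opprD !opprK => k2.
have u0 : 0 <= g x - g (x - h) by rewrite subr_ge0 gl; lra.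
have v0 : 0 <= g (x + h) - g x by rewrite subr_ge0 gl; lra.
by move: u0 v0 k1 k2; move: (g x) (g (x - h)) (g (x + h)) => p q r *; split; nra.
Qed.

End CircleLift.

(** * Oscillation over dyadic arcs *)

Section Averages.
Variable R : realType.
Local Notation mu := (@lebesgue_measure R).
Implicit Types (P g : R -> R) (a b c d : R).

Lemma continuous_integrable_itv g a b : continuous g ->
  mu.-integrable `[a, b] (EFin \o g).
Proof.
move=> cg; apply: continuous_compact_integrable; first exact: segment_compact.
exact: continuous_subspaceT.
Qed.

Definition average P a b : R := (b - a)^-1 * \int[mu]_(t in `[a, b]) P t.

Definition variance_on P a b : R :=
  (b - a)^-1 * \int[mu]_(t in `[a, b]) (P t - average P a b) ^+ 2.

Lemma Rintegral_cst_itv a b k : a <= b -> \int[mu]_(t in `[a, b]) k = k * (b - a).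
Proof.
move=> ab; rewrite Rintegral_cst//= lebesgue_measure_itv/= lte_fin.
by case: ltP => //= ba; rewrite (_ : b - a = 0)//; lra.
Qed.

Lemma average_mul P a b : a < b -> \int[mu]_(t in `[a, b]) P t = (b - a) * average P a b.
Proof. by move=> ab; rewrite /average mulrA mulfV ?mul1r// gt_eqF// subr_gt0. Qed.

Lemma variance_on_ge0 P a b : a < b -> 0 <= variance_on P a b.
Proof.
move=> ab; rewrite mulr_ge0 ?invr_ge0//; first lra.
by apply: Rintegral_ge0 => x _; exact: sqr_ge0.
Qed.

Lemma continuous_sqrB P k : continuous P -> continuous (fun t => (P t - k) ^+ 2).
Proof.
move=> cP x; apply: (@continuous_comp _ _ _ (fun t => P t - k) (fun y => y ^+ 2)); last exact: exprn_continuous.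
by apply: cvgB; [exact: cP|exact: cvg_cst].
Qed.

(** Jensen's inequality by tangents: the integrand on the right lies above the affine function of
    [P] tangent to it at the average, whose integral is the left side. *)
Lemma sqr_average_le P k a b : continuous P -> a < b ->
  (b - a) * (average P a b - k) ^+ 2 <= \int[mu]_(t in `[a, b]) (P t - k) ^+ 2.
Proof.
move=> cP ab; set A := average P a b.
have -> : (b - a) * (A - k) ^+ 2 =
    \int[mu]_(t in `[a, b]) (2 * (A - k) * P t + (- 2 * (A - k) * k - (A - k) ^+ 2)).
  rewrite RintegralD//; last 2 first.
  - by apply: continuous_integrable_itv => x; apply: cvgM; [exact: cvg_cst|exact: cP].
  - by apply: continuous_integrable_itv => x; exact: cvg_cst.
  rewrite RintegralZl//; last exact: continuous_integrable_itv.
  by rewrite Rintegral_cst_itv ?(ltW ab)// average_mul// -/A; ring.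
apply: le_Rintegral => //.
- apply: continuous_integrable_itv => x; apply: cvgD; last exact: cvg_cst.
  by apply: cvgM; [exact: cvg_cst|exact: cP].
- by apply: continuous_integrable_itv; exact: continuous_sqrB.
- by move=> x _; have := sqr_ge0 (P x - k - (A - k)); nra.
Qed.

(** Jensen on the smaller interval, then enlargement of the domain; only the ratio of the lengths is
    lost. *)
Lemma average_subitv P a b c d : continuous P -> a <= c -> c < d -> d <= b ->
  (average P c d - average P a b) ^+ 2 <= (b - a) / (d - c) * variance_on P a b.
Proof.
move=> cP ac cd db; set A := average P a b.
have dc : 0 < d - c by lra.
have ba : 0 < b - a by lra.
rewrite mulrAC ler_pdivlMr// mulrC (le_trans (sqr_average_le A cP cd))//.
rewrite /variance_on mulrA mulfV ?mul1r ?gt_eqF//.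
have ci u v : mu.-integrable `[u, v] (EFin \o (fun t => (P t - A) ^+ 2)).
  by apply: continuous_integrable_itv; exact: continuous_sqrB.
rewrite -lee_fin /Rintegral !fineK; try exact: integrable_fin_num (ci _ _).
apply: ge0_subset_integral => //.
- by case/integrableP : (ci a b).
- by move=> x _; rewrite lee_fin sqr_ge0.
- by move=> x /=; rewrite !in_itv/= => /andP[h1 h2]; apply/andP; split; lra.
Qed.

Lemma average_dist P L x a b : continuous P -> a < b -> a <= x <= b ->
  (forall s t, `|P s - P t| <= L * `|s - t|) ->
  (P x - average P a b) ^+ 2 <= L ^+ 2 * (b - a) ^+ 2.
Proof.
move=> cP ab /andP[ax xb] PL.
have L0 : 0 <= L by have := PL 1 0; rewrite subr0 normr1 mulr1; apply: le_trans.
have := sqr_average_le (P x) cP ab.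
have H : \int[mu]_(t in `[a, b]) (P t - P x) ^+ 2 <= L ^+ 2 * (b - a) ^+ 2 * (b - a).
  rewrite -Rintegral_cst_itv ?(ltW ab)//; apply: le_Rintegral => //.
  - by apply: continuous_integrable_itv; exact: continuous_sqrB.
  - by apply: continuous_integrable_itv => y; exact: cvg_cst.
  - move=> t /=; rewrite in_itv/= => /andP[ta tb].
    rewrite -exprMn -[X in X <= _]real_normK ?num_real//.
    rewrite lerXn2r ?nnegrE//; first by rewrite mulr_ge0//; lra.
    apply: (le_trans (PL _ _)); rewrite ler_wpM2l// ler_norml; apply/andP; split; lra.
move=> /le_trans/(_ H); rewrite mulrC ler_pM2r ?subr_gt0//.
by rewrite -(sqrrN (P x - _)) opprB.
Qed.

End Averages.

(** * Telescoping with geometric weights *)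

Section Telescoping.
Variable R : realFieldType.

(** Young's inequality, with a factor on the first square that may be close to 1, so that iterating
    it costs only a geometric weight. *)
Lemma sqrD_le_weighted (th x y : R) : 1 < th ->
  (x + y) ^+ 2 <= th * x ^+ 2 + th / (th - 1) * y ^+ 2.
Proof.
move=> th1; have t0 : 0 < th - 1 by lra.
rewrite -subr_ge0.
have -> : th * x ^+ 2 + th / (th - 1) * y ^+ 2 - (x + y) ^+ 2 =
   (th - 1)^-1 * ((th - 1) * x - y) ^+ 2.
  by field; rewrite gt_eqF.
by rewrite mulr_ge0 ?sqr_ge0// invr_ge0 ltW.
Qed.

(** The remainder is kept explicit: with th = 1 / beta and a last square of order beta^(2 N), it
    tends to 0 like beta^N. *)
Lemma telescoping_sqr (th K F : R) (a V : nat -> R) : 1 < th ->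
  (forall n, (a n - a n.+1) ^+ 2 <= K * V n) ->
  forall N j, (F - a j) ^+ 2 <=
    th / (th - 1) * K * (\sum_(n < N) th ^+ n * V (j + n)%N) + th ^+ N * (F - a (j + N)%N) ^+ 2.
Proof.
move=> th1 aV; have t0 : 0 < th - 1 by lra.
have c0 : 0 <= th / (th - 1) by rewrite divr_ge0//; lra.
elim=> [|N IH] j; first by rewrite big_ord0 mulr0 add0r expr0 mul1r addn0.
have -> : F - a j = (F - a j.+1) + (a j.+1 - a j) by ring.
apply: (le_trans (sqrD_le_weighted _ _ th1)).
have H1 := IH j.+1.
have H2 := aV j; rewrite -sqrrN opprB in H2.
rewrite big_ord_recl expr0 mul1r addn0.
have -> : \sum_(i < N) th ^+ bump 0 i * V (j + bump 0 i)%N =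
    th * \sum_(i < N) th ^+ i * V (j.+1 + i)%N.
  rewrite mulr_sumr; apply: eq_bigr => i _.
  by rewrite /bump add1n exprS addnS addSn mulrA.
rewrite [th ^+ N.+1]exprS addnS -addSn.
have := ler_wpM2l c0 H2; have := ler_wpM2l (_ : 0 <= th) H1.
move=> /(_ _)/wrap[]; first lra.
move: (\sum_(i < N) _) (th ^+ N) (V j) (F - a (j.+1 + N)%N) (F - a j.+1) (a j.+1 - a j) (th / (th - 1)).
by move=> S T v e f g c h1 h2; rewrite mulrDr; lra.
Qed.

Lemma sqr_sum4_le (u v w t : R) :
  (u + v + w + t) ^+ 2 <= 4 * (u ^+ 2 + v ^+ 2 + w ^+ 2 + t ^+ 2).
Proof.
rewrite -subr_ge0 (_ : _ - _ = (u - v) ^+ 2 + (u - w) ^+ 2 + (u - t) ^+ 2 +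
  (v - w) ^+ 2 + (v - t) ^+ 2 + (w - t) ^+ 2); last by ring.
by rewrite !addr_ge0// sqr_ge0.
Qed.

Lemma sum4_bound (D E T S1 S2 t1 t2 t3 t4 v1 v2 : R) :
  t1 <= D * S1 + T -> t2 <= E * v1 -> t3 <= E * v2 -> t4 <= D * S2 + T ->
  E * v1 <= E * S1 -> E * v2 <= E * S2 ->
  4 * (t1 + t2 + t3 + t4) <= (4 * D + 4 * E) * (S1 + S2) + 8 * T.
Proof. by move=> *; nra. Qed.

End Telescoping.

(** * Images of dyadic arcs under a doubling lift *)

Section ScaleEstimate.
Variable R : realType.
Implicit Types (g P : R -> R) (M x z r : R).

Definition scale (m : nat) : R := pi / 2 ^+ m.

(** Left end of the [g]-image of the dyadic arc of centre [x] and half-length [scale m]; at [m = 0]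
    the arc is a full turn. *)
Definition arcl g x m := g (x - scale m).
Definition arcr g x m := g (x + scale m).
Definition arclen g x m := arcr g x m - arcl g x m.

Lemma scale_gt0 m : 0 < scale m.
Proof. by rewrite divr_gt0 ?pi_gt0// exprn_gt0. Qed.

Lemma scaleS m : scale m = 2 * scale m.+1.
Proof. by rewrite /scale exprS; field; rewrite gt_eqF// exprn_gt0. Qed.

Lemma scale_le_pi m : scale m <= pi.
Proof.
by rewrite ler_pdivrMr ?exprn_gt0// ler_peMr ?pi_ge0// exprn_ege1// ler1n.
Qed.

Lemma head_le_weighted_sum (b : R) (v : nat -> R) N : 0 <= b -> (forall n, 0 <= v n) ->
  v 0%N <= \sum_(n < N.+1) b ^- n * v n.
Proof.
move=> b0 v0; rewrite big_ord_recl /= expr0 invr1 mul1r lerDl.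
by apply: sumr_ge0 => i _; rewrite mulr_ge0// invr_ge0 exprn_ge0.
Qed.

Section lift.
Variables (g : R -> R) (M : R).
Hypotheses (lg : circle_lift g) (M1 : 1 < M) (gd : doubling g M pi).

(** By doubling, each half of the inner arc is at most [M] times the adjacent outer piece, so the
    inner arc takes at most this fraction of the whole. It exceeds 1 / 2 since M > 1. *)
Let beta := M / (1 + M).

Let gl := circle_lift_mono lg.
Let glt x y : (g x < g y) = (x < y). Proof. exact: leW_mono. Qed.

Lemma arclen_gt0 x m : 0 < arclen g x m.
Proof. by rewrite subr_gt0 glt; have := scale_gt0 m; lra. Qed.

Lemma arclen_contract x m : arclen g x m.+1 <= beta * arclen g x m.
Proof.
rewrite /arclen /arcr /arcl (scaleS m); set r := scale m.+1.
have r0 : 0 < r := scale_gt0 _.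
have rpi : r <= pi := scale_le_pi _.
have := gd (x + r) (_ : 0 < r <= pi); have := gd (x - r) (_ : 0 < r <= pi).
rewrite r0 rpi => /(_ isT)[a1 a2] /(_ isT)[b1 b2].
rewrite addrK in b1 b2; rewrite subrK in a1 a2.
rewrite (_ : x - 2 * r = x - r - r); last ring.
rewrite (_ : x + 2 * r = x + r + r); last ring.
have m1 := M1; have MM : 0 < 1 + M by lra.
rewrite /beta mulrAC ler_pdivlMr//.
by nra.
Qed.

Lemma arclen_double x m : g (x + 2 * scale m) - g (x - 2 * scale m) <= (1 + M) * arclen g x m.
Proof.
rewrite /arclen /arcr /arcl; set r := scale m.
have r0 : 0 < r := scale_gt0 _.
have rpi : r <= pi := scale_le_pi _.
have := gd (x + r) (_ : 0 < r <= pi); have := gd (x - r) (_ : 0 < r <= pi).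
rewrite r0 rpi => /(_ isT)[a1 a2] /(_ isT)[b1 b2].
rewrite addrK in b1 b2; rewrite subrK in a1 a2.
rewrite (_ : x - 2 * r = x - r - r); last ring.
rewrite (_ : x + 2 * r = x + r + r); last ring.
by nra.
Qed.

Lemma arclen0 x : arclen g x 0 = 2 * pi.
Proof.
rewrite /arclen /arcr /arcl /scale expr0 divr1; have [_ _ gT] := lg.
by rewrite (_ : x + pi = x - pi + 2 * pi) ?gT; ring.
Qed.

Lemma beta01 : 0 < beta < 1.
Proof.
have m1 := M1; have MM : 0 < 1 + M by lra.
by rewrite /beta divr_gt0 ?ltr_pdivrMr//; lra.
Qed.

Lemma arclen_le x m n : arclen g x (m + n) <= beta ^+ n * arclen g x m.
Proof.
have /andP[b0 b1] := beta01.
elim: n => [|n IH]; first by rewrite addn0 expr0 mul1r.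
rewrite addnS exprS -mulrA (le_trans (arclen_contract _ _))//.
by rewrite ler_wpM2l// ltW.
Qed.

Let av P x m := average P (arcl g x m) (arcr g x m).
Let var P x m := variance_on P (arcl g x m) (arcr g x m).

Lemma arcl_lt_arcr x m : arcl g x m < arcr g x m.
Proof. by rewrite -subr_gt0; exact: arclen_gt0. Qed.

Lemma average_step P x m : continuous P ->
  (av P x m - av P x m.+1) ^+ 2 <= (1 + M) * var P x m.
Proof.
move=> cP; rewrite -sqrrN opprB.
apply: (le_trans (average_subitv cP _ (arcl_lt_arcr x m.+1) _)).
- by rewrite /arcl gl (scaleS m); have := scale_gt0 m.+1; lra.
- by rewrite /arcr gl (scaleS m); have := scale_gt0 m.+1; lra.
rewrite ler_wpM2r ?variance_on_ge0 ?arcl_lt_arcr//.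
rewrite ler_pdivrMr ?arclen_gt0//.
have := arclen_double x m.+1; rewrite -scaleS; exact.
Qed.

(** The Lipschitz bound controls the last square by that of an arc of length at most 2 pi beta^N;
    the telescoping weight beta^-N leaves beta^N. *)
Lemma point_average P L x j N : continuous P ->
  (forall s t, `|P s - P t| <= L * `|s - t|) ->
  (P (g x) - av P x j) ^+ 2 <=
    beta^-1 / (beta^-1 - 1) * (1 + M) * (\sum_(n < N) beta ^- n * var P x (j + n)%N) +
    L ^+ 2 * (2 * pi) ^+ 2 * beta ^+ N.
Proof.
move=> cP PL; have /andP[b0 b1] := beta01.
have th1 : 1 < beta^-1 by rewrite invf_gt1.
have := @telescoping_sqr R beta^-1 (1 + M) (P (g x)) (av P x) (var P x) th1
  (fun n => average_step _ _ cP) N j.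
under eq_bigr do rewrite exprVn.
move=> /le_trans; apply; rewrite lerD2l exprVn mulrC ler_pdivrMr ?exprn_gt0//.
have H : (P (g x) - av P x (j + N)) ^+ 2 <= L ^+ 2 * (arclen g x (j + N)) ^+ 2.
  apply: average_dist => //; first exact: arcl_lt_arcr.
  by rewrite /arcl /arcr !gl; have := scale_gt0 (j + N); lra.
apply: (le_trans H).
rewrite (_ : _ * _ * _ * _ = L ^+ 2 * (2 * pi * beta ^+ N) ^+ 2); last by ring.
rewrite ler_wpM2l ?sqr_ge0// lerXn2r ?nnegrE ?(ltW (arclen_gt0 _ _))//.
  by rewrite mulr_ge0 ?exprn_ge0 ?(ltW b0)//; have := pi_ge0 R; lra.
rewrite mulrC (le_trans (arclen_le _ _ _))// ler_wpM2l ?exprn_ge0 ?(ltW b0)//.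
rewrite -(arclen0 x) -[j]add0n (le_trans (arclen_le _ _ _))//.
by rewrite ler_piMl ?(ltW (arclen_gt0 _ _))// exprn_ile1 ?(ltW b0) ?ltW.
Qed.

(** The arc about [x] stays within distance 5 r of [z]. Two doublings with step 2 r on each side of
    the arc from z - r to z + r reach that far, at a cost of 1 + 2 M + 2 M^2. *)
Lemma arclen_cover z r x j : 0 < r <= pi / 2 -> scale j < 4 * r -> `|x - z| <= r ->
  arclen g x j <= 2 * (1 + M) ^+ 2 * (g (z + r) - g (z - r)).
Proof.
move=> /andP[r0 r2] sj; rewrite ler_norml => /andP[x1 x2].
have rr : 0 < 2 * r <= pi by apply/andP; split; lra.
have [a1 _] := gd (z + r) rr; have [_ b2] := gd (z - r) rr.
have [c1 _] := gd (z + r + 2 * r) rr; have [_ d2] := gd (z - r - 2 * r) rr.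
rewrite addrK in c1; rewrite subrK in d2.
rewrite (_ : z + r - 2 * r = z - r) in a1; last ring.
rewrite (_ : z - r + 2 * r = z + r) in b2; last ring.
have s0 := scale_gt0 j.
have h1 : g (x + scale j) <= g (z + r + 2 * r + 2 * r) by rewrite gl; lra.
have h2 : g (z - r - 2 * r - 2 * r) <= g (x - scale j) by rewrite gl; lra.
rewrite /arclen /arcr /arcl.
have h0 : 0 < g (z + r) - g (z - r) by rewrite subr_gt0 glt; lra.
move: (g (z + r + 2 * r + 2 * r)) (g (z - r - 2 * r - 2 * r)) (g (z + r + 2 * r)) (g (z - r - 2 * r)) (g (z + r)) (g (z - r)) (g (x + _)) (g (x - _)) a1 b2 c1 d2 h1 h2 h0 => p1 p2 p3 p4 p5 p6 p7 p8 *.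
have m1 := M1; have M0 : 0 <= M by lra.
have q1 : p1 - p3 <= M * (M * (p5 - p6)) by apply: le_trans (ler_wpM2l M0 _); eassumption.
have q2 : p4 - p2 <= M * (M * (p5 - p6)) by apply: le_trans (ler_wpM2l M0 _); eassumption.
have : p7 - p8 <= (1 + 2 * M + 2 * (M * M)) * (p5 - p6) by rewrite !mulrDl mul1r -!mulrA; lra.
move/le_trans; apply; rewrite ler_pM2r//; nra.
Qed.

(** The two values are joined through three averages: about [z + r] at scale [j], over the image of
    the arc from z - r to z + r, and about [z - r] at scale [j]. The lower bound on [scale j] puts
    the middle arc inside both others; the upper bound makes the lengths comparable. *)
Lemma increment_bound P L : continuous P ->
  (forall s t, `|P s - P t| <= L * `|s - t|) ->
  exists C1, forall z r j N, 0 < r <= pi / 2 -> 2 * r <= scale j < 4 * r ->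
  (P (g (z + r)) - P (g (z - r))) ^+ 2 <=
    (4 * (beta^-1 / (beta^-1 - 1) * (1 + M)) + 4 * (2 * (1 + M) ^+ 2)) *
      (\sum_(n < N.+1) beta ^- n * (var P (z + r) (j + n)%N + var P (z - r) (j + n)%N)) +
    C1 * beta ^+ N.+1.
Proof.
move=> cP PL; exists (8 * (L ^+ 2 * (2 * pi) ^+ 2)) => z r j N r0 /andP[r1 r2].
have m1 := M1; have /andP[b0 b1] := beta01.
have pt x := point_average x j N.+1 cP PL.
set D := beta^-1 / (beta^-1 - 1) * (1 + M) in pt *.
have D0 : 0 <= D.
  have : 1 < beta^-1 by rewrite invf_gt1.
  by move=> ?; rewrite !mulr_ge0 ?invr_ge0; lra.
have rr : 0 < 2 * r by lra.
set A := average P (g (z - r)) (g (z + r)).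
have gz : g (z - r) < g (z + r) by rewrite glt; lra.
have near x : `|x - z| <= r -> (A - av P x j) ^+ 2 <= 2 * (1 + M) ^+ 2 * var P x j.
  move=> xz; have := arclen_cover r0 r2 xz => cov.
  move: xz; rewrite ler_norml => /andP[x1 x2].
  apply: (le_trans (average_subitv cP _ gz _)); try by rewrite /arcl /arcr gl; lra.
  rewrite ler_wpM2r ?variance_on_ge0 ?arcl_lt_arcr//.
  by rewrite ler_pdivrMr ?subr_gt0.
have n1 : (A - av P (z + r) j) ^+ 2 <= 2 * (1 + M) ^+ 2 * var P (z + r) j.
  by apply: near; rewrite addrAC subrr add0r ger0_norm//; lra.
have n2 : (A - av P (z - r) j) ^+ 2 <= 2 * (1 + M) ^+ 2 * var P (z - r) j.
  by apply: near; rewrite addrAC subrr add0r normrN ger0_norm//; lra.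
have v0 x m : 0 <= var P x m by rewrite variance_on_ge0 ?arcl_lt_arcr.
have sumle x : var P x j <= \sum_(n < N.+1) beta ^- n * var P x (j + n)%N.
  have := @head_le_weighted_sum beta (fun n => var P x (j + n)%N) N (ltW b0) (fun n => v0 _ _).
  by rewrite addn0.
have E2 : 0 <= 2 * (1 + M) ^+ 2 by rewrite mulr_ge0// sqr_ge0.
have s1 := ler_wpM2l E2 (sumle (z + r)); have s2 := ler_wpM2l E2 (sumle (z - r)).
under eq_bigr do rewrite mulrDr.
rewrite big_split/=.
have p1 := pt (z + r); have p2 := pt (z - r).
have -> : P (g (z + r)) - P (g (z - r)) = (P (g (z + r)) - av P (z + r) j)
  + - (A - av P (z + r) j) + (A - av P (z - r) j) + - (P (g (z - r)) - av P (z - r) j) by ring.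
apply: (le_trans (sqr_sum4_le _ _ _ _)); rewrite !sqrrN.
rewrite -(mulrA 8); exact: sum4_bound p1 n1 n2 p2 s1 s2.
Qed.

End lift.
End ScaleEstimate.

(** * Weighted series in the extended reals *)

Section ErealSeries.
Variable R : realType.
Local Open Scope ereal_scope.

Lemma nneseries_le_bound (u : nat -> \bar R) (B : \bar R) : (forall n, 0 <= u n) ->
  (forall N, \sum_(0 <= n < N) u n <= B) -> \sum_(0 <= n <oo) u n <= B.
Proof.
move=> u0 uB; apply: lime_le; first exact: is_cvg_nneseries.
by apply: nearW => n; exact: uB.
Qed.

Lemma geometric_nneseries_le (c : R) (S : \bar R) : (0 < c < 1)%R -> 0 <= S ->
  \sum_(0 <= n <oo) ((c ^+ n)%R%:E * S) <= ((1 - c)^-1)%R%:E * S.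
Proof.
move=> /andP[c0 c1] S0; apply: nneseries_le_bound.
  by move=> n; rewrite mule_ge0// lee_fin exprn_ge0// ltW.
move=> N; rewrite -ge0_sume_distrl; last by move=> n _; rewrite lee_fin exprn_ge0// ltW.
rewrite sumEFin lee_wpmul2r// lee_fin.
have := @geometric_le_lim R N 1%R c ler01 c0; rewrite ger0_norm ?(ltW c0)// => /(_ c1).
by rewrite mul1r /series/=; under eq_bigr do rewrite mul1r.
Qed.

(** After exchanging the sums, each tail of [a] is at most the full series and the weights form a
    geometric series. *)
Lemma weighted_double_series (a : nat -> \bar R) (c : R) : (0 < c < 1)%R ->
  (forall n, 0 <= a n) ->
  \sum_(0 <= j <oo) \sum_(0 <= n <oo) ((c ^+ n)%R%:E * a (j + n)%N)
    <= ((1 - c)^-1)%R%:E * \sum_(0 <= m <oo) a m.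
Proof.
move=> c01 a0; have /andP[c0 c1] := c01.
have cn n : (0 <= c ^+ n)%R by rewrite exprn_ge0// ltW.
rewrite (@nneseries_interchange _ _ xpredT xpredT); last first.
  by move=> i j; rewrite mule_ge0// lee_fin.
apply: le_trans (geometric_nneseries_le c01 _); last exact: nneseries_ge0.
apply: lee_nneseries => [n _ _|n _].
  by apply: nneseries_ge0 => j _ _; rewrite mule_ge0// lee_fin.
rewrite nneseriesZl; last by move=> *; exact: a0.
rewrite lee_wpmul2l ?lee_fin//.
rewrite (nneseries_addn n a0) [leRHS](@nneseries_split _ a 0 n)//.
by rewrite add0n leeDr// sume_ge0.
Qed.

End ErealSeries.

Section MeasurableIf.
Context d (T : measurableType d) (R : realType).

Lemma measurable_if_le (a b : T -> R) (h : T -> R) :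
  measurable_fun setT a -> measurable_fun setT b -> measurable_fun setT h ->
  measurable_fun setT (fun x => if a x <= b x then h x else 0).
Proof.
move=> ma mb mh; apply: measurable_fun_ifT => //.
exact: measurable_fun_ler.
Qed.

Lemma measurable_funV (h : T -> R) : measurable_fun setT h ->
  measurable_fun setT (fun x => (h x)^-1).
Proof.
move=> mh.
(* Powers with a real exponent are measurable; at a zero of [h] both sides are 0. *)
have -> : (fun x => (h x)^-1) = (fun x => h x * (h x ^+ 2) `^ (-1)).
  apply/funext => x; rewrite powR_inv1 ?sqr_ge0//.
  have [->|h0] := eqVneq (h x) 0; first by rewrite invr0 mul0r.
  by rewrite expr2 invfM mulrA mulfV// mul1r.
apply: measurable_funM => //.
apply: (@measurableT_comp _ _ _ _ _ _ (fun y : R => y `^ (-1))).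
  exact: measurable_powR.
exact: measurable_funX.
Qed.

End MeasurableIf.

(** * Lebesgue measure on the plane and Tonelli's theorem *)

Section PlaneMeasure.
Variable R : realType.
Local Notation mu := (@lebesgue_measure R).

(* A constant for the product measure, so that it can itself be used as a
   factor in Fubini's theorem. *)
Definition plane : set (measurableTypeR R * measurableTypeR R)%type -> \bar R := (mu \x mu)%E.

Let plane_sigma_finite : sigma_finite setT plane.
Proof.
have /sigma_finiteP[F [TF ndF Foo]] := sigma_finiteT mu.
exists (fun n => F n `*` F n).
  apply/esym; rewrite -subTset => -[x y] _.
  have [n _ nx] : (\bigcup_n F n) x by rewrite -TF.
  have [m _ my] : (\bigcup_n F n) y by rewrite -TF.
  exists (maxn n m) => //; split; [move: nx|move: my]; apply/subsetPset/ndF.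
    exact: leq_maxl.
  exact: leq_maxr.
move=> n; have [mF Fy] := Foo n; split; first exact: measurableX.
by rewrite /plane product_measure1E// lte_mul_pinfty// ge0_fin_numE.
Qed.

HB.instance Definition _ := Measure.on plane.
HB.instance Definition _ := Measure_isSigmaFinite.Build _ _ _ plane plane_sigma_finite.

Lemma plane_tonelli1 (f : R * R -> \bar R) : measurable_fun setT f -> (forall x, 0 <= f x)%E ->
  (\int[plane]_z f z = \int[mu]_x \int[mu]_y f (x, y))%E.
Proof. by move=> mf f0; exact: (@fubini_tonelli1 _ _ (measurableTypeR R) (measurableTypeR R) R mu mu f mf f0). Qed.

Lemma plane_tonelli2 (f : R * R -> \bar R) : measurable_fun setT f -> (forall x, 0 <= f x)%E ->
  (\int[plane]_z f z = \int[mu]_y \int[mu]_x f (x, y))%E.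
Proof. by move=> mf f0; exact: (@fubini_tonelli2 _ _ (measurableTypeR R) (measurableTypeR R) R mu mu f mf f0). Qed.

Lemma line_tonelli (f : R * R -> \bar R) : measurable_fun setT f -> (forall x, 0 <= f x)%E ->
  (\int[mu]_x \int[mu]_y f (x, y) = \int[mu]_y \int[mu]_x f (x, y))%E.
Proof. by move=> mf f0; rewrite -plane_tonelli1// -plane_tonelli2. Qed.

Lemma line_plane_tonelli (f : R * (R * R) -> \bar R) : measurable_fun setT f -> (forall x, 0 <= f x)%E ->
  (\int[mu]_x \int[plane]_y f (x, y) = \int[plane]_y \int[mu]_x f (x, y))%E.
Proof. by move=> mf f0; exact: (fubini_tonelli (m1 := mu) (m2 := plane) f mf f0). Qed.

Lemma measurable_integral_line d (T : measurableType d) (f : T * R -> \bar R) : measurable_fun setT f ->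
  (forall x, 0 <= f x)%E -> measurable_fun setT (fun x => \int[mu]_y f (x, y))%E.
Proof. by move=> mf f0; exact: (measurable_fun_fubini_tonelli_F (m2 := mu) f mf f0). Qed.

Lemma measurable_integral_plane d (T : measurableType d) (f : T * (R * R) -> \bar R) :
  measurable_fun setT f -> (forall x, 0 <= f x)%E ->
  measurable_fun setT (fun x => \int[plane]_y f (x, y))%E.
Proof. by move=> mf f0; exact: (measurable_fun_fubini_tonelli_F (m2 := plane) f mf f0). Qed.

End PlaneMeasure.
Arguments plane {R}.

(** * Mean oscillation over image arcs *)

Section Oscillation.
Variable R : realType.
Local Notation mu := (@lebesgue_measure R).
Implicit Types (g P : R -> R).

(** Integrated in [y], this is the mean of [(P y.1 - P y.2) ^+ 2] over the square of the image arc,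
    which is twice the variance. Unlike the variance it involves no average depending on [x], so
    Tonelli can fix [y] and let [x] vary. *)
Definition oscillation_kernel g P (m : nat) (x : R) (y : R * R) : R :=
  if (arcl g x m <= y.1) then if (y.1 <= arcr g x m) then
  if (arcl g x m <= y.2) then if (y.2 <= arcr g x m) then
    (arclen g x m) ^- 2 * (P y.1 - P y.2) ^+ 2 else 0 else 0 else 0 else 0.

Definition oscillation g P m x : \bar R :=
  (\int[plane]_y (oscillation_kernel g P m x y)%:E)%E.

Lemma oscillation_kernel_ge0 g P m x y : 0 <= oscillation_kernel g P m x y.
Proof.
rewrite /oscillation_kernel; do 4 case: ifP => // _.
by rewrite mulr_ge0 ?sqr_ge0// invr_ge0 sqr_ge0.
Qed.

Lemma oscillation_ge0 g P m x : (0 <= oscillation g P m x)%E.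
Proof. by apply: integral_ge0 => y _; rewrite lee_fin oscillation_kernel_ge0. Qed.

Lemma measurable_oscillation_kernel g P m : continuous g -> continuous P ->
  measurable_fun setT (fun xy : R * (R * R) => oscillation_kernel g P m xy.1 xy.2).
Proof.
move=> cg cP.
have mg : measurable_fun setT g by exact: continuous_measurable_fun.
have mP : measurable_fun setT P by exact: continuous_measurable_fun.
have m1 : measurable_fun setT (fun xy : R * (R * R) => xy.1) by exact: measurable_fst.
have m2 : measurable_fun setT (fun xy : R * (R * R) => xy.2.1).
  by apply: measurableT_comp; [exact: measurable_fst|exact: measurable_snd].
have m3 : measurable_fun setT (fun xy : R * (R * R) => xy.2.2).
  by apply: measurableT_comp; [exact: measurable_snd|exact: measurable_snd].
have ml : measurable_fun setT (fun xy : R * (R * R) => arcl g xy.1 m).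
  by apply: measurableT_comp => //; exact: measurable_funB.
have mr : measurable_fun setT (fun xy : R * (R * R) => arcr g xy.1 m).
  by apply: measurableT_comp => //; exact: measurable_funD.
do 4 apply: measurable_if_le => //.
apply: measurable_funM; last first.
  by apply: measurable_funX; apply: measurable_funB; apply: measurableT_comp.
by apply: measurable_funV; apply: measurable_funX; exact: measurable_funB.
Qed.

Lemma measurable_oscillation g P m : continuous g -> continuous P ->
  measurable_fun setT (oscillation g P m).
Proof.
move=> cg cP.
have mk : measurable_fun setT (fun xy : R * (R * R) => (oscillation_kernel g P m xy.1 xy.2)%:E).
  by apply/measurable_EFinP; exact: measurable_oscillation_kernel.
apply: (@measurable_integral_plane R _ _ _ mk).
by move=> x; rewrite lee_fin oscillation_kernel_ge0.
Qed.

(** The average minimizes the mean square distance to a constant, because the cross term integrates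
    to 0. *)
Lemma sqr_dist_average_le P k a b : continuous P -> a < b ->
  (b - a) * variance_on P a b <= \int[mu]_(t in `[a, b]) (P t - k) ^+ 2.
Proof.
move=> cP ab; set A := average P a b.
have ba : b - a != 0 by rewrite gt_eqF// subr_gt0.
have i1 u : mu.-integrable `[a, b] (EFin \o (fun t => (P t - u) ^+ 2)).
  by apply: continuous_integrable_itv; exact: continuous_sqrB.
have ci u : continuous (fun _ : R => u : R) by move=> x; exact: cvg_cst.
have i2 : mu.-integrable `[a, b] (EFin \o (fun t => 2 * (A - k) * P t)).
  by apply: continuous_integrable_itv => x; apply: cvgM; [exact: ci|exact: cP].
have i3 : mu.-integrable `[a, b] (EFin \o (fun t : R => - (2 * (A - k) * A))).
  exact: continuous_integrable_itv.
have i4 : mu.-integrable `[a, b] (EFin \o (fun t => 2 * (A - k) * P t + - (2 * (A - k) * A))).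
  apply: continuous_integrable_itv => x; apply: cvgD; last exact: ci.
  by apply: cvgM; [exact: ci|exact: cP].
rewrite /variance_on -/A mulrA mulfV// mul1r.
have Z : \int[mu]_(t in `[a, b]) (2 * (A - k) * P t + - (2 * (A - k) * A)) = 0.
  rewrite RintegralD// RintegralZl//; last exact: continuous_integrable_itv.
  by rewrite Rintegral_cst_itv ?(ltW ab)// average_mul// -/A; ring.
rewrite -[leLHS]addr0 -Z -RintegralD//.
apply: le_Rintegral => //.
- have -> : (EFin \o (fun t => (P t - A) ^+ 2 + (2 * (A - k) * P t + - (2 * (A - k) * A)))) =
     (EFin \o (fun t => (P t - A) ^+ 2)) \+ (EFin \o (fun t => 2 * (A - k) * P t + - (2 * (A - k) * A))).
    by apply/funext => t /=; rewrite EFinD.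
  exact: integrableD.
- by move=> x _; have := sqr_ge0 (A - k); nra.
Qed.

(** For fixed [y.1] in the arc, the mean over [y.2] of the squared difference is at least the
    variance; averaging over [y.1] keeps this bound. *)
Lemma variance_le_oscillation g P m x : continuous g -> continuous P ->
  arcl g x m < arcr g x m ->
  ((variance_on P (arcl g x m) (arcr g x m))%:E <= oscillation g P m x)%E.
Proof.
move=> cg cP ab.
set a := arcl g x m; set b := arcr g x m.
have ba : 0 < b - a by rewrite subr_gt0.
have mk : measurable_fun setT (fun y => (oscillation_kernel g P m x y)%:E).
  apply/measurable_EFinP.
  exact: (measurable_fun_pair2 (f := fun xy => oscillation_kernel g P m xy.1 xy.2) x (measurable_oscillation_kernel m cg cP)).
rewrite /oscillation plane_tonelli1//; last by move=> y; rewrite lee_fin oscillation_kernel_ge0.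
pose V := variance_on P a b.
have V0 : 0 <= V by exact: variance_on_ge0.
have step t : ((if (a <= t <= b) then (b - a)^-1 * V else 0)%:E <=
    \int[mu]_t' (oscillation_kernel g P m x (t, t'))%:E)%E.
  case: ifPn => [/andP[at_ tb]|_]; last first.
    by apply: integral_ge0 => t' _; rewrite lee_fin oscillation_kernel_ge0.
  apply: (@le_trans _ _ (\int[mu]_(t' in `[a, b]) ((b - a) ^- 2 * (P t' - P t) ^+ 2)%:E)%E).
    rewrite -[X in (_ <= X)%E]fineK; last first.
      apply: integrable_fin_num => //.
      apply: (@continuous_integrable_itv _ (fun t' => (b - a) ^- 2 * (P t' - P t) ^+ 2)) => z.
      by apply: cvgM; [exact: cvg_cst|exact: continuous_sqrB].
    rewrite lee_fin -/(Rintegral mu `[a, b] (fun t' => (b - a) ^- 2 * (P t' - P t) ^+ 2)).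
    rewrite RintegralZl//; last by apply: continuous_integrable_itv; exact: continuous_sqrB.
    rewrite expr2 invfM -mulrA ler_wpM2l ?invr_ge0 ?(ltW ba)//.
    by rewrite mulrC ler_pdivlMr// mulrC sqr_dist_average_le.
  rewrite integral_mkcond; apply: ge0_le_integral => //.
  - move=> t' _; rewrite patchE; case: ifP => // _.
    by rewrite lee_fin mulr_ge0 ?sqr_ge0// invr_ge0 sqr_ge0.
  - apply/(measurable_restrictT _ _).1 => //; apply: measurable_funTS.
    apply/measurable_EFinP; apply: measurable_funM => //.
    by apply: continuous_measurable_fun; exact: continuous_sqrB.
  - exact: (measurable_fun_pair2 (f := fun y => (oscillation_kernel g P m x y)%:E) t mk).
  - move=> t' _; rewrite patchE; case: ifPn => [|_]; last by rewrite lee_fin oscillation_kernel_ge0.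
    rewrite inE/= in_itv/= => /andP[h1 h2].
    by rewrite lee_fin /oscillation_kernel/= -/a -/b at_ tb h1 h2 -(sqrrN (P t' - P t)) opprB.
apply: (@le_trans _ _ (\int[mu]_t (if (a <= t <= b) then (b - a)^-1 * V else 0)%:E)%E); last first.
  apply: ge0_le_integral => //.
  - by move=> t _; rewrite lee_fin; case: ifP => // _; rewrite mulr_ge0// invr_ge0 ltW.
  - apply/measurable_EFinP; apply: measurable_fun_ifT => //.
    by apply: measurable_and; apply: measurable_fun_ler.
  - apply: (measurable_integral_line mk) => y; by rewrite lee_fin oscillation_kernel_ge0.
have -> : (fun t => (if a <= t <= b then (b - a)^-1 * V else 0)%:E) =
   (fun _ => ((b - a)^-1 * V)%:E) \_ `[a, b].
  by apply/funext => t; rewrite patchE mem_setE in_itv/=; case: ifP.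
rewrite -integral_mkcond integral_cst//= lebesgue_measure_itv/= lte_fin ab -EFinB -EFinM.
by rewrite lee_fin mulrAC mulVf ?mul1r// gt_eqF.
Qed.

End Oscillation.

(** * Summation over dyadic scales *)

Section ScaleSums.
Variable R : realType.
Local Notation mu := (@lebesgue_measure R).
Implicit Types (g P : R -> R).

(** j + 1 is the first index whose scale falls below 2 r; the index 0 is excluded by r < pi / 2. *)
Lemma scale_select (r : R) : 0 < r < pi / 2 -> exists j, 2 * r <= scale R j < 4 * r.
Proof.
move=> /andP[r0 r2].
have ex : exists n, scale R n < 2 * r.
  exists (Num.truncn (pi / (2 * r))).+1.
  rewrite /scale ltr_pdivrMr ?exprn_gt0// mulrC -ltr_pdivrMr; last lra.
  apply: (lt_le_trans (truncnS_gt _)).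
  by rewrite -natrX ler_nat ltnW// ltn_expl.
have [n nP nmin] := ex_minnP ex.
case: n nP nmin => [|j] nP nmin; first by move: nP; rewrite /scale expr0; lra.
exists j; apply/andP; split.
  by rewrite leNgt; apply/negP => /nmin; rewrite ltnn.
by rewrite scaleS; lra.
Qed.

(** Passage to the limit in [N], where the majorant [Y] is allowed to be infinite. *)
Lemma lee_of_eps_geometric (x y C b : R) (Y : \bar R) : 0 < b < 1 -> (0 <= Y)%E ->
  (forall N, exists2 y, (y%:E <= Y)%E & x <= y + C * b ^+ N.+1) -> (x%:E <= Y)%E.
Proof.
move=> /andP[b0 b1] Y0 H.
case: Y Y0 H => [Y| |]// Y0 H; last by rewrite leey.
rewrite lee_fin; apply/ler_addgt0Pr => e e0.
have cb : (fun n => C * b ^+ n) @ \oo --> (0 : R).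
  by rewrite -[0](mulr0 C); apply: cvgM; [exact: cvg_cst|apply: cvg_expr; rewrite ger0_norm// ltW].
have /cvgrPdist_le/(_ e e0)[N _ NP] := cb.
have [z] := H N; rewrite lee_fin => zY; move/le_trans; apply.
have := NP N.+1 (leqnSn _); rewrite sub0r normrN => h.
by have := ler_norm (C * b ^+ N.+1); lra.
Qed.

Section lift.
Variables (g : R -> R) (M : R).
Hypotheses (lg : circle_lift g) (M1 : 1 < M) (gd : doubling g M pi).
Let beta := M / (1 + M).

Let cg : continuous g. Proof. by case: lg. Qed.

Let A := 4 * (beta^-1 / (beta^-1 - 1) * (1 + M)) + 4 * (2 * (1 + M) ^+ 2).

Let A0 : 0 <= A.
Proof.
have /andP[b0 b1] := beta01 M1; have m1 := M1.
have : 1 < beta^-1 by rewrite invf_gt1.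
move=> h; rewrite /A addr_ge0// !mulr_ge0 ?sqr_ge0 ?invr_ge0//; try lra.
exact: ltW.
Qed.

Lemma increment_le_oscillation P L : continuous P ->
  (forall s t, `|P s - P t| <= L * `|s - t|) ->
  forall z r j, 0 < r <= pi / 2 -> 2 * r <= scale R j < 4 * r ->
  (((P (g (z + r)) - P (g (z - r))) ^+ 2)%:E <=
    A%:E * \sum_(0 <= n <oo) ((beta ^- n)%:E *
       (oscillation g P (j + n) (z + r)%R + oscillation g P (j + n) (z - r)%R)))%E.
Proof.
move=> cP PL z r j r0 rj; have b01 := beta01 M1; have /andP[b0 b1] := b01.
have [C1 HC1] := increment_bound lg M1 gd cP PL.
have bn n : 0 <= beta ^- n by rewrite invr_ge0 exprn_ge0// ltW.
have o0 n : (0 <= oscillation g P (j + n) (z + r)%R + oscillation g P (j + n) (z - r)%R)%E.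
  by rewrite adde_ge0// oscillation_ge0.
apply: (@lee_of_eps_geometric _ 0 C1 beta) => //.
  rewrite mule_ge0 ?lee_fin//; apply: nneseries_ge0 => n _ _.
  by rewrite mule_ge0// lee_fin.
move=> N; exists (A * \sum_(n < N.+1) beta ^- n *
   (variance_on P (arcl g (z + r) (j + n)) (arcr g (z + r) (j + n)) +
    variance_on P (arcl g (z - r) (j + n)) (arcr g (z - r) (j + n)))); last first.
  by apply: le_trans (HC1 z r j N r0 rj) _.
rewrite EFinM lee_wpmul2l ?lee_fin//.
apply: (le_trans _ (nneseries_lim_ge N.+1 _)); last first.
  by move=> n _ _; rewrite mule_ge0// lee_fin.
rewrite big_mkord -sumEFin; apply: lee_sum => n _.
rewrite EFinM lee_wpmul2l ?lee_fin// EFinD.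
by apply: leeD; apply: variance_le_oscillation => //; exact: (arcl_lt_arcr lg).
Qed.

(** The window contains [z + r] and [z - r] for z in [0, 2 pi] and r < pi / 2, so the translates of
    one period stay inside it. *)
Let Gam P m := (\int[mu]_(x in `[(- pi)%R, (3 * pi)%R]) oscillation g P m x)%E.

Lemma increment_integral_le : exists2 B, 0 <= B & forall P L, continuous P ->
  (forall s t, `|P s - P t| <= L * `|s - t|) ->
  forall r j, 0 < r < pi / 2 -> 2 * r <= scale R j < 4 * r ->
  (\int[mu]_(z in `[0%R, (2 * pi)%R])
     ((sin r) ^- 2 * (P (g (z + r)%R) - P (g (z - r)%R)) ^+ 2)%:E <=
   (B / scale R j ^+ 2)%:E *
     \sum_(0 <= n <oo) ((beta ^- n)%:E * Gam P (j + n)))%E.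
Proof.
(* 512 = 2 * 256: from sin r >= r / 4 and scale j < 4 r, 1 / sin^2 r is at most 256 / scale^2, and
   the two centres [z + r] and [z - r] contribute the factor 2. *)
exists (512 * A) => [|P L cP PL r j]; first exact: mulr_ge0 (ler0n _ _) A0.
move=> /andP[r0 r2] rj; have b01 := beta01 M1; have /andP[b0 b1] := b01.
have p0 := pi_gt0 R.
have bn n : 0 <= beta ^- n by rewrite invr_ge0 exprn_ge0// ltW.
have mo n : measurable_fun setT (oscillation g P n) by exact: measurable_oscillation.
have mD c n : measurable_fun setT (fun z : R => oscillation g P n (z + c)%R).
  by apply: measurableT_comp => //; exact: measurable_funD.
have o0 n z c : (0 <= oscillation g P (j + n) (z + c)%R + oscillation g P (j + n) (z - c)%R)%E.
  by rewrite adde_ge0// oscillation_ge0.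
have s0 := scale_gt0 R j.
have sr : 0 < sin r by apply: sin_gt0_pihalf; rewrite r0.
have sinb : (sin r) ^- 2 <= 256 / scale R j ^+ 2.
  have sq : r / 4 <= sin r by apply: sin_ge_quarter; apply/andP; split; lra.
  rewrite -[leLHS]div1r ler_pdivrMr ?exprn_gt0// mulrAC ler_pdivlMr ?exprn_gt0// mul1r.
  have -> : 256 * sin r ^+ 2 = (16 * sin r) ^+ 2 by ring.
  by rewrite lerXn2r ?nnegrE//; lra.
have GD c n : `|c| <= pi / 2 ->
    (\int[mu]_(z in `[0%R, (2 * pi)%R]) oscillation g P n (z + c)%R <= Gam P n)%E.
  rewrite ler_norml => /andP[c1 c2].
  have -> : `[0, 2 * pi]%classic = (fun x : R => x + c) @^-1` `[c, 2 * pi + c]%classic.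
    by apply/seteqP; split => x /=; rewrite !in_itv/= => /andP[h1 h2]; apply/andP; split; lra.
  rewrite (@ge0_integral_shift R c `[c, 2 * pi + c]%classic (oscillation g P n)) //; last 2 first.
  - by apply: measurable_funTS; exact: mo.
  - by move=> x; exact: oscillation_ge0.
  apply: ge0_subset_integral => //; first by apply: measurable_funTS; exact: mo.
    by move=> x _; exact: oscillation_ge0.
  by move=> x /=; rewrite !in_itv/= => /andP[h1 h2]; apply/andP; split; lra.
have mX : measurable_fun setT (fun z : R => (P (g (z + r)) - P (g (z - r))) ^+ 2).
  by apply: measurable_funX; apply: measurable_funB; apply: measurableT_comp;
    [exact: continuous_measurable_fun|apply: measurableT_comp;
      [exact: continuous_measurable_fun|exact: measurable_funD]
    |exact: continuous_measurable_fun|apply: measurableT_comp;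
      [exact: continuous_measurable_fun|exact: measurable_funB]].
pose F n z := ((beta ^- n)%:E * (oscillation g P (j + n) (z + r)%R + oscillation g P (j + n) (z - r)%R))%E.
have F0 n z : (0 <= F n z)%E by rewrite mule_ge0 ?lee_fin.
have mF n : measurable_fun setT (F n).
  by apply: emeasurable_funM => //; apply: emeasurable_funD.
have mS : measurable_fun setT (fun z => \sum_(0 <= n <oo) F n z)%E.
  by apply: ge0_emeasurable_sum => // n z _ _; exact: F0.
have [K K0 [KE sinK]] : exists2 K, 0 <= K &
    512 * A / scale R j ^+ 2 = 2 * K /\ sin r ^- 2 * A <= K.
  exists (256 / scale R j ^+ 2 * A); last by split; [ring|exact: ler_wpM2r].
  by apply: mulr_ge0 A0; apply: le_trans sinb; rewrite invr_ge0 sqr_ge0.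
rewrite KE {KE sinb}.
apply: (@le_trans _ _ (\int[mu]_(z in `[0%R, (2 * pi)%R])
    (K%:E * \sum_(0 <= n <oo) F n z))%E).
  apply: ge0_le_integral => //.
  - by move=> z _; rewrite lee_fin mulr_ge0 ?sqr_ge0// invr_ge0 sqr_ge0.
  - apply: measurable_funTS; apply/measurable_EFinP; exact: measurable_funM.
  - by apply: measurable_funTS; apply: emeasurable_funM.
  - move=> z _.
    have S0 : (0 <= \sum_(0 <= n <oo) F n z)%E by apply: nneseries_ge0 => n _ _; exact: F0.
    apply: (@le_trans _ _ ((sin r ^- 2)%:E * (A%:E * \sum_(0 <= n <oo) F n z))%E).
      rewrite EFinM lee_wpmul2l ?lee_fin ?invr_ge0 ?sqr_ge0//.
      by apply: increment_le_oscillation PL _ _ _ _ _ => //; apply/andP; split; lra.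
    by rewrite muleA -EFinM lee_wpmul2r// lee_fin.
rewrite ge0_integralZl//; last 2 first.
- by apply: measurable_funTS; exact: mS.
- by move=> z _; apply: nneseries_ge0 => n _ _; exact: F0.
rewrite integral_nneseries//; last first.
  by move=> n; apply: measurable_funTS; exact: mF.
rewrite (mulrC 2 K) [X in (_ <= X * _)%E]EFinM -[X in (_ <= X)%E]muleA.
apply: lee_wpmul2l; first by rewrite lee_fin.
have G0 n : (0 <= Gam P n)%E by apply: integral_ge0 => x _; exact: oscillation_ge0.
rewrite -nneseriesZl; last by move=> n _; rewrite mule_ge0// lee_fin.
apply: lee_nneseries => [n _ _|n _]; first by apply: integral_ge0 => z _; exact: F0.
rewrite /F ge0_integralZl//; last 2 first.
- by apply: measurable_funTS; apply: emeasurable_funD; exact: mD.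
- by rewrite lee_fin.
rewrite muleCA lee_wpmul2l ?lee_fin//.
rewrite ge0_integralD//; try (by apply: measurable_funTS; exact: mD); last 2 first.
- by move=> z _; exact: oscillation_ge0.
- by move=> z _; exact: oscillation_ge0.
rewrite (_ : 2%:E = 1%:E + 1%:E)%E; last by rewrite -EFinD.
rewrite ge0_muleDl// !mul1e.
by apply: leeD; apply: GD; rewrite ?normrN gtr0_norm//; lra.
Qed.

Lemma energy_le_oscillation : exists2 C, 0 < C & forall P L, continuous P ->
  (forall s t, `|P s - P t| <= L * `|s - t|) ->
  (\int[mu]_(r in `]0%R, (pi / 2)%R[) \int[mu]_(z in `[0%R, (2 * pi)%R])
     ((sin r) ^- 2 * (P (g (z + r)%R) - P (g (z - r)%R)) ^+ 2)%:E <=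
   C%:E * \sum_(0 <= m <oo) ((2 ^+ m)%:E * Gam P m))%E.
Proof.
have b01 := beta01 M1; have /andP[b0 b1] := b01; have m1 := M1; have p0 := pi_gt0 R.
rewrite -/beta in b0 b1; have [B B0 HB] := increment_integral_le.
(* Writing beta^-n 2^j as c^n 2^(j + n) isolates the ratio that has to be summed; M > 1 gives beta >
   1 / 2, hence c < 1. *)
pose c := (2 * beta)^-1.
have c01 : 0 < c < 1.
  rewrite /c invr_gt0 invf_lt1; last lra.
  apply/andP; split; first lra.
  by rewrite /beta mulrA ltr_pdivlMr; lra.
have c10 : 0 < (1 - c)^-1 by rewrite invr_gt0; lra.
have d0 : 0 <= B / (4 * pi) by apply: divr_ge0 B0 _; lra.
(* The summand 1 keeps the constant positive when [B = 0]. *)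
exists ((B / (4 * pi) + 1) * (1 - c)^-1) => [|P L cP PL]; first by apply: mulr_gt0; lra.
have bn n : 0 <= beta ^- n by rewrite invr_ge0 exprn_ge0// ltW.
have G0 n : (0 <= Gam P n)%E by apply: integral_ge0 => x _; exact: oscillation_ge0.
pose h j := ((B / scale R j ^+ 2)%:E *
     \sum_(0 <= n <oo) ((beta ^- n)%:E * Gam P (j + n)))%E.
have S0 j : (0 <= \sum_(0 <= n <oo) ((beta ^- n)%:E * Gam P (j + n)))%E.
  by apply: nneseries_ge0 => n _ _; rewrite mule_ge0// lee_fin.
have h0 j : (0 <= h j)%E.
  by apply: mule_ge0 (S0 j); rewrite lee_fin; apply: divr_ge0 B0 (sqr_ge0 _).
(* Exactly the [r] with 2 r <= scale j < 4 r. Its length scale j / 4 turns the factor 1 / scale^2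
   into a multiple of 2^j. *)
pose I j : set R := `]scale R j / 4, scale R j / 2]%classic.
have mI j : measurable (I j) by exact: measurable_itv.
have mH j : measurable_fun setT (fun r : R => (\1_(I j) r)%:E * h j)%E.
  by apply: emeasurable_funM => //; apply/measurable_EFinP; exact: measurable_indic.
apply: (@le_trans _ _ (\int[mu]_r \sum_(0 <= j <oo) ((\1_(I j) r)%:E * h j))%E).
  rewrite integral_mkcond; apply: ge0_le_integral => //.
  - move=> r _; rewrite patchE; case: ifP => // _; apply: integral_ge0 => z _.
    by rewrite lee_fin mulr_ge0 ?sqr_ge0// invr_ge0 sqr_ge0.
  - apply/(measurable_restrictT _ _).1 => //; apply: measurable_funTS.
    pose k (x : R * R) : \bar R := (((sin x.1) ^- 2 * (P (g (x.2 + x.1)%R) - P (g (x.2 - x.1)%R)) ^+ 2)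
        * \1_(`[0, 2 * pi]%classic : set R) x.2)%:E.
    have -> : (fun r => \int[mu]_(z in `[0%R, (2 * pi)%R])
       ((sin r) ^- 2 * (P (g (z + r)%R) - P (g (z - r)%R)) ^+ 2)%:E)%E =
       (fun r => \int[mu]_z k (r, z))%E.
      apply/funext => r; rewrite integral_mkcond; apply: eq_integral => z _.
      by rewrite patchE /k indicE/=; case: ifPn => zI; rewrite ?mulr1 ?mulr0.
    apply: measurable_integral_line; last first.
      move=> x; rewrite /k lee_fin; apply: mulr_ge0; last by rewrite indicE.
      by rewrite mulr_ge0 ?sqr_ge0// invr_ge0 sqr_ge0.
    have mg : measurable_fun setT g by exact: continuous_measurable_fun.
    have mP : measurable_fun setT P by exact: continuous_measurable_fun.
    apply/measurable_EFinP; apply: measurable_funM; last first.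
      by apply: measurableT_comp; [exact: measurable_indic|exact: measurable_snd].
    apply: measurable_funM; last first.
      apply: measurable_funX; apply: measurable_funB;
        do 2 (apply: measurableT_comp => //); [apply: measurable_funD|apply: measurable_funB]; exact: measurable_fst || exact: measurable_snd.
    apply: measurable_funV; apply: measurable_funX; apply: measurableT_comp.
      by apply: continuous_measurable_fun; exact: continuous_sin.
    exact: measurable_fst.
  - apply: ge0_emeasurable_sum => [j r _ _|j _]; last exact: mH.
    by rewrite mule_ge0 ?lee_fin ?indicE.
  - move=> r _; have H0 j : (0 <= (\1_(I j) r)%:E * h j)%E by rewrite mule_ge0 ?lee_fin ?indicE.
    rewrite patchE; case: ifPn => [|_]; last by apply: nneseries_ge0 => j _ _; exact: H0.
    rewrite inE/= in_itv/= => r02; have [j jP] := scale_select r02.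
    apply: (le_trans (HB P L cP PL _ _ r02 jP)).
    apply: (@le_trans _ _ ((\1_(I j) r)%:E * h j)%E).
      rewrite indicE mem_set ?mul1e// /I /= in_itv/=.
      by move/andP: jP => [j1 j2]; apply/andP; split; lra.
    apply: (le_trans _ (nneseries_lim_ge j.+1 _)); last by move=> n _ _; exact: H0.
    by rewrite big_nat_recr//= leeDr// sume_ge0.
rewrite integral_nneseries//; last first.
  by move=> j r _; rewrite mule_ge0 ?lee_fin ?indicE.
have muI j : mu (I j) = (scale R j / 4)%:E.
  have s0 := scale_gt0 R j.
  rewrite /I lebesgue_measure_itv/= lte_fin ifT; last lra.
  by rewrite -EFinB; congr (_%:E); lra.
have intI j : (\int[mu]_r ((\1_(I j) r)%:E * h j) = (scale R j / 4)%:E * h j)%E.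
  rewrite ge0_integralZr//; last by apply/measurable_EFinP; apply: measurable_indic; exact: mI.
  rewrite (@integral_indic _ (measurableTypeR R) R mu setT measurableT (I j) (mI j)).
  rewrite (_ : _ `&` _ = I j); last exact: setIT.
  congr (_ * _)%E; exact: muI.
under eq_eseriesr do rewrite intI.
have E j : ((scale R j / 4)%:E * h j = (B / (4 * pi))%:E * \sum_(0 <= n <oo) ((c ^+ n)%:E * ((2 ^+ (j + n))%:E * Gam P (j + n))))%E.
  rewrite /h muleA -EFinM.
  have -> : scale R j / 4 * (B / scale R j ^+ 2) = B / (4 * pi) * 2 ^+ j.
    have j0 : 2 ^+ j != 0 :> R by rewrite expf_neq0.
    have pn0 : pi != 0 :> R by rewrite gt_eqF.
    have E (p q : R) : p != 0 -> q != 0 -> p / q / 4 * (B / (p / q) ^+ 2) = B / (4 * p) * q.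
      by move=> p1 q1; field; rewrite p1 q1.
    exact: E.
  rewrite EFinM -muleA; congr (_ * _)%E.
  rewrite -nneseriesZl; last by move=> n _; rewrite mule_ge0// lee_fin.
  apply: eq_eseriesr => n _; rewrite !muleA -!EFinM; congr (_%:E * _)%E.
  have bn0 : beta ^+ n != 0 by rewrite expf_neq0// gt_eqF.
  have tn0 : 2 ^+ n != 0 :> R by rewrite expf_neq0.
  rewrite /c; move: bn0; move: beta => b bn0.
  by rewrite exprVn exprMn exprD; field; rewrite bn0 tn0.
under eq_eseriesr do rewrite E.
have a0 n : (0 <= (2 ^+ n)%:E * Gam P n)%E by rewrite mule_ge0// lee_fin exprn_ge0.
have cn n : 0 <= c ^+ n by rewrite exprn_ge0//; lra.
rewrite nneseriesZl; last first.
  by move=> j _; apply: nneseries_ge0 => n _ _; rewrite mule_ge0// lee_fin.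
rewrite [X in (_ <= X * _)%E]EFinM -[X in (_ <= X)%E]muleA.
apply: (@le_trans _ _ ((B / (4 * pi))%:E * ((1 - c)^-1%:E * \sum_(0 <= m <oo) ((2 ^+ m)%:E * Gam P m)))%E).
  apply: lee_wpmul2l; first by rewrite lee_fin.
  exact: (weighted_double_series c01 a0).
apply: lee_wpmul2r; last by rewrite lee_fin lerDl.
by apply: mule_ge0; [rewrite lee_fin ltW|apply: nneseries_ge0].
Qed.

End lift.
End ScaleSums.

(** Contraction makes the inverse squares grow at least geometrically, so the sum is dominated by
    its last nonzero term. The induction carries the sharper bound in terms of [s N ^- 2] as long as
    [s N] is above the cutoff. *)
Lemma geometric_cutoff_sum (R : realFieldType) (b k : R) (s : nat -> R) : 0 < b < 1 -> 0 < k ->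
  (forall m, 0 < s m) -> (forall m, s m.+1 <= b * s m) ->
  forall N, \sum_(m < N) (if k <= s m then s m ^- 2 else 0) <= k ^- 2 / (1 - b ^+ 2).
Proof.
move=> /andP[b0 b1] k0 s0 sS.
have b2 : 0 < 1 - b ^+ 2 by nra.
have inv2 (x y : R) : 0 < x -> x <= y -> y ^- 2 <= x ^- 2.
  move=> x0 xy; have y0 : 0 < y by exact: lt_le_trans xy.
  by rewrite lef_pV2 ?posrE ?exprn_gt0// lerXn2r// nnegrE ltW.
have H N : (k <= s N -> \sum_(m < N.+1) (if k <= s m then s m ^- 2 else 0) <= s N ^- 2 / (1 - b ^+ 2)) /\
     \sum_(m < N.+1) (if k <= s m then s m ^- 2 else 0) <= k ^- 2 / (1 - b ^+ 2).
  elim: N => [|N [IH1 IH2]].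
    rewrite big_ord_recl big_ord0 addr0/=.
    have : s 0%N ^- 2 <= s 0%N ^- 2 / (1 - b ^+ 2).
      rewrite ler_pdivlMr// ler_piMr ?invr_ge0 ?sqr_ge0//.
      by rewrite gerBl sqr_ge0.
    move=> h; split; first by move=> ->.
    case: ifP => [ks|_]; last by rewrite divr_ge0 ?invr_ge0 ?sqr_ge0// ltW.
    by apply: (le_trans h); rewrite ler_wpM2r ?invr_ge0 ?(ltW b2)// inv2.
  have h1 : k <= s N.+1 -> \sum_(m < N.+2) (if k <= s m then s m ^- 2 else 0) <= s N.+1 ^- 2 / (1 - b ^+ 2).
    move=> ks; have ksN : k <= s N.
      by apply: (le_trans ks); apply: (le_trans (sS N)); have := s0 N; nra.
    rewrite big_ord_recr/= ks.
    apply: (@le_trans _ _ (s N ^- 2 / (1 - b ^+ 2) + s N.+1 ^- 2)); first by rewrite lerD2r IH1.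
    rewrite -[X in _ + X <= _](mulfK (lt0r_neq0 b2)).
    rewrite -mulrDl ler_wpM2r ?invr_ge0 ?(ltW b2)//.
    have : s N ^- 2 <= b ^+ 2 * s N.+1 ^- 2.
      rewrite -ler_pdivrMl ?exprn_gt0// -exprVn -exprVn -exprMn -invfM.
      by rewrite exprVn inv2.
    by move=> h; lra.
  split=> //; have [ks|ks] := leP k (s N.+1).
    apply: (le_trans (h1 ks)); rewrite ler_wpM2r ?invr_ge0 ?(ltW b2)// inv2//.
  by rewrite big_ord_recr/= (leNgt k (s N.+1)) ks/= addr0.
case=> [|N]; last by have [] := H N.
by rewrite big_ord0 divr_ge0 ?invr_ge0 ?sqr_ge0// ltW.
Qed.

(** * From oscillation sums to the Gagliardo seminorm *)

Section Gagliardo.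
Variable R : realType.
Local Notation mu := (@lebesgue_measure R).
Implicit Types (P : R -> R) (T : R).

(** Integrand of the Gagliardo seminorm of order 1 / 2 on a square; it is 0 on the diagonal, where
    the division is by 0. *)
Definition gagliardo P T (y : R * R) : R :=
  if (`|y.1| <= T) then if (`|y.2| <= T) then (P y.1 - P y.2) ^+ 2 / (y.1 - y.2) ^+ 2 else 0 else 0.

Lemma gagliardo_ge0 P T y : 0 <= gagliardo P T y.
Proof. by rewrite /gagliardo; do 2 case: ifP => // _; rewrite divr_ge0 ?sqr_ge0. Qed.

Lemma measurable_gagliardo P T : continuous P -> measurable_fun setT (gagliardo P T).
Proof.
move=> cP; have mP : measurable_fun setT P by exact: continuous_measurable_fun.
have m1 : measurable_fun setT (fun xy : R * R => xy.1) by exact: measurable_fst.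
have m2 : measurable_fun setT (fun xy : R * R => xy.2) by exact: measurable_snd.
do 2 (apply: measurable_if_le; [by apply: measurableT_comp => //; exact: normr_measurable|by []|]).
apply: measurable_funM.
  by apply: measurable_funX; apply: measurable_funB; apply: measurableT_comp.
by apply: measurable_funV; apply: measurable_funX; exact: measurable_funB.
Qed.

Section lift.
Variables (g : R -> R) (M : R).
Hypotheses (lg : circle_lift g) (M1 : 1 < M) (gd : doubling g M pi).
Let beta := M / (1 + M).

Let cg : continuous g. Proof. by case: lg. Qed.
Let gl := circle_lift_mono lg.

(** 2 pi is the weight 2^m times the length of the set of centres; one factor (1 + M)^2 comes from
    recentring the arcs, the other from the cutoff, and the denominator from the geometric sum. *)
Let K := 2 * pi * (1 + M) ^+ 4 / (1 - beta ^+ 2).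

Lemma arclen_nearby x z m : `|x - z| <= scale R m ->
  arclen g x m <= (1 + M) * arclen g z m.
Proof.
rewrite ler_norml => /andP[h1 h2]; apply: le_trans (arclen_double gd z m).
by apply: lerB; rewrite gl; lra.
Qed.

(** If the image arc about [x] contains [y.1], then [f y.1] is within [scale m] of [x] and the arc
    can be recentred there; the bound depends on [x] only through that condition. The arc must also
    be as long as the distance of [y.1] and [y.2], which produces the cutoff. Centres in
    [- pi, 3 pi] and half-lengths up to pi keep the arcs within [- 2 pi, 4 pi], hence the two
    conditions on [T]. *)
Lemma oscillation_kernel_le f P T x y m : cancel g f -> cancel f g ->
  `|g (- (2 * pi))| <= T -> `|g (4 * pi)| <= T -> y.1 != y.2 -> - pi <= x <= 3 * pi ->
  oscillation_kernel g P m x y <=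
    if `|x - f y.1| <= scale R m then
      (1 + M) ^+ 2 * (y.1 - y.2) ^+ 2 * gagliardo P T y *
        (if `|y.1 - y.2| / (1 + M) <= arclen g (f y.1) m then arclen g (f y.1) m ^- 2 else 0)
    else 0.
Proof.
move=> gK fK T1 T2 y12 /andP[x1 x2]; have m1 := M1; have mm : 0 < 1 + M by lra.
have rhs0 : 0 <= if `|x - f y.1| <= scale R m then
      (1 + M) ^+ 2 * (y.1 - y.2) ^+ 2 * gagliardo P T y *
        (if `|y.1 - y.2| / (1 + M) <= arclen g (f y.1) m then arclen g (f y.1) m ^- 2 else 0)
    else 0.
  case: ifP => // _; apply: mulr_ge0.
    by apply: mulr_ge0; [apply: mulr_ge0; exact: sqr_ge0|exact: gagliardo_ge0].
  by case: ifP => // _; rewrite invr_ge0 sqr_ge0.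
rewrite /oscillation_kernel; case: ifP => // y1l; case: ifP => // y1r; case: ifP => // y2l; case: ifP => // y2r.
have s0 := scale_gt0 R m; have spi := scale_le_pi R m.
have near : `|x - f y.1| <= scale R m.
  move: y1l y1r; rewrite /arcl /arcr -[in g (x - _) <= _](fK y.1) -[in _ <= g (x + _)](fK y.1) !gl.
  by rewrite ler_norml => ? ?; apply/andP; split; lra.
have near' : `|f y.1 - x| <= scale R m by rewrite distrC.
have yT (u : R) : arcl g x m <= u -> u <= arcr g x m -> `|u| <= T.
  move=> ul ur; have l1 : g (- (2 * pi)) <= u by apply: le_trans ul; rewrite gl; lra.
  have l2 : u <= g (4 * pi) by apply: (le_trans ur); rewrite gl; lra.
  move: T1 T2; rewrite !ler_norml => /andP[? ?] /andP[? ?]; apply/andP; split; lra.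
have len : `|y.1 - y.2| <= arclen g x m.
  by rewrite /arclen ler_norml; apply/andP; split; lra.
have A1 := arclen_nearby near; have A2 := arclen_nearby near'.
have L0 := arclen_gt0 lg x m; have L1 := arclen_gt0 lg (f y.1) m.
rewrite near ifT; last by rewrite ler_pdivrMr// mulrC; exact: le_trans len A1.
rewrite /gagliardo !yT//.
have d0 : (y.1 - y.2) ^+ 2 != 0 by rewrite expf_neq0// subr_eq0.
rewrite -(mulrA _ _ (_ / _)) (mulrC ((y.1 - y.2) ^+ 2)) divfK//.
rewrite mulrAC ler_wpM2r ?sqr_ge0//.
rewrite -ler_pdivrMl ?exprn_gt0// -invfM -exprMn lef_pV2 ?posrE ?exprn_gt0//; last exact: mulr_gt0.
by rewrite lerXn2r// nnegrE ltW// mulr_gt0.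
Qed.

(** At each scale the centres fill an interval of length 2 scale m, and 2^m scale m = pi is
    independent of [m]. What remains is a sum of inverse squared lengths over the scales whose arcs
    are long enough to hold both points. *)
Lemma oscillation_kernel_sum_le P T y : continuous P ->
  `|g (- (2 * pi))| <= T -> `|g (4 * pi)| <= T ->
  (\sum_(0 <= m <oo) \int[mu]_(x in `[(- pi)%R, (3 * pi)%R])
      (2 ^+ m * oscillation_kernel g P m x y)%:E <= (K * gagliardo P T y)%:E)%E.
Proof.
move=> cP T1 T2; have [f [lf gK fK]] := circle_lift_inv lg.
have m1 := M1; have /andP[b0 b1] := beta01 M1; have mm : 0 < 1 + M by lra.
have p0 := pi_gt0 R.
have be2 : 0 < 1 - beta ^+ 2 by rewrite -/beta in b0 b1; nra.
(* On the diagonal the kernel vanishes; elsewhere the cutoff [kap] is positive. *)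
have [y12|y12] := eqVneq y.1 y.2.
  have z m x : oscillation_kernel g P m x y = 0.
    rewrite /oscillation_kernel y12 subrr expr0n/= mulr0.
    by do 4 case: ifP => // _.
  under eq_eseriesr.
    move=> m _; under eq_integral do rewrite z mulr0.
    rewrite integral0; over.
  rewrite eseries0// lee_fin mulr_ge0 ?gagliardo_ge0// /K.
  by rewrite divr_ge0 ?(ltW be2)// mulr_ge0 ?exprn_ge0 ?(ltW mm)//; lra.
pose kap := `|y.1 - y.2| / (1 + M).
pose sg m := arclen g (f y.1) m.
pose Q := (1 + M) ^+ 2 * (y.1 - y.2) ^+ 2 * gagliardo P T y.
have Q0 : 0 <= Q by rewrite mulr_ge0 ?gagliardo_ge0// mulr_ge0 ?sqr_ge0.
pose c m := if kap <= sg m then sg m ^- 2 else 0.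
have c0 m : 0 <= c m by rewrite /c; case: ifP => // _; rewrite invr_ge0 sqr_ge0.
have mk m : measurable_fun setT (fun x => 2 ^+ m * oscillation_kernel g P m x y).
  apply: measurable_funM => //.
  exact: (measurable_fun_pair1 (f := fun xy => oscillation_kernel g P m xy.1 xy.2) y (measurable_oscillation_kernel m cg cP)).
have step m : (\int[mu]_(x in `[(- pi)%R, (3 * pi)%R])
      (2 ^+ m * oscillation_kernel g P m x y)%:E <= (2 * pi * Q * c m)%:E)%E.
  have s0 := scale_gt0 R m.
  pose B : set R := `[f y.1 - scale R m, f y.1 + scale R m]%classic.
  have mB : measurable B by exact: measurable_itv.
  apply: (@le_trans _ _ (\int[mu]_(x in B) (2 ^+ m * (Q * c m))%:E)%E); last first.
    have muB : mu B = (2 * scale R m)%:E.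
      rewrite /B lebesgue_measure_itv/= lte_fin ifT; last lra.
      by rewrite -EFinB; congr (_%:E); ring.
    rewrite integral_cst//.
    apply: (@le_trans _ _ ((2 ^+ m * (Q * c m))%:E * (2 * scale R m)%:E)%E).
      by rewrite le_eqVlt; apply/orP; left; apply/eqP; congr (_ * _)%E; exact: muB.
    rewrite -EFinM lee_fin.
    have -> : 2 ^+ m * (Q * c m) * (2 * scale R m) = 2 * Q * c m * (2 ^+ m * scale R m) by ring.
    rewrite (_ : 2 ^+ m * scale R m = pi); first by lra.
    by rewrite /scale mulrC divfK// expf_neq0.
  rewrite integral_mkcond [leRHS]integral_mkcond; apply: ge0_le_integral => //.
  - move=> x _; rewrite patchE; case: ifP => // _.
    by rewrite lee_fin mulr_ge0 ?exprn_ge0// oscillation_kernel_ge0.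
  - apply/(measurable_restrictT _ _).1 => //; apply: measurable_funTS.
    by apply/measurable_EFinP; exact: mk.
  - by apply/(measurable_restrictT _ _).1.
  - move=> x _; rewrite !patchE.
    have rhs0 : (0 <= (if x \in B then (2 ^+ m * (Q * c m))%:E else point))%E.
      by case: ifP => _; [rewrite lee_fin mulr_ge0 ?exprn_ge0// mulr_ge0|exact: lexx].
    case: ifPn => [|_]; last exact: rhs0.
    rewrite inE/= in_itv/= => xI.
    have H := @oscillation_kernel_le f P T x y m gK fK T1 T2 y12 xI.
    case: ifPn => [_|xB].
      rewrite lee_fin ler_wpM2l ?exprn_ge0//; apply: (le_trans H).
      by rewrite -/kap -/(sg m) -/(c m) -/Q; case: ifP => // _; rewrite mulr_ge0.
    rewrite lee_fin; suff : oscillation_kernel g P m x y <= 0.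
      by move=> h; rewrite (_ : oscillation_kernel g P m x y = 0) ?mulr0//; apply/le_anti; rewrite h oscillation_kernel_ge0.
    apply: (le_trans H); rewrite ifF//; apply/negP => xs; move/negP: xB; apply.
    rewrite inE /B/= in_itv/=; move: xs; rewrite ler_norml => /andP[? ?]; apply/andP; split; lra.
apply: (@le_trans _ _ (\sum_(0 <= m <oo) (2 * pi * Q * c m)%:E)%E).
  apply: lee_nneseries => [m _ _|m _]; last exact: step.
  by apply: integral_ge0 => x _; rewrite lee_fin mulr_ge0 ?exprn_ge0// oscillation_kernel_ge0.
have pQ : 0 <= 2 * pi * Q by rewrite mulr_ge0//; lra.
apply: nneseries_le_bound => [m|N]; first by rewrite lee_fin mulr_ge0.
rewrite sumEFin lee_fin big_mkord -mulr_sumr.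
have k0 : 0 < kap by rewrite divr_gt0// normr_gt0 subr_eq0.
have := @geometric_cutoff_sum R beta kap sg (beta01 M1) k0 (fun m => arclen_gt0 lg (f y.1) m)
  (fun m => arclen_contract M1 gd (f y.1) m) N.
rewrite -/beta => /(ler_wpM2l pQ)/le_trans; apply.
have d0 : y.1 - y.2 != 0 by rewrite subr_eq0.
have -> : kap ^- 2 = (1 + M) ^+ 2 / (y.1 - y.2) ^+ 2.
  by rewrite /kap exprMn invfM real_normK ?num_real// exprVn invrK mulrC.
rewrite /Q /K le_eqVlt; apply/orP; left; apply/eqP.
move: (gagliardo P T y) (1 - beta ^+ 2) be2 (y.1 - y.2) d0 => G be be0 d d0.
by field; rewrite d0 gt_eqF.
Qed.

Lemma oscillation_sum_le T : `|g (- (2 * pi))| <= T -> `|g (4 * pi)| <= T ->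
  exists2 C, 0 < C & forall P, continuous P ->
  (\sum_(0 <= m <oo) ((2 ^+ m)%:E * \int[mu]_(x in `[(- pi)%R, (3 * pi)%R]) oscillation g P m x) <=
   C%:E * \int[plane]_y (gagliardo P T y)%:E)%E.
Proof.
move=> T1 T2; have m1 := M1; have /andP[b0 b1] := beta01 M1; have p0 := pi_gt0 R.
have K0 : 0 < K.
  have be2 : 0 < 1 - beta ^+ 2 by rewrite -/beta in b0 b1; nra.
  by rewrite /K divr_gt0// mulr_gt0 ?exprn_gt0//; lra.
exists K => // P cP.
pose I : set R := `[- pi, 3 * pi]%classic.
pose h m (x : R) (y : R * R) : \bar R := (2 ^+ m * oscillation_kernel g P m x y * \1_I x)%:E.
have h0 m x y : (0 <= h m x y)%E.
  by rewrite lee_fin mulr_ge0 ?mulr_ge0 ?exprn_ge0 ?oscillation_kernel_ge0// indicE.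
have mh m : measurable_fun setT (fun xy : R * (R * R) => h m xy.1 xy.2).
  apply/measurable_EFinP; apply: measurable_funM.
    by apply: measurable_funM => //; exact: measurable_oscillation_kernel.
  by apply: measurableT_comp; [apply: measurable_indic; exact: measurable_itv|exact: measurable_fst].
have E m : ((2 ^+ m)%:E * \int[mu]_(x in I) oscillation g P m x =
    \int[plane]_y \int[mu]_x h m x y)%E.
  rewrite -(line_plane_tonelli (mh m)); last by move=> x; exact: h0.
  rewrite -ge0_integralZl//; last 3 first.
  - exact: measurable_itv.
  - by apply: measurable_funTS; exact: measurable_oscillation.
  - by move=> x _; exact: oscillation_ge0.
  rewrite integral_mkcond; apply: eq_integral => x _.
  rewrite patchE; case: ifPn => xI.
    rewrite -ge0_integralZl//; last 2 first.
    - apply/measurable_EFinP.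
      exact: (measurable_fun_pair2 (f := fun xy => oscillation_kernel g P m xy.1 xy.2) x (measurable_oscillation_kernel m cg cP)).
    - by move=> y _; rewrite lee_fin oscillation_kernel_ge0.
    by apply: eq_integral => y _; rewrite /h indicE xI mulr1 EFinM.
  rewrite integral0_eq// => y _.
  by rewrite /h indicE (negbTE xI) mulr0.
under eq_eseriesr do rewrite E.
have mG : measurable_fun setT (fun y => (gagliardo P T y)%:E).
  by apply/measurable_EFinP; exact: measurable_gagliardo.
have H0 m y : (0 <= \int[mu]_x h m x y)%E by apply: integral_ge0 => x _; exact: h0.
have mH m : measurable_fun setT (fun y => \int[mu]_x h m x y)%E.
  apply: (@measurable_integral_line R _ _ (fun yx : (R * R) * R => h m yx.2 yx.1)).
    have ms : measurable_fun setT (fun yx : (R * R) * R => (yx.2, yx.1)).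
      by apply: measurable_fun_pair; [exact: measurable_snd|exact: measurable_fst].
    exact: (measurableT_comp (mh m) ms).
  by move=> x; exact: h0.
rewrite -integral_nneseries//.
rewrite -ge0_integralZl//; last 2 first.
- by move=> y _; rewrite lee_fin gagliardo_ge0.
- by rewrite lee_fin ltW.
apply: ge0_le_integral => //.
- by move=> y _; apply: nneseries_ge0 => m _ _; exact: H0.
- by apply: ge0_emeasurable_sum => [m y _ _|m _]; [exact: H0|exact: mH].
- exact: emeasurable_funM.
move=> y _; rewrite -EFinM.
apply: le_trans (oscillation_kernel_sum_le y cP T1 T2).
apply: lee_nneseries => [m _ _|m _]; first exact: H0.
rewrite [leRHS]integral_mkcond le_eqVlt; apply/orP; left; apply/eqP.
apply: eq_integral => x _; rewrite patchE /h indicE.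
by case: ifPn => xI; rewrite ?mulr1 ?mulr0//.
Qed.

End lift.
End Gagliardo.

(** * The energy identity *)

Lemma measurable_boolR d (T : measurableType d) (R : realType) (b : T -> bool) :
  measurable_fun setT b -> measurable_fun setT (fun x => (b x)%:R : R).
Proof.
move=> mb; have -> : (fun x => (b x)%:R : R) = (fun x => if b x then 1 else 0).
  by apply/funext => x; case: (b x).
exact: measurable_fun_ifT.
Qed.

Section FTC.
Variable R : realType.
Local Notation mu := (@lebesgue_measure R).

Lemma FTC2_is_derive (f F : R -> R) a b : a < b ->
  (forall x : R, a <= x <= b -> is_derive x 1 F (f x)) -> {within `[a, b], continuous f} ->
  (\int[mu]_(x in `[a, b]) (f x)%:E = (F b - F a)%:E)%E.
Proof.
move=> ab dF cf; rewrite EFinB; apply: continuous_FTC2 => //.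
- have cF x : a <= x <= b -> {for x, continuous F}.
    by move=> /dF[dFx _]; apply: differentiable_continuous; exact/derivable1_diffP.
  split.
  - move=> x; rewrite in_itv/= => /andP[x1 x2].
    by have [] := dF x; rewrite ?(ltW x1) ?(ltW x2).
  - by apply: cvg_at_right_filter; apply: cF; rewrite lexx ltW.
  - by apply: cvg_at_left_filter; apply: cF; rewrite lexx ltW.
- move=> x; rewrite in_itv/= => /andP[x1 x2].
  have [|d <-] := dF x; first by rewrite (ltW x1) (ltW x2).
  by rewrite derive1E.
Qed.

End FTC.

Section ArcKernel.
Variable R : realType.
Local Notation mu := (@lebesgue_measure R).
Implicit Types (x y z r d : R).

(* z lies at distance less than r from x on the circle R / 2 pi Z. *)
Definition in_arc r x z : bool := cos r < cos (x - z).

Lemma in_arcD2pi r x z : in_arc r x (z + 2 * pi) = in_arc r x z.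
Proof.
by rewrite /in_arc -(cosD2pi' (x - (z + 2 * pi))); congr (_ < cos _); ring.
Qed.

Lemma in_arcP r x z : 0 < r < pi -> `|x - z| <= pi -> in_arc r x z = (`|x - z| < r).
Proof.
move=> /andP[r0 rpi] xz; rewrite /in_arc -(cos_norm (x - z)) ltr_cos//.
  by rewrite in_itv/= normr_ge0.
by rewrite in_itv/= (ltW r0) ltW.
Qed.

(** Half-lengths below pi / 2 keep the two arcs from meeting on the far side of the circle: there
    cos (x + d - z) is negative, whereas cos r is positive. *)
Lemma in_arc_pair r x d z : 0 < r < pi / 2 -> 0 < d <= pi -> x - pi <= z <= x + pi ->
  (in_arc r x z && in_arc r (x + d) z) = (x + d - r < z < x + r).
Proof.
move=> /andP[r0 r2] /andP[d0 dpi] /andP[z1 z2].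
have p0 := pi_gt0 R.
have c0 : 0 < cos r by apply: cos_gt0_pihalf; apply/andP; split; lra.
rewrite in_arcP; [|by apply/andP; split; lra|by rewrite ler_norml; apply/andP; split; lra].
have [h1|h1] := ltP `|x - z| r; last first.
  apply/esym/negP => /andP[h2 h3]; move: h1; apply/negP; rewrite -ltNge ltr_norml.
  by apply/andP; split; lra.
have [a1 a2] : - r < x - z /\ x - z < r by apply/andP; rewrite -ltr_norml.
have [u|u] := leP (x + d - z) pi.
  rewrite in_arcP; [|by apply/andP; split; lra|by rewrite ler_norml; apply/andP; split; lra].
  by rewrite /= ltr_norml; apply/idP/idP => /andP[h2 h3]; apply/andP; split; lra.
rewrite /=; transitivity false; last by apply/esym/negP => /andP[h2 h3]; lra.
apply/negP; rewrite /in_arc => h.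
have : 0 < cos (x + d - z - pi) by apply: cos_gt0_pihalf; apply/andP; split; lra.
have := cosDpi (x + d - z - pi); rewrite subrK.
by lra.
Qed.

Definition arc_overlap r x y z : R := (in_arc r x z && in_arc r y z)%:R.

Lemma measurable_in_arc r x : measurable_fun setT (fun z => in_arc r x z).
Proof.
apply: measurable_fun_ltr => //; apply: measurableT_comp.
  by apply: continuous_measurable_fun; exact: continuous_cos.
exact: measurable_funB.
Qed.

Lemma arc_overlap_integral r x d : 0 < r < pi / 2 -> 0 < d <= pi ->
  (\int[mu]_(z in `[0%R, (2 * pi)%R]) (arc_overlap r x (x + d) z)%:E =
    (Num.max 0 (2 * r - d))%:E)%E.
Proof.
move=> r0 d0; have p0 := pi_gt0 R.
rewrite -[in LHS](add0r (2 * pi)) (@integral_periodic _ _ 0 (x - pi)); first last.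
- by move=> z; rewrite /arc_overlap !in_arcD2pi.
- apply/measurable_EFinP; apply: measurable_boolR; apply: measurable_and; exact: measurable_in_arc.
- by lra.
transitivity (\int[mu]_(z in `](x + d - r)%R, (x + r)%R[) (1%:E : \bar R))%E.
  rewrite integral_mkcond [RHS]integral_mkcond; apply: eq_integral => z _.
  rewrite !patchE !mem_setE !in_itv/=; case: ifPn => zI.
    rewrite /arc_overlap in_arc_pair//; last by move: zI => /andP[? ?]; apply/andP; split; lra.
    by case: ifP.
  rewrite ifF//; apply/negP => /andP[h1 h2]; move/negP: zI; apply.
  by move: r0 d0 => /andP[? ?] /andP[? ?]; apply/andP; split; lra.
rewrite integral_cst//= mul1e lebesgue_measure_itv/= lte_fin.
case: ltP => h; last by rewrite max_l//; lra.
by rewrite max_r -?EFinB; [congr (_%:E)|]; lra.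
Qed.

(** Primitive of (2 r - d) / sin^2 r, by parts with - cot. It vanishes at r = pi / 2 and equals 2 ln
    sin (d / 2) at r = d / 2. *)
Let H d r := - (2 * r - d) * (cos r / sin r) + 2 * ln (sin r).

Lemma is_derive_arc_primitive d r : 0 < sin r ->
  is_derive r 1 (H d) ((2 * r - d) / sin r ^+ 2).
Proof.
move=> s0; have sn0 : sin r != 0 by rewrite gt_eqF.
have D1 : is_derive r 1 (fun u : R => - (2 * u - d)) (- 2).
  by apply: is_derive_eq; rewrite /GRing.scale/=; ring.
have D2 : is_derive r 1 (fun u : R => cos u / sin u) (- sin r ^- 2).
  have Ds := is_deriveV sn0 (is_derive_sin r).
  have Dm := is_deriveM (is_derive_cos r) Ds.
  apply: is_derive_eq Dm _; rewrite /GRing.scale/=.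
  have := cos2Dsin2 r; move: (cos r) (sin r) sn0 => c s sn0 cs.
  have -> : c * (- s ^- 2 * c) + s^-1 * - s = - (c ^+ 2 + s ^+ 2) / s ^+ 2 by field.
  by rewrite cs mulN1r.
have D3 : is_derive r 1 (fun u : R => ln (sin u)) (cos r / sin r).
  have Dl := is_derive1_comp (is_derive1_ln s0) (is_derive_sin r).
  by apply: is_derive_eq Dl _; rewrite mulrC.
have D4 := is_deriveM D1 D2.
have D5 : is_derive r 1 (fun u : R => 2 * ln (sin u)) (2 * (cos r / sin r)).
  by apply: is_derive_eq; rewrite /GRing.scale/=; ring.
apply: is_derive_eq (is_deriveD D4 D5) _; rewrite /GRing.scale/=.
by field.
Qed.

Lemma sqr_sin_half_eq (u v : R) : cos u = cos v -> `|sin (u / 2)| = `|sin (v / 2)|.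
Proof.
move=> cuv; apply/eqP; rewrite -(eqrXn2 (n := 2))// !real_normK ?num_real//.
by have := cos_half u; have := cos_half v; rewrite cuv => h1 h2; apply/eqP; lra.
Qed.

(* -2 ln |sin ((x - y) / 2)| as a superposition of products of indicators of
   arcs (arc_kernelE), which turns its quadratic form into an integral of squares. *)
Definition arc_kernel x y : \bar R :=
  (\int[mu]_(r in `]0%R, (pi / 2)%R[) \int[mu]_(z in `[0%R, (2 * pi)%R])
    ((sin r) ^- 2 * arc_overlap r x y z)%:E)%E.

(** Arcs of half-length r about points at distance d overlap only if r > d / 2, and then in length 2
    r - d, so the integral over centres leaves (2 r - d) / sin^2 r. *)
Lemma arc_kernel_near x d : 0 < d <= pi ->
  arc_kernel x (x + d) = (- 2 * ln (sin (d / 2)))%:E.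
Proof.
move=> d0'; have /andP[d0 dpi] := d0'; have p0 := pi_gt0 R.
have mo r : measurable_fun setT (fun z => (arc_overlap r x (x + d) z)%:E).
  by apply/measurable_EFinP; apply: measurable_boolR; apply: measurable_and; exact: measurable_in_arc.
rewrite /arc_kernel.
transitivity (\int[mu]_(r in `](d / 2)%R, (pi / 2)%R[) ((2 * r - d) / sin r ^+ 2)%:E)%E.
  rewrite integral_mkcond [RHS]integral_mkcond; apply: eq_integral => r _.
  rewrite !patchE !mem_setE !in_itv/=; case: ifPn => r0.
    under eq_integral do rewrite EFinM.
    rewrite ge0_integralZl//; last 3 first.
    - by apply: measurable_funTS; exact: mo.
    - by move=> z _; rewrite lee_fin ler0n.
    - by rewrite lee_fin invr_ge0 sqr_ge0.
    rewrite arc_overlap_integral// -EFinM.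
    case: ifPn => [/andP[r1 r2]|rd]; first by rewrite max_r; [rewrite mulrC|lra].
    rewrite max_l ?mulr0//.
    by move: r0 => /andP[_ r2]; rewrite r2 andbT -leNgt in rd; lra.
  rewrite ifF//; apply/negP => /andP[h1 h2]; move/negP: r0; apply; apply/andP; split; lra.
(* At d = pi the range of [r] is empty, in accordance with ln sin (pi / 2) = 0. *)
have [->|dn] := eqVneq d pi.
  by rewrite set_itv_ge ?bnd_simp ?ltxx// integral_set0 sin_pihalf ln1 mulr0.
have {}dpi : d < pi by rewrite lt_neqAle dn.
have sp r : d / 2 <= r <= pi / 2 -> 0 < sin r.
  by move=> /andP[? ?]; apply: sin_gt0_pi; apply/andP; split; lra.
have cf : {within `[d / 2, pi / 2], continuous (fun r => (2 * r - d) / sin r ^+ 2)}.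
  apply: continuous_in_subspaceT => r; rewrite inE/= in_itv/= => rI.
  apply: cvgM.
    by apply: cvgB; [apply: cvgM; [exact: cvg_cst|exact: cvg_id]|exact: cvg_cst].
  apply: cvgV; first by rewrite expf_neq0// gt_eqF// sp.
  by apply: (@continuous_comp _ _ _ sin (fun u => u ^+ 2)); [exact: continuous_sin|exact: exprn_continuous].
rewrite -(@integral_itv_bndoo _ _ _ _ true false); last first.
  apply/measurable_EFinP; apply: measurable_funTS; apply: measurable_funM.
    by apply: measurable_funB => //; exact: measurable_funM.
  apply: measurable_funV; apply: measurable_funX.
  by apply: continuous_measurable_fun; exact: continuous_sin.
have dH r : d / 2 <= r <= pi / 2 -> is_derive r 1 (H d) ((2 * r - d) / sin r ^+ 2).
  by move=> rI; apply: is_derive_arc_primitive; exact: sp.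
have ab : d / 2 < pi / 2 by lra.
rewrite (FTC2_is_derive ab dH cf).
rewrite /H cos_pihalf sin_pihalf ln1; congr (_%:E).
have -> : 2 * (d / 2) - d = 0 by field.
by ring.
Qed.

Lemma arc_kernelC x y : arc_kernel x y = arc_kernel y x.
Proof.
rewrite /arc_kernel; apply: eq_integral => r _; apply: eq_integral => z _.
by rewrite /arc_overlap andbC.
Qed.

Lemma arc_kernelD2piZ x y (n : int) : arc_kernel x (y + n%:~R * (2 * pi)) = arc_kernel x y.
Proof.
rewrite /arc_kernel; apply: eq_integral => r _; apply: eq_integral => z _.
rewrite /arc_overlap /in_arc; congr ((_ * (_ && (_ < _))%:R)%:E).
rewrite -[RHS](periodic_intmul (@cosD2pi' R) n); congr cos; ring.
Qed.

Lemma arc_kernelE x y : sin ((x - y) / 2) != 0 ->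
  arc_kernel x y = (- 2 * ln `|sin ((x - y) / 2)|)%:E.
Proof.
move=> s0; have p0 := pi_gt0 R.
pose n := Num.floor ((y - x) / (2 * pi)).
have /andP[] := floor_itv ((y - x) / (2 * pi)).
have p20 : 0 < 2 * pi :> R by lra.
rewrite -/n ler_pdivlMr// ltr_pdivrMr// intrD => n1 n2.
pose d := y - x + (- n)%:~R * (2 * pi).
have dE : d = y - x - n%:~R * (2 * pi) by rewrite /d mulrNz mulNr.
have cd : cos d = cos (x - y).
  by rewrite /d (periodic_intmul (@cosD2pi' R)) -cosN opprB.
have sd : `|sin ((x - y) / 2)| = `|sin (d / 2)| by apply: sqr_sin_half_eq.
have d0 : 0 < d.
  rewrite lt_neqAle; apply/andP; split; last by lra.
  apply/eqP => dz; move: s0; rewrite -normr_eq0 sd -dz mul0r sin0 normr0 eqxx//.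
have d2 : d < 2 * pi by lra.
have sp : 0 < sin (d / 2) by apply: sin_half_gt0; rewrite d0.
have yE : y = x + d + n%:~R * (2 * pi) by rewrite dE; ring.
rewrite sd gtr0_norm// [in LHS]yE arc_kernelD2piZ.
have [dpi|dpi] := leP d pi; first by apply: arc_kernel_near; rewrite d0.
(* Past pi the shorter arc runs from [x + d] to [x + 2 * pi], so the two points are exchanged. *)
rewrite arc_kernelC -(arc_kernelD2piZ _ x 1) mul1r.
rewrite (_ : x + 2 * pi = x + d + (2 * pi - d)); last by ring.
rewrite arc_kernel_near; last by apply/andP; split; lra.
congr ((_ * ln _)%:E).
rewrite (_ : (2 * pi - d) / 2 = - (d / 2) + pi); last by field.
by rewrite sinDpi sinN opprK.
Qed.

End ArcKernel.

Section PlaneProducts.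
Variable R : realType.
Local Notation mu := (@lebesgue_measure R).

Lemma plane_integral_mul (h1 h2 : R -> R) :
  mu.-integrable setT (EFin \o h1) -> mu.-integrable setT (EFin \o h2) ->
  plane.-integrable setT (fun x => (h1 x.1 * h2 x.2)%:E) /\
  (\int[plane]_x (h1 x.1 * h2 x.2)%:E =
   ((\int[mu]_s h1 s) * (\int[mu]_s h2 s))%:E)%E.
Proof.
move=> i1 i2; have /integrableP[/measurable_EFinP m1 f1] := i1.
have /integrableP[/measurable_EFinP m2 f2] := i2.
have mf : measurable_fun setT (fun x : R * R => (h1 x.1 * h2 x.2)%:E).
  have m1' : measurable_fun [set: R] h1 by exact: m1.
  have m2' : measurable_fun [set: R] h2 by exact: m2.
  apply/measurable_EFinP; apply: measurable_funM.
    by apply: (measurableT_comp m1'); exact: measurable_fst.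
  by apply: (measurableT_comp m2'); exact: measurable_snd.
have mn1 : measurable_fun [set: R] (fun y => `|h1 y|%:E).
  apply/measurable_EFinP; exact: (measurableT_comp (@normr_measurable R setT) m1).
have mn2 : measurable_fun [set: R] (fun y => `|h2 y|%:E).
  apply/measurable_EFinP; exact: (measurableT_comp (@normr_measurable R setT) m2).
have int : plane.-integrable setT (fun x => (h1 x.1 * h2 x.2)%:E).
  apply: (integrable12ltyP mu mu mf).2.
  have E x : (\int[mu]_y `|(h1 (x, y).1 * h2 (x, y).2)%:E| =
      `|h1 x|%:E * \int[mu]_y `|h2 y|%:E)%E.
    under eq_integral do rewrite /= normrM EFinM.
    by rewrite ge0_integralZl; [| |exact: mn2| |].
  under eq_integral do rewrite E.
  rewrite ge0_integralZr; [| |exact: mn1| |]; [|by []|by []|exact: integral_ge0].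
  by apply: lte_mul_pinfty => //; [exact: integral_ge0|rewrite ge0_fin_numE//; exact: integral_ge0].
split=> //.
rewrite -(integral12_prod_meas1 (m1 := mu) (m2 := mu) int) /fubini_F.
have -> : (fun x => \int[mu]_y (h1 (x, y).1 * h2 (x, y).2)%:E)%E =
   (fun x => ((\int[mu]_s h2 s)%R%:E * (h1 x)%:E)%E).
  apply/funext => x /=.
  under eq_integral do rewrite EFinM.
  rewrite integralZl//; rewrite /Rintegral fineK ?integrable_fin_num//; exact: muleC.
rewrite integralZl// mulrC EFinM; congr (_ * _)%E.
by rewrite /Rintegral fineK// integrable_fin_num.
Qed.

Lemma plane_strip_null (c : R) : plane [set x : R * R | x.1 - x.2 = c] = 0%E.
Proof.
rewrite /plane /product_measure1; apply: integral0_eq => x _ /=.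
rewrite (_ : xsection _ x = [set x - c]) ?lebesgue_measure_set1//.
apply/seteqP; split => y; rewrite /xsection/= inE/= => h; lra.
Qed.

End PlaneProducts.

(** * The energy of a function along a lift *)

Section Energy.
Variable R : realType.
Local Notation mu := (@lebesgue_measure R).
Implicit Types (f g p P : R -> R).

(** The points [z + r] and [z - r] are at chordal distance 2 sin r. For periodic [P] this is
    therefore, up to a factor, Douglas's integral for the Dirichlet energy of the harmonic extension
    of [P \o g]. *)
Definition energy g P : \bar R :=
  (\int[mu]_(r in `]0%R, (pi / 2)%R[) \int[mu]_(z in `[0%R, (2 * pi)%R])
     ((sin r) ^- 2 * (P (g (z + r)%R) - P (g (z - r)%R)) ^+ 2)%:E)%E.

Lemma energy_ge0 g P : (0 <= energy g P)%E.
Proof.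
apply: integral_ge0 => r _; apply: integral_ge0 => z _.
by rewrite lee_fin mulr_ge0 ?sqr_ge0// invr_ge0 sqr_ge0.
Qed.

Lemma energy_le_gagliardo g M T : circle_lift g -> 1 < M -> doubling g M pi ->
  `|g (- (2 * pi))| <= T -> `|g (4 * pi)| <= T ->
  exists2 C, 0 < C & forall P (L : R), continuous P ->
    (forall s t, `|P s - P t| <= L * `|s - t|) ->
    (energy g P <= C%:E * \int[plane]_y (gagliardo P T y)%:E)%E.
Proof.
move=> lg M1 gd T1 T2.
have [C1 C10 H1] := energy_le_oscillation lg M1 gd.
have [C2 C20 H2] := oscillation_sum_le lg M1 gd T1 T2.
exists (C1 * C2); first by rewrite mulr_gt0.
move=> P L cP LP; apply: le_trans (H1 P L cP LP) _.
by rewrite EFinM -muleA lee_pmul2l ?lte_fin//; exact: H2.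
Qed.

Lemma gagliardo_lipschitz_lty P (L T : R) : continuous P ->
  (forall s t, `|P s - P t| <= L * `|s - t|) ->
  (\int[plane]_y (gagliardo P T y)%:E < +oo)%E.
Proof.
move=> cP LP; have L0 : 0 <= L.
  by have := LP 1 0; rewrite subr0 normr1 mulr1; apply: le_trans.
have [T0|T0] := ltP T 0.
  rewrite integral0_eq// => y _; rewrite /gagliardo ifF//.
  by apply/negbTE; rewrite -ltNge (lt_le_trans T0).
pose box : set (R * R) := `[- T, T]%classic `*` `[- T, T]%classic.
have mbox : measurable box by apply: measurableX; exact: measurable_itv.
apply: (@le_lt_trans _ _ (\int[plane]_(y in box) (L ^+ 2)%:E)%E).
  rewrite [leRHS]integral_mkcond; apply: ge0_le_integral => //.
  - by move=> y _; rewrite lee_fin gagliardo_ge0.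
  - by apply/measurable_EFinP; exact: measurable_gagliardo.
  - apply/(measurable_restrictT _ _).1 => //.
  move=> y _; rewrite patchE /gagliardo; case: (boolP (y \in box)) => yD; last first.
    case: ifP => // h1; case: ifP => // h2; exfalso; move/negP: yD; apply.
    by rewrite inE/=; split; rewrite /= in_itv/= -ler_norml.
  rewrite lee_fin; case: ifP => _; [|exact: sqr_ge0]; case: ifP => _; last exact: sqr_ge0.
  have [->|yy] := eqVneq y.1 y.2; first by rewrite !subrr expr0n mul0r sqr_ge0.
  rewrite ler_pdivrMr; last by rewrite exprn_even_gt0//= subr_eq0.
  rewrite -exprMn -(real_normK (num_real (P _ - _))) -(real_normK (num_real (_ * _))).
  by rewrite ler_pXn2r ?nnegrE// normrM (ger0_norm L0).
rewrite integral_cst//.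
rewrite lte_mul_pinfty ?lee_fin ?sqr_ge0//.
rewrite -[X in (X < _)%E]/((mu \x mu)%E (`[- T, T] `*` `[- T, T])).
rewrite product_measure1E; [|exact: measurable_itv..].
rewrite -[X in (X < _)%E]/(mu `[(- T)%R, T]%classic * mu `[(- T)%R, T]%classic)%E lebesgue_measure_itv/=.
by case: ifP => _; rewrite ?mule0 ?ltry.
Qed.

(** Lipschitz functions have bounded difference quotients. This finiteness justifies Fubini and the
    passage to real values through [fine]. *)
Lemma energy_lty g M P L : circle_lift g -> 1 < M -> doubling g M pi ->
  continuous P -> (forall s t, `|P s - P t| <= L * `|s - t|) -> (energy g P < +oo)%E.
Proof.
move=> lg M1 gd cP LP.
pose T := Num.max `|g (- (2 * pi))| `|g (4 * pi)|.
have [|| C C0 H] := @energy_le_gagliardo g M T lg M1 gd; rewrite ?le_max ?lexx ?orbT//.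
apply: le_lt_trans (H P L cP LP) _.
by rewrite lte_mul_pinfty ?lee_fin ?(ltW C0)//; apply: gagliardo_lipschitz_lty LP.
Qed.

Lemma derive_bound_lipschitz P p B : (forall t : R, is_derive t 1 P (p t)) ->
  (forall t, `|p t| <= B) -> forall s t, `|P s - P t| <= B * `|s - t|.
Proof.
move=> dP pB.
have cP : continuous P.
  by move=> t; apply: differentiable_continuous; apply/derivable1_diffP; have [] := dP t.
suff H s t : s <= t -> `|P s - P t| <= B * `|s - t|.
  move=> s t; have [/H//|/ltW/H] := leP s t; by rewrite distrC (distrC t).
move=> st; have [] := @MVT_segment R P p s t st.
- exact: continuous_subspaceT.
move=> c _ e; rewrite distrC e normrM (distrC s).
by rewrite ler_wpM2r.
Qed.

Lemma in_arcDl2pi (r x z : R) : in_arc r (x + 2 * pi) z = in_arc r x z.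
Proof. by rewrite /in_arc -(cosD2pi' (x - z)); congr (_ < cos _); ring. Qed.

(** In the period that starts at g (z - pi), the arc condition on [f s] reads g (z - r) < s < g (z +
    r), and [P] is a primitive of [p]. This is where the inverse lift enters the energy. *)
Lemma in_arc_lift_integral f g p P r z : circle_lift f -> circle_lift g ->
  cancel f g -> cancel g f -> continuous p -> (forall t, p (t + 2 * pi) = p t) ->
  (forall t : R, is_derive t 1 P (p t)) -> 0 < r < pi / 2 ->
  (\int[mu]_(s in `[0%R, (2 * pi)%R]) (p s * (in_arc r (f s) z)%:R)%:E =
   (P (g (z + r)) - P (g (z - r)))%:E)%E.
Proof.
move=> lf lg fK gK cp pT dP /andP[r0 r2]; have p0 := pi_gt0 R.
have [cf fi fT] := lf; have [cg gi gT] := lg.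
have mf : measurable_fun setT f by exact: continuous_measurable_fun.
have mh : measurable_fun setT (fun s => (p s * (in_arc r (f s) z)%:R)%:E).
  apply/measurable_EFinP; apply: measurable_funM; first exact: continuous_measurable_fun.
  apply: measurable_boolR; apply: measurable_fun_ltr => //; apply: measurableT_comp.
    by apply: continuous_measurable_fun; exact: continuous_cos.
  exact: measurable_funB.
rewrite -[in LHS](add0r (2 * pi)) (@integral_periodic _ _ 0 (g (z - pi)))//; first last.
- by move=> s; rewrite pT fT in_arcDl2pi.
- by lra.
have -> : g (z - pi) + 2 * pi = g (z + pi) by rewrite -gT; congr g; ring.
have ab : g (z - r) < g (z + r) by apply: gi; lra.
have cpw : {within `[g (z - r), g (z + r)], continuous p} by exact: continuous_subspaceT.
rewrite -(FTC2_is_derive ab (fun x _ => dP x) cpw).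
rewrite [RHS](@integral_itv_bndoo _ _ _ _ true false); last first.
  by apply/measurable_EFinP; apply: measurable_funTS; exact: continuous_measurable_fun.
rewrite integral_mkcond [RHS]integral_mkcond; apply: eq_integral => s _.
rewrite !patchE !mem_setE !in_itv/=.
have Lg u v : (g u < v) = (u < f v) by rewrite -{1}(fK v) (leW_mono (circle_lift_mono lg)).
have Rg u v : (v < g u) = (f v < u) by rewrite -{1}(fK v) (leW_mono (circle_lift_mono lg)).
have Le u v : (g u <= v) = (u <= f v) by rewrite -{1}(fK v) (circle_lift_mono lg).
have Re u v : (v <= g u) = (f v <= u) by rewrite -{1}(fK v) (circle_lift_mono lg).
rewrite Lg Rg Le Re; case: ifPn => h.
  have /andP[h1 h2] := h.
  rewrite in_arcP; [|by apply/andP; split; lra|by rewrite ler_norml; apply/andP; split; lra].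
  rewrite ltr_norml (_ : _ && _ = (z - r < f s < z + r)); last by apply/idP/idP => /andP[? ?]; apply/andP; split; lra.
  by case: ifP => _; rewrite ?mulr1 ?mulr0.
rewrite ifF//; apply/negP => /andP[h1 h2]; move/negP: h; apply; apply/andP; split; lra.
Qed.

End Energy.

Section KernelEnergy.
Variable R : realType.
Local Notation mu := (@lebesgue_measure R).

Lemma strip_measurable (c : R) : measurable [set x : R * R | x.1 - x.2 = c].
Proof.
have -> : [set x : R * R | x.1 - x.2 = c] = setT `&` (fun x : R * R => x.1 - x.2) @^-1` [set c].
  by rewrite setTI.
have m : measurable_fun [set: R * R] (fun x : R * R => x.1 - x.2).
  by apply: measurable_funB; [exact: measurable_fst|exact: measurable_snd].
by apply: m => //; exact: measurable_set1.
Qed.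

Definition torus_square : set (R * R) := `[0, 2 * pi] `*` `[0, 2 * pi].

Lemma measurable_torus_square : measurable torus_square.
Proof. by apply: measurableX; exact: measurable_itv. Qed.

(** This is 2 K_f, with value 0 where the sine vanishes, since ln 0 = 0. *)
Definition arc_log (f : R -> R) (x : R * R) : R := - 2 * ln `|sin ((f x.1 - f x.2) / 2)|.

Lemma measurable_arc_log f : continuous f -> measurable_fun setT (arc_log f).
Proof.
move=> cf; apply: measurable_funM => //; apply: measurableT_comp; first exact: measurable_ln.
apply: measurableT_comp; first exact: normr_measurable.
apply: measurableT_comp; first by apply: continuous_measurable_fun; exact: continuous_sin.
have mf : measurable_fun setT f by exact: continuous_measurable_fun.
apply: measurable_funM => //; apply: measurable_funB.
  by apply: (measurableT_comp mf); exact: measurable_fst.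
by apply: (measurableT_comp mf); exact: measurable_snd.
Qed.

(** On the closed square the sine vanishes only on the diagonal and at two corners, which lie on
    three null lines. *)
Lemma ae_half_chord_neq0 f : circle_lift f ->
  {ae plane, forall x : R * R, torus_square x ->
     sin ((f x.1 - f x.2) / 2) != 0}.
Proof.
move=> lf; have [cf fi fT] := lf; have p0 := pi_gt0 R.
pose S c := [set x : R * R | x.1 - x.2 = c].
exists (S 0 `|` (S (2 * pi) `|` S (- (2 * pi)))); split.
- by do ! apply: measurableU; exact: strip_measurable.
- have SN c : plane.-negligible (S c).
    by apply/negligibleP; [exact: strip_measurable|exact: plane_strip_null].
  by apply/negligibleP; do ?[apply: measurableU]; do ?[exact: strip_measurable]; do ! apply: negligibleU.
move=> x /=; apply: contra_notP => /not_orP[x0 /not_orP[x1 x2]] [].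
rewrite /= !in_itv/= => /andP[a1 a2] /andP[b1 b2].
apply/eqP => s0.
have : cos (f x.1 - f x.2) = 1 by rewrite cos_half s0; ring.
move=> /cos_eq1_intmul[n hn].
have {hn} : f x.1 = f (x.2 + n%:~R * (2 * pi)) by rewrite circle_liftD2piZ// -hn; ring.
move=> /(inc_inj (circle_lift_mono lf)) e.
have n1 : n%:~R * (2 * pi) <= 1%:~R * (2 * pi) :> R by lra.
have n2 : (-1)%:~R * (2 * pi) <= n%:~R * (2 * pi) :> R by rewrite mulrNz; lra.
rewrite !ler_pM2r ?ler_int in n1 n2; try lra.
have : n = 0 \/ n = 1 \/ n = -1.
  by move: n1 n2; clear e; case: n => [[|[|?]]|[|?]]//; [left|right; left|right; right].
case=> [nE|[nE|nE]]; rewrite nE in e.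
- by apply: x0; rewrite /S/= e; ring.
- by apply: x1; rewrite /S/= e; ring.
- by apply: x2; rewrite /S/= e; ring.
Qed.

Lemma ae_arc_kernelE f : circle_lift f ->
  {ae plane, forall x : R * R, torus_square x ->
     arc_kernel (f x.1) (f x.2) = (arc_log f x)%:E}.
Proof.
move=> /ae_half_chord_neq0; apply: (@filterS _ _ (ae_filter_ringOfSetsType plane)) => x H xD.
by apply: arc_kernelE; exact: H.
Qed.

Section Fubini.
Variables f g : R -> R.
Implicit Types (p P : R -> R).
Hypotheses (lf : circle_lift f) (lg : circle_lift g).
Hypotheses (fK : cancel f g) (gK : cancel g f).

(** Here y = (r, z). Integrating [Xi] in [y] yields the kernel, and integrating it in [x] against
    [p x.1 * p x.2] yields a square. The domains are encoded in the factors, so that all integrals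
    run over the whole plane. *)
Let w (y : R * R) : R := (if (0 < y.1) && (y.1 < pi / 2) && ((0 <= y.2) && (y.2 <= 2 * pi))
  then sin y.1 ^- 2 else 0).
Let c (y : R * R) (s : R) : R := \1_(`[0%R, (2 * pi)%R]) s * (in_arc y.1 (f s) y.2)%:R.
Let Xi (x y : R * R) : R := w y * (c y x.1 * c y x.2).

Let w0 y : 0 <= w y.
Proof. by rewrite /w; case: ifP => // _; rewrite invr_ge0 sqr_ge0. Qed.

Let c0 y s : 0 <= c y s.
Proof. by rewrite mulr_ge0. Qed.

Let Xi0 x y : 0 <= Xi x y.
Proof. by rewrite !mulr_ge0. Qed.

Let mw : measurable_fun setT w.
Proof.
have m1 : measurable_fun [set: R * R] (fun xy : R * R => xy.1) by exact: measurable_fst.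
have m2 : measurable_fun [set: R * R] (fun xy : R * R => xy.2) by exact: measurable_snd.
apply: measurable_fun_ifT => //.
  apply: measurable_and; apply: measurable_and.
  - exact: measurable_fun_ltr.
  - exact: measurable_fun_ltr.
  - exact: measurable_fun_ler.
  - exact: measurable_fun_ler.
apply: measurable_funV; apply: measurable_funX; apply: measurableT_comp => //.
by apply: continuous_measurable_fun; exact: continuous_sin.
Qed.

Let mc d (T : measurableType d) (u : T -> R * R) (v : T -> R) :
  measurable_fun setT u -> measurable_fun setT v -> measurable_fun setT (fun t => c (u t) (v t)).
Proof.
move=> mu1 mv.
have mf : measurable_fun setT f by apply: continuous_measurable_fun; have [] := lf.
have mcos : measurable_fun [set: R] (@cos R) by apply: continuous_measurable_fun; exact: continuous_cos.
apply: measurable_funM.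
  by apply: measurableT_comp mv; apply: measurable_indic; exact: measurable_itv.
apply: measurable_boolR; apply: measurable_fun_ltr; apply: measurableT_comp => //.
  by apply: measurableT_comp mu1; exact: measurable_fst.
apply: measurable_funB; first exact: measurableT_comp mv.
by apply: measurableT_comp mu1; exact: measurable_snd.
Qed.

Let mXi : measurable_fun setT (fun xy : (R * R) * (R * R) => Xi xy.1 xy.2).
Proof.
have m1 : measurable_fun [set: (R * R) * (R * R)] (fun xy => xy.1) by exact: measurable_fst.
have m2 : measurable_fun [set: (R * R) * (R * R)] (fun xy => xy.2) by exact: measurable_snd.
apply: measurable_funM; first exact: measurableT_comp mw m2.
apply: measurable_funM; apply: mc => //; apply: measurableT_comp m1.
  exact: measurable_fst.
exact: measurable_snd.
Qed.

Let Xi_integral x : (\int[plane]_y (Xi x y)%:E =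
  if x \in torus_square then arc_kernel (f x.1) (f x.2) else 0)%E.
Proof.
have mXx : measurable_fun [set: R * R] (fun y => (Xi x y)%:E).
  apply/measurable_EFinP.
  exact: (measurable_fun_pair2 (f := fun xy => Xi xy.1 xy.2) x mXi).
case: ifPn => xD; last first.
  apply: integral0_eq => y _; congr (_%:E); rewrite /Xi /c !indicE.
  have [i1|i1] := boolP (x.1 \in `[0%R, (2 * pi)%R]%classic); last by rewrite !mul0r mulr0.
  have [i2|i2] := boolP (x.2 \in `[0%R, (2 * pi)%R]%classic); last by rewrite !mul0r !mulr0.
  exfalso; move/negP: xD; apply; rewrite inE; split => /=; exact: set_mem.
rewrite plane_tonelli1; [|exact: mXx|by move=> y; rewrite lee_fin; exact: Xi0].
rewrite /arc_kernel [RHS]integral_mkcond; apply: eq_integral => r _.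
rewrite patchE mem_setE in_itv/=; case: ifPn => r0; last first.
  by apply: integral0_eq => z _; rewrite /Xi /w/= (negbTE r0) mul0r.
rewrite [RHS]integral_mkcond; apply: eq_integral => z _.
rewrite patchE mem_setE in_itv/= /Xi /w/= r0/=; case: ifPn => z0; last by rewrite mul0r.
have [h1 h2] := set_mem xD.
by rewrite /c /arc_overlap !indicE !mem_set// !mul1r -natrM mulnb.
Qed.

Let c_integral p P y : continuous p -> (forall t, p (t + 2 * pi) = p t) ->
  (forall t : R, is_derive t 1 P (p t)) -> 0 < y.1 < pi / 2 ->
  mu.-integrable setT (EFin \o (fun s => p s * c y s)) /\
  (\int[mu]_s (p s * c y s) = P (g (y.2 + y.1)) - P (g (y.2 - y.1)))%R.
Proof.
move=> cp pT dP y1; split.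
  have mp : measurable_fun setT p by exact: continuous_measurable_fun.
  have ip : mu.-integrable setT ((EFin \o p) \_ `[0, 2 * pi]%classic).
    apply/(integrable_mkcond _ _).1; first exact: measurable_itv.
    exact: continuous_integrable_itv.
  apply: le_integrable ip => //.
  - by apply/measurable_EFinP; apply: measurable_funM => //; exact: mc.
  - move=> s _; rewrite /= patchE /c indicE; case: ifP => _; last by rewrite /= mul0r mulr0 normr0 lexx.
    rewrite lee_fin mul1r normrM; case: (in_arc _ _ _); first by rewrite normr1 mulr1.
    by rewrite normr0 mulr0.
rewrite /Rintegral (_ : (\int[mu]_s _)%E = (P (g (y.2 + y.1)) - P (g (y.2 - y.1)))%:E)//.
rewrite -(in_arc_lift_integral y.2 lf lg fK gK cp pT dP y1) [RHS]integral_mkcond.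
apply: eq_integral => s _; rewrite patchE /c indicE.
by case: ifP => _; rewrite ?mul1r// mul0r mulr0.
Qed.

Let inner_integral p P y : continuous p -> (forall t, p (t + 2 * pi) = p t) ->
  (forall t : R, is_derive t 1 P (p t)) ->
  (\int[plane]_x (p x.1 * p x.2 * Xi x y)%:E =
   (w y * (P (g (y.2 + y.1)) - P (g (y.2 - y.1))) ^+ 2)%:E)%E.
Proof.
move=> cp pT dP.
have [wy|wy] := eqVneq (w y) 0.
  by rewrite wy mul0r integral0_eq// => x _; rewrite /Xi wy mul0r mulr0.
have y1 : 0 < y.1 < pi / 2 by move: wy; rewrite /w; case: ifP => [/andP[]//|]; rewrite eqxx.
have [ic ec] := c_integral cp pT dP y1.
have iwc : mu.-integrable setT (EFin \o (fun s => w y * (p s * c y s))).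
  by apply: eq_integrable (integrableZl measurableT (w y) ic).
have [_ E] := plane_integral_mul iwc ic.
transitivity (\int[plane]_x (w y * (p x.1 * c y x.1) * (p x.2 * c y x.2))%:E)%E.
  by apply: eq_integral => x _; congr (_%:E); rewrite /Xi; ring.
by rewrite E RintegralZl// ec expr2 mulrA.
Qed.

Let outer_integral P : continuous P ->
  (\int[plane]_y (w y * (P (g (y.2 + y.1)) - P (g (y.2 - y.1))) ^+ 2)%:E = energy g P)%E.
Proof.
move=> cP.
have mPg : measurable_fun setT (P \o g).
  apply: continuous_measurable_fun => t; apply: continuous_comp; last exact: cP.
  by have [cg _ _] := lg; exact: cg.
have m1 : measurable_fun [set: R * R] (fun xy : R * R => xy.1) by exact: measurable_fst.
have m2 : measurable_fun [set: R * R] (fun xy : R * R => xy.2) by exact: measurable_snd.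
rewrite plane_tonelli1; last 2 first.
- apply/measurable_EFinP; apply: measurable_funM => //; apply: measurable_funX; apply: measurable_funB.
    by apply: (measurableT_comp mPg); exact: measurable_funD.
  by apply: (measurableT_comp mPg); exact: measurable_funB.
- by move=> y; rewrite lee_fin mulr_ge0// sqr_ge0.
rewrite /energy [RHS]integral_mkcond; apply: eq_integral => r _.
rewrite patchE mem_setE in_itv/=; case: ifPn => r0; last first.
  by apply: integral0_eq => z _; rewrite /w/= (negbTE r0) mul0r.
rewrite [RHS]integral_mkcond; apply: eq_integral => z _.
rewrite patchE mem_setE in_itv/= /w/= r0/=; case: ifPn => z0//; by rewrite mul0r.
Qed.

Variable M : R.
Hypotheses (M1 : 1 < M) (gd : doubling g M pi).

(** A single test function gives absolute integrability: p = 1, whose primitive id is Lipschitz and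
    hence of finite energy. Every bounded [p] is then dominated. *)
Let Xi_lty : (\int[plane]_y \int[plane]_x (Xi x y)%:E < +oo)%E.
Proof.
have d1 (t : R) : is_derive t 1 id (1 : R) by exact: is_derive_id.
have c1 : continuous (fun _ : R => 1 : R) by move=> ?; exact: cvg_cst.
have E y := inner_integral (p := fun=> 1) (P := id) y c1 (fun=> erefl) d1.
under eq_integral => y _.
  under eq_integral => x _ do rewrite -[Xi x y]mul1r -[X in X * _](mulr1 1).
  rewrite E; over.
rewrite (outer_integral (P := id)); last by move=> ?; exact: cvg_id.
apply: (energy_lty (L := 1) lg M1 gd); first by move=> ?; exact: cvg_id.
by move=> s t; rewrite mul1r.
Qed.

Let integrable_Xi p B : continuous p -> (forall t, `|p t| <= B) ->
  (plane \x plane)%E.-integrable setT (fun xy => (p xy.1.1 * p xy.1.2 * Xi xy.1 xy.2)%:E).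
Proof.
move=> cp pB; have mp : measurable_fun setT p by exact: continuous_measurable_fun.
have B0 : 0 <= B by apply: le_trans (pB 0).
have m1 : measurable_fun [set: (R * R) * (R * R)] (fun xy => xy.1) by exact: measurable_fst.
have mXi1 y : measurable_fun [set: R * R] (fun x => (Xi x y)%:E).
  apply/measurable_EFinP.
  exact: (measurable_fun_pair1 (f := fun xy => Xi xy.1 xy.2) y mXi).
have mXi2 : measurable_fun [set: R * R] (fun y => \int[plane]_x (Xi x y)%:E)%E.
  apply: (@measurable_integral_plane R _ _ (fun yx : (R * R) * (R * R) => (Xi yx.2 yx.1)%:E)) => [|x]; last first.
    by rewrite lee_fin.
  apply/measurable_EFinP.
  have ms : measurable_fun setT (fun yx : (R * R) * (R * R) => (yx.2, yx.1)).
    by apply: measurable_fun_pair; [exact: measurable_snd|exact: measurable_fst].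
  exact: (measurableT_comp mXi ms).
have mF : measurable_fun setT (fun xy : (R * R) * (R * R) => (p xy.1.1 * p xy.1.2 * Xi xy.1 xy.2)%:E).
  apply/measurable_EFinP; apply: measurable_funM => //; apply: measurable_funM.
    by apply: (measurableT_comp mp); apply: measurableT_comp m1; exact: measurable_fst.
  by apply: (measurableT_comp mp); apply: measurableT_comp m1; exact: measurable_snd.
apply: (integrable21ltyP plane plane mF).2.
apply: (@le_lt_trans _ _ ((B ^+ 2)%:E * \int[plane]_y \int[plane]_x (Xi x y)%:E)%E); last first.
  by apply: lte_mul_pinfty => //; rewrite lee_fin sqr_ge0.
rewrite -ge0_integralZl//; last 2 first.
- by move=> y _; apply: integral_ge0 => x _; rewrite lee_fin.
- by rewrite lee_fin sqr_ge0.
apply: ge0_le_integral => //.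
- by move=> y _; apply: integral_ge0.
- apply: (@measurable_integral_plane R _ _ (fun yx : (R * R) * (R * R) => `|(p yx.2.1 * p yx.2.2 * Xi yx.2 yx.1)%:E|)%E) => [|x]; last exact: abse_ge0.
  have ms : measurable_fun setT (fun yx : (R * R) * (R * R) => (yx.2, yx.1)).
    by apply: measurable_fun_pair; [exact: measurable_snd|exact: measurable_fst].
  by apply: measurableT_comp; [exact: abse_measurable|exact: (measurableT_comp mF ms)].
- exact: measurable_funeM.
move=> y _; rewrite -ge0_integralZl//; last 3 first.
- exact: mXi1.
- by move=> x _; rewrite lee_fin.
- by rewrite lee_fin sqr_ge0.
apply: ge0_le_integral => //.
- apply: measurableT_comp; first exact: abse_measurable.
  exact: (measurable_fun_pair1 (f := fun xy => (p xy.1.1 * p xy.1.2 * Xi xy.1 xy.2)%:E) y mF).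
- by apply: measurable_funeM; exact: mXi1.
move=> x _; rewrite -EFinM lee_fin normrM (ger0_norm (Xi0 _ _)) ler_wpM2r// normrM expr2.
by apply: ler_pM.
Qed.

Let kernel_fubini p B : continuous p -> (forall t, `|p t| <= B) ->
  plane.-integrable torus_square (fun x => (arc_log f x * (p x.1 * p x.2))%:E) /\
  (\int[plane]_(x in torus_square) (arc_log f x * (p x.1 * p x.2))%:E =
   \int[plane]_y \int[plane]_x (p x.1 * p x.2 * Xi x y)%:E)%E.
Proof.
move=> cp pB; have iF := integrable_Xi cp pB.
have mD := measurable_torus_square.
have mp : measurable_fun setT p by exact: continuous_measurable_fun.
have mk : measurable_fun torus_square (fun x => (arc_log f x * (p x.1 * p x.2))%:E).
  apply: measurable_funTS; apply/measurable_EFinP; apply: measurable_funM.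
    by apply: measurable_arc_log; have [] := lf.
  apply: measurable_funM.
    by apply: (measurableT_comp mp); exact: measurable_fst.
  by apply: (measurableT_comp mp); exact: measurable_snd.
rewrite -(Fubini iF); have iG := integrable_fubini_F iF.
pose G (x : R * R) := (\int[plane]_y (p x.1 * p x.2 * Xi x y)%:E)%E.
have {}iG : plane.-integrable setT G by [].
have GD : G = G \_ torus_square.
  apply/funext => x; rewrite patchE; case: ifPn => // xD.
  have := Xi_integral x; rewrite (negbTE xD) => X0.
  rewrite /G; apply: integral0_eq => y _; rewrite /Xi /c !indicE.
  have [i1|i1] := boolP (x.1 \in `[0%R, (2 * pi)%R]%classic); last by rewrite !mul0r !mulr0.
  have [i2|i2] := boolP (x.2 \in `[0%R, (2 * pi)%R]%classic); last by rewrite !mul0r !mulr0.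
  exfalso; move/negP: xD; apply; rewrite inE; split => /=; exact: set_mem.
have iGD : plane.-integrable torus_square G by apply: integrableS iG.
have mG : measurable_fun torus_square G by case/integrableP : iGD.
have aeG : ae_eq plane torus_square (fun x => (arc_log f x * (p x.1 * p x.2))%:E) G.
  apply: (@filterS _ _ (ae_filter_ringOfSetsType plane)) (ae_arc_kernelE lf) => x H xD.
  have := Xi_integral x; rewrite mem_set// H// => Xx.
  have iX : plane.-integrable setT (fun y => (Xi x y)%:E).
    apply/integrableP; split.
      apply/measurable_EFinP.
      exact: (measurable_fun_pair2 (f := fun xy => Xi xy.1 xy.2) x mXi).
    by under eq_integral do rewrite gee0_abs ?lee_fin//; rewrite Xx ltry.
  rewrite /G; under eq_integral do rewrite EFinM.
  by rewrite integralZl// Xx -EFinM mulrC.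
split; last first.
  rewrite (@ae_eq_integral _ _ _ plane torus_square G _ mD mk mG aeG).
  rewrite -[RHS]/(\int[plane]_x G x)%E integral_mkcond; congr (integral _ _ _).
  by rewrite -GD.
apply/integrableP; split => //.
rewrite (@ae_eq_integral _ _ _ plane torus_square (abse \o G) (abse \o (fun x => (arc_log f x * (p x.1 * p x.2))%:E)) mD).
- by case/integrableP : iGD.
- exact: measurableT_comp.
- exact: measurableT_comp.
- by apply: (@filterS _ _ (ae_filter_ringOfSetsType plane)) aeG => x H xD; exact: (congr1 abse (H xD)).
Qed.

Lemma arc_log_integrable :
  plane.-integrable torus_square (fun x => (arc_log f x)%:E).
Proof.
have c1 : continuous (fun _ : R => 1 : R) by move=> ?; exact: cvg_cst.
have [|H _] := @kernel_fubini (fun=> 1) 1 c1; first by move=> t; rewrite normr1.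
by apply: eq_integrable H => [|x _]; [exact: measurable_torus_square|rewrite !mulr1].
Qed.

Lemma arc_log_energy p P B : continuous p -> (forall t, p (t + 2 * pi) = p t) ->
  (forall t, `|p t| <= B) -> (forall t : R, is_derive t 1 P (p t)) ->
  plane.-integrable torus_square (fun x => (arc_log f x * (p x.1 * p x.2))%:E) /\
  (\int[plane]_(x in torus_square) (arc_log f x * (p x.1 * p x.2))%:E = energy g P)%E.
Proof.
move=> cp pT pB dP; have [i ->] := kernel_fubini cp pB; split => //.
rewrite -outer_integral; last first.
  by move=> t; apply: differentiable_continuous; apply/derivable1_diffP; have [] := dP t.
by apply: eq_integral => y _; exact: inner_integral.
Qed.

End Fubini.
End KernelEnergy.

(** * Trigonometric polynomials *)

Section BigSum.
Variable R : realType.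

Lemma is_derive_bigsum (I : eqType) (s : seq I) (F f : I -> R -> R) (t : R) :
  (forall k, k \in s -> is_derive t 1 (F k) (f k t)) ->
  is_derive t 1 (fun u => \sum_(k <- s) F k u) (\sum_(k <- s) f k t).
Proof.
elim: s => [|k s IH] H.
  have -> : (fun u => \sum_(k <- [::]) F k u) = cst 0.
    by apply/funext => u; rewrite big_nil.
  by rewrite big_nil; exact: is_derive_cst.
have -> : (fun u => \sum_(k <- k :: s) F k u) = F k + (fun u => \sum_(k <- s) F k u).
  by apply/funext => u; rewrite big_cons.
rewrite big_cons; apply: is_deriveD; first by apply: H; rewrite mem_head.
by apply: IH => l ls; apply: H; rewrite in_cons ls orbT.
Qed.

Lemma continuous_bigsum (I : Type) (s : seq I) (f : I -> R -> R) :
  (forall k, continuous (f k)) -> continuous (fun t => \sum_(k <- s) f k t).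
Proof.
move=> H; elim: s => [|k s IH].
  have -> : (fun u => \sum_(k <- [::]) f k u) = cst 0.
    by apply/funext => u; rewrite big_nil.
  by move=> t; exact: cvg_cst.
have -> : (fun u => \sum_(k <- k :: s) f k u) = f k + (fun u => \sum_(k <- s) f k u).
  by apply/funext => u; rewrite big_cons.
by move=> t; apply: cvgD; [exact: H|exact: IH].
Qed.

Lemma is_derive_cosM (m t : R) : is_derive t 1 (fun u => cos (m * u)) (- m * sin (m * t)).
Proof.
have D : is_derive t 1 (fun u => m * u) m.
  by apply: is_derive_eq; rewrite /GRing.scale/= mulr1.
by apply: is_derive_eq (is_derive1_comp (is_derive_cos (m * t)) D) _; ring.
Qed.

Lemma is_derive_sinM (m t : R) : is_derive t 1 (fun u => sin (m * u)) (m * cos (m * t)).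
Proof.
have D : is_derive t 1 (fun u => m * u) m.
  by apply: is_derive_eq; rewrite /GRing.scale/= mulr1.
by apply: is_derive_eq (is_derive1_comp (is_derive_sin (m * t)) D) _; ring.
Qed.

Lemma is_derive_wave (a b m t : R) : is_derive t 1
  (fun u => a * cos (m * u) - b * sin (m * u)) (- (b * m) * cos (m * t) - (a * m) * sin (m * t)).
Proof.
have D1 : is_derive t 1 (fun u => a * cos (m * u)) (a * (- m * sin (m * t))).
  by have := is_deriveZ a (is_derive_cosM m t).
have D2 : is_derive t 1 (fun u => b * sin (m * u)) (b * (m * cos (m * t))).
  by have := is_deriveZ b (is_derive_sinM m t).
by apply: is_derive_eq (is_deriveB D1 D2) _; ring.
Qed.

Lemma is_derive_continuous (F f : R -> R) : (forall t : R, is_derive t 1 F (f t)) -> continuous F.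
Proof.
by move=> dF t; apply: differentiable_continuous; apply/derivable1_diffP; have [] := dF t.
Qed.

End BigSum.

Section TrigPoly.
Variable R : realType.
Local Notation mu := (@lebesgue_measure R).
Implicit Types (s : seq int) (a b : int -> R).

(* The real part of the trigonometric polynomial with coefficients a + i b;
   its imaginary part is trig_poly s b (- a). *)
Definition trig_poly s a b (t : R) : R :=
  \sum_(k <- s) (a k * cos (k%:~R * t) - b k * sin (k%:~R * t)).

Lemma continuous_trig_poly s a b : continuous (trig_poly s a b).
Proof.
apply: continuous_bigsum => k; apply: is_derive_continuous => t; exact: is_derive_wave.
Qed.

Lemma cos_intD2pi (k : int) (t : R) : cos (k%:~R * (t + 2 * pi)) = cos (k%:~R * t).
Proof. by rewrite mulrDr (periodic_intmul (@cosD2pi' R)). Qed.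

Lemma sin_intD2pi (k : int) (t : R) : sin (k%:~R * (t + 2 * pi)) = sin (k%:~R * t).
Proof. by rewrite mulrDr (periodic_intmul (@sinD2pi' R)). Qed.

Lemma trig_polyD2pi s a b t : trig_poly s a b (t + 2 * pi) = trig_poly s a b t.
Proof. by apply: eq_bigr => k _; rewrite cos_intD2pi sin_intD2pi. Qed.

Lemma trig_poly_bounded s a b : exists B, forall t, `|trig_poly s a b t| <= B.
Proof.
exists (\sum_(k <- s) (`|a k| + `|b k|)) => t; apply: le_trans (ler_norm_sum _ _ _) _.
apply: ler_sum => k _; apply: le_trans (ler_normB _ _) _.
by rewrite !normrM lerD// ler_piMr// ler_norml ?cos_geN1 ?cos_le1 ?sin_geN1 ?sin_le1.
Qed.

(** The coefficient a + i b is divided by i k, which the absence of the frequency 0 permits. *)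
Lemma is_derive_trig_poly s a b (t : R) : 0 \notin s ->
  is_derive t 1 (trig_poly s (fun k => b k / k%:~R) (fun k => - (a k / k%:~R))) (trig_poly s a b t).
Proof.
move=> s0.
have H k : k \in s -> is_derive t 1
    (fun u => b k / k%:~R * cos (k%:~R * u) - - (a k / k%:~R) * sin (k%:~R * u))
    ((fun u => a k * cos (k%:~R * u) - b k * sin (k%:~R * u)) t).
  move=> ks; have k0 : k%:~R != 0 :> R.
    by rewrite intr_eq0; apply: contraNneq s0 => <-.
  apply: is_derive_eq (is_derive_wave _ _ _ _) _.
  by rewrite !mulNr opprK !divfK.
exact: (is_derive_bigsum (f := fun k u => a k * cos (k%:~R * u) - b k * sin (k%:~R * u)) H).
Qed.

(** The coefficient of frequency k is multiplied by e^(i k r) - 1. *)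
Lemma trig_poly_diff s a b t r :
  trig_poly s a b (t + r) - trig_poly s a b t =
  trig_poly s (fun k => a k * (cos (k%:~R * r) - 1) - b k * sin (k%:~R * r))
    (fun k => a k * sin (k%:~R * r) + b k * (cos (k%:~R * r) - 1)) t.
Proof.
rewrite /trig_poly -sumrB; apply: eq_bigr => k _.
by rewrite mulrDr cosD sinD; ring.
Qed.

Lemma trig_poly_sqr s a b t :
  trig_poly s a b t ^+ 2 + trig_poly s b (fun k => - a k) t ^+ 2 =
  \sum_(k <- s) \sum_(l <- s) ((a k * a l + b k * b l) * cos ((k - l)%:~R * t)
     - (b k * a l - a k * b l) * sin ((k - l)%:~R * t)).
Proof.
rewrite /trig_poly !expr2 !big_distrlr/= -big_split/=; apply: eq_bigr => k _.
rewrite -big_split/=; apply: eq_bigr => l _.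
by rewrite intrB ![(_ - _) * t]mulrBl cosB sinB; ring.
Qed.

Lemma sum_diag s (X : int -> R) k : uniq s -> k \in s ->
  \sum_(l <- s) (if k - l == 0 then X l else 0) = X k.
Proof.
move=> us ks; rewrite (bigD1_seq k)//= subrr eqxx big1 ?addr0// => l lk.
by rewrite subr_eq0 eq_sym (negbTE lk).
Qed.

Lemma sin_int_pi (m : int) (N : nat) : sin (m%:~R * (2 * pi * N%:R)) = 0 :> R.
Proof.
rewrite (_ : m%:~R * _ = 0 + (m * N%:Z)%:~R * (2 * pi) :> R); last by rewrite intrM; ring.
by rewrite (periodic_intmul (@sinD2pi' R)) sin0.
Qed.

Lemma trig_poly_parseval s a b N : uniq s -> (0 < N)%N ->
  (\int[mu]_(t in `[(- (2 * pi * N%:R))%R, (2 * pi * N%:R)%R])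
    (trig_poly s a b t ^+ 2 + trig_poly s b (fun k => - a k) t ^+ 2)%:E =
   (2 * (2 * pi * N%:R) * \sum_(k <- s) (a k ^+ 2 + b k ^+ 2))%:E)%E.
Proof.
move=> us N0; set T := 2 * pi * N%:R.
have T0 : 0 < T by rewrite /T !mulr_gt0 ?pi_gt0 ?ltr0n.
have TT : - T < T by lra.
pose u k l t := (a k * a l + b k * b l) * cos ((k - l)%:~R * t)
     - (b k * a l - a k * b l) * sin ((k - l)%:~R * t).
(* Primitive of each cross term; for distinct frequencies it takes equal values at the two ends,
   which are a whole number of periods apart. *)
pose U k l t := if k - l == 0 then (a k * a l + b k * b l) * t else
  (b k * a l - a k * b l) / (k - l)%:~R * cos ((k - l)%:~R * t)
  - (- (a k * a l + b k * b l) / (k - l)%:~R) * sin ((k - l)%:~R * t).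
have dU k l (t : R) : is_derive t 1 (U k l) (u k l t).
  rewrite /U /u; case: eqVneq => [->|kl].
    by apply: is_derive_eq; rewrite /GRing.scale/= mul0r cos0 sin0; ring.
  have kl0 : (k - l)%:~R != 0 :> R by rewrite intr_eq0.
  by apply: is_derive_eq (is_derive_wave _ _ _ _) _; rewrite !mulNr opprK !divfK.
have dV (t : R) : is_derive t 1 (fun t => \sum_(k <- s) \sum_(l <- s) U k l t)
    (\sum_(k <- s) \sum_(l <- s) u k l t).
  apply: (is_derive_bigsum (f := fun k t => \sum_(l <- s) u k l t)) => k _.
  by apply: (is_derive_bigsum (f := fun l t => u k l t)) => l _; exact: dU.
under eq_integral do rewrite trig_poly_sqr.
have cu : continuous (fun t => \sum_(k <- s) \sum_(l <- s) u k l t).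
  apply: continuous_bigsum => k; apply: continuous_bigsum => l.
  by apply: is_derive_continuous => t; exact: is_derive_wave.
rewrite (FTC2_is_derive TT (fun x _ => dV x)); last exact: continuous_subspaceT.
congr (_%:E); rewrite -sumrB mulr_sumr big_seq [RHS]big_seq; apply: eq_bigr => k ks.
rewrite -sumrB -(sum_diag (fun l => 2 * T * (a l ^+ 2 + b l ^+ 2)) us ks).
apply: eq_bigr => l _; rewrite /U; case: ifPn => [|_].
  by rewrite subr_eq0 => /eqP ->; ring.
by rewrite mulrN cosN sinN sin_int_pi; ring.
Qed.

End TrigPoly.

(** * The Gagliardo seminorm of a trigonometric polynomial *)

Section TrigGagliardo.
Variable R : realType.
Local Notation mu := (@lebesgue_measure R).
Implicit Types (s : seq int) (a b : int -> R).

(** The sine is bounded by 1 and by its argument. The right side is a smooth majorant of the smaller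
    of the two resulting bounds, chosen because its primitive is an arctangent and its total
    integral is 4 pi |m|. *)
Lemma sin_kernel_le (m r : R) : 4 * sin (m * r / 2) ^+ 2 / r ^+ 2 <= 8 * m ^+ 2 / (4 + m ^+ 2 * r ^+ 2).
Proof.
have [->|r0] := eqVneq r 0; first by rewrite !expr0n/= invr0 !mulr0 addr0 divr_ge0// mulr_ge0// sqr_ge0.
have d0 : 0 < 4 + m ^+ 2 * r ^+ 2 by rewrite -exprMn; have := sqr_ge0 (m * r); lra.
have r2 : 0 < r ^+ 2 by rewrite exprn_even_gt0.
have s1 : sin (m * r / 2) ^+ 2 <= 1.
  by rewrite -[leRHS](expr1n _ 2) -(real_normK (num_real (sin _))) ler_pXn2r ?nnegrE// ler_norml sin_geN1 sin_le1.
have s2 : sin (m * r / 2) ^+ 2 <= (m * r / 2) ^+ 2.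
  by rewrite -(real_normK (num_real (sin _))) -(real_normK (num_real (m * r / 2))) ler_pXn2r ?nnegrE// abs_sin_le.
rewrite ler_pdivrMr// [leRHS]mulrAC ler_pdivlMr//.
have e : (m * r / 2) ^+ 2 = m ^+ 2 * r ^+ 2 / 4 by field.
have s0 := sqr_ge0 (sin (m * r / 2)).
move: s0 s1 s2; rewrite e; move: (sin _ ^+ 2) => q s0 s1 s2.
have xy : 0 <= m ^+ 2 * r ^+ 2 by rewrite mulr_ge0 ?sqr_ge0.
move: s2 xy; rewrite -(mulrA 8); move: (m ^+ 2 * r ^+ 2) => v s2 v0.
have : q * v <= v by rewrite ler_piMl.
by rewrite -mulrA mulrDr; lra.
Qed.

Lemma atan_kernel_integral_le (k : int) T : 0 < T ->
  (\int[mu]_(r in `[(- T)%R, T]) (8 * k%:~R ^+ 2 / (4 + k%:~R ^+ 2 * r ^+ 2))%:E <=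
   (4 * pi * `|k%:~R|)%:E)%E.
Proof.
move=> T0; have TT : - T < T by lra.
set m : R := k%:~R.
have d0 r : 4 + m ^+ 2 * r ^+ 2 != 0.
  by rewrite gt_eqF// -exprMn; have := sqr_ge0 (m * r); lra.
have dF (r : R) : is_derive r 1 (fun r => 4 * m * atan (m / 2 * r)) (8 * m ^+ 2 / (4 + m ^+ 2 * r ^+ 2)).
  have D1 : is_derive r 1 (fun r => m / 2 * r) (m / 2).
    by apply: is_derive_eq; rewrite /GRing.scale/= mulr1.
  have D2 := is_derive1_comp (is_derive1_atan (m / 2 * r)) D1.
  have D3 := is_deriveZ (4 * m) D2.
  apply: is_derive_eq D3 _; rewrite /GRing.scale/=.
  have -> : 1 + (m / 2 * r) ^+ 2 = (4 + m ^+ 2 * r ^+ 2) / 4 by field.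
  by move: (d0 r); move: (4 + _) => q q0; field.
have cf : continuous (fun r : R => 8 * m ^+ 2 / (4 + m ^+ 2 * r ^+ 2)).
  move=> r; apply: cvgM; first exact: cvg_cst.
  apply: cvgV => //; apply: cvgD; first exact: cvg_cst.
  by apply: cvgM; [exact: cvg_cst|exact: exprn_continuous].
rewrite (FTC2_is_derive TT (fun x _ => dF x)); last exact: continuous_subspaceT.
rewrite lee_fin -mulrBr; apply: le_trans (ler_norm _) _.
have h : `|atan (m / 2 * T) - atan (m / 2 * - T)| <= pi.
  rewrite ler_norml; move: (atan_ltpi2 (m / 2 * T)) (atan_gtNpi2 (m / 2 * T))
    (atan_ltpi2 (m / 2 * - T)) (atan_gtNpi2 (m / 2 * - T)).
  by move: (atan _) (atan _) => x y ? ? ? ?; apply/andP; split; lra.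
by rewrite !normrM [X in X * _ * _]ger0_norm// (mulrAC _ pi) ler_wpM2l.
Qed.

Let gag2 s a b T (y : R * R) : R :=
  gagliardo (trig_poly s a b) T y + gagliardo (trig_poly s b (fun k => - a k)) T y.

Let gag2_shift_le s a b T t r : gag2 s a b T (t, r + t) <=
  if `|t| <= T then if `|r| <= 2 * T then
   ((trig_poly s a b (t + r) - trig_poly s a b t) ^+ 2
    + (trig_poly s b (fun k => - a k) (t + r) - trig_poly s b (fun k => - a k) t) ^+ 2) / r ^+ 2 else 0 else 0.
Proof.
rewrite /gag2 /gagliardo/=; case: ifPn => t1; last by rewrite addr0.
have X0 : 0 <= ((trig_poly s a b (t + r) - trig_poly s a b t) ^+ 2
    + (trig_poly s b (fun k => - a k) (t + r) - trig_poly s b (fun k => - a k) t) ^+ 2) / r ^+ 2.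
  by rewrite divr_ge0 ?sqr_ge0// addr_ge0// sqr_ge0.
case: ifPn => t2; last by rewrite addr0; case: ifP.
rewrite ifT; last first.
  by move: t1 t2; rewrite !ler_norml => /andP[? ?] /andP[? ?]; apply/andP; split; lra.
have -> : t - (r + t) = - r by ring.
rewrite sqrrN -mulrDl (addrC r) ![X in X / _ <= _](_ : _ = 
 (trig_poly s a b (t + r) - trig_poly s a b t) ^+ 2
    + (trig_poly s b (fun k => - a k) (t + r) - trig_poly s b (fun k => - a k) t) ^+ 2)//; ring.
Qed.

(** For a fixed difference [r], Parseval over whole periods weights the squared coefficients by 4
    sin^2 (k r / 2); integrating against r^-2 through [sin_kernel_le] produces |k|. The constant is
    2 T from Parseval times 4 pi from the arctangent. *)
Lemma trig_poly_gagliardo_le s a b N T : uniq s -> (0 < N)%N -> T = 2 * pi * N%:R ->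
  (\int[plane]_y (gagliardo (trig_poly s a b) T y)%:E
    + \int[plane]_y (gagliardo (trig_poly s b (fun k => - a k)) T y)%:E <=
   (8 * pi * T * \sum_(k <- s) `|k%:~R| * (a k ^+ 2 + b k ^+ 2))%:E)%E.
Proof.
move=> us N0 TE; have T0 : 0 < T by rewrite TE !mulr_gt0 ?pi_gt0 ?ltr0n.
have cP1 := @continuous_trig_poly R s a b.
have cP2 := @continuous_trig_poly R s b (fun k => - a k).
have mG1 := measurable_gagliardo T cP1.
have mG2 := measurable_gagliardo T cP2.
rewrite -ge0_integralD//; last 4 first.
- by move=> y _; rewrite lee_fin gagliardo_ge0.
- exact/measurable_EFinP.
- by move=> y _; rewrite lee_fin gagliardo_ge0.
- exact/measurable_EFinP.
rewrite -[leLHS]/(\int[plane]_y (gag2 s a b T y)%:E)%E.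
have G0 y : 0 <= gag2 s a b T y by rewrite addr_ge0// gagliardo_ge0.
have mG : measurable_fun setT (fun y => (gag2 s a b T y)%:E).
  by apply/measurable_EFinP; exact: measurable_funD.
rewrite plane_tonelli1//.
have shift t : (\int[mu]_t' (gag2 s a b T (t, t'))%:E = \int[mu]_r (gag2 s a b T (t, r + t))%:E)%E.
  rewrite -(@ge0_integral_shift _ t setT)//; last by move=> x; rewrite lee_fin.
  apply/measurable_EFinP.
  exact: (measurable_fun_pair2 (f := gag2 s a b T) t (measurable_funD mG1 mG2)).
under eq_integral do rewrite shift.
have mS : measurable_fun setT (fun tr : R * R => (gag2 s a b T (tr.1, tr.2 + tr.1))%:E).
  have m1 : measurable_fun [set: R * R] (fun xy : R * R => xy.1) by exact: measurable_fst.
  have m2 : measurable_fun [set: R * R] (fun xy : R * R => xy.2) by exact: measurable_snd.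
  have mt : measurable_fun [set: R * R] (fun tr : R * R => (tr.1, tr.2 + tr.1)).
    by apply: measurable_fun_pair => //; exact: measurable_funD.
  exact: (measurableT_comp mG mt).
rewrite (line_tonelli mS); last by move=> x; rewrite lee_fin.
pose w (k : int) (r : R) : R := 8 * k%:~R ^+ 2 / (4 + k%:~R ^+ 2 * r ^+ 2).
pose c k := 2 * T * (a k ^+ 2 + b k ^+ 2).
have c0 k : 0 <= c k by rewrite mulr_ge0 ?addr_ge0 ?sqr_ge0//; lra.
have w0 k r : 0 <= w k r.
  by apply: divr_ge0; [rewrite mulr_ge0 ?sqr_ge0|rewrite addr_ge0// mulr_ge0 ?sqr_ge0].
have mw k : measurable_fun setT (w k).
  apply: measurable_funM => //; apply: measurable_funV; apply: measurable_funD => //.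
  by apply: measurable_funM => //; exact: measurable_funX.
have mcw k : measurable_fun [set: R] (fun r => (c k * w k r)%:E).
  by apply/measurable_EFinP; exact: measurable_funM.
apply: (@le_trans _ _ (\int[mu]_(r in `[(- (2 * T))%R, (2 * T)%R]) \sum_(k <- s) (c k * w k r)%:E)%E); last first.
  rewrite ge0_integral_sum//; last 2 first.
  - by move=> k; apply: measurable_funTS; exact: mcw.
  - by move=> k r _; rewrite lee_fin mulr_ge0.
  rewrite mulr_sumr -sumEFin; apply: lee_sum => k _.
  under eq_integral do rewrite EFinM.
  rewrite ge0_integralZl//; last 3 first.
  - by apply/measurable_EFinP; apply: measurable_funTS; exact: mw.
  - by move=> r _; rewrite lee_fin.
  - by rewrite lee_fin.
  have T2 : 0 < 2 * T by lra.
  apply: le_trans (lee_wpmul2l _ (atan_kernel_integral_le k T2)) _; first by rewrite lee_fin.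
  by rewrite -EFinM lee_fin /c le_eqVlt; apply/orP; left; apply/eqP; ring.
rewrite [leRHS]integral_mkcond; apply: ge0_le_integral => //.
- by move=> r _; apply: integral_ge0 => t _; rewrite lee_fin.
- apply: (@measurable_integral_line R _ _ (fun rt : R * R => (gag2 s a b T (rt.2, rt.1 + rt.2))%:E)) => [|x]; last by rewrite lee_fin.
  have ms : measurable_fun setT (fun rt : R * R => (rt.2, rt.1)).
    by apply: measurable_fun_pair; [exact: measurable_snd|exact: measurable_fst].
  exact: (measurableT_comp mS ms).
- apply/(measurable_restrictT _ _).1 => //.
  apply: measurable_funTS; apply: emeasurable_sum => k.
  exact: mcw.
move=> r _; rewrite patchE mem_setE in_itv/= -ler_norml; case: ifPn => r2; last first.
  rewrite integral0_eq; first exact: lexx.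
  move=> t _; congr (_%:E); apply/eqP; rewrite eq_le G0 andbT.
  by have := gag2_shift_le s a b T t r; rewrite (negbTE r2) if_same.
pose A k := a k * (cos (k%:~R * r) - 1) - b k * sin (k%:~R * r).
pose B k := a k * sin (k%:~R * r) + b k * (cos (k%:~R * r) - 1).
have iA : (\int[mu]_(t in `[(- T)%R, T]) (trig_poly s A B t ^+ 2 + trig_poly s B (fun k => - A k) t ^+ 2)%:E
   = (2 * T * \sum_(k <- s) (A k ^+ 2 + B k ^+ 2))%:E)%E by rewrite TE; exact: trig_poly_parseval.
have cAB : continuous (fun t => trig_poly s A B t ^+ 2 + trig_poly s B (fun k => - A k) t ^+ 2).
  have sq (q : R -> R) : continuous q -> continuous (fun t => q t ^+ 2).
    by move=> cq t; apply: (@continuous_comp _ _ _ q (fun x => x ^+ 2)); [exact: cq|exact: exprn_continuous].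
  by move=> t; apply: cvgD; apply: sq; exact: continuous_trig_poly.
have mAB := continuous_measurable_fun cAB.
apply: (@le_trans _ _ (\int[mu]_(t in `[(- T)%R, T]) ((r ^- 2)%:E * (trig_poly s A B t ^+ 2 + trig_poly s B (fun k => - A k) t ^+ 2)%:E))%E).
  rewrite [leRHS]integral_mkcond; apply: ge0_le_integral => //.
  - by move=> t _; rewrite lee_fin.
  - exact: (measurable_fun_pair1 r mS).
  - apply/(measurable_restrictT _ _).1 => //.
    by apply: measurable_funTS; apply: measurable_funeM; exact/measurable_EFinP.
  move=> t _; rewrite patchE mem_setE in_itv/= -ler_norml.
  have := gag2_shift_le s a b T t r; rewrite r2; case: ifP => _; rewrite -lee_fin//.
  move=> h; apply: le_trans h _; rewrite -EFinM lee_fin !trig_poly_diff mulrC.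
  rewrite (_ : trig_poly s B (fun k => - A k) t = trig_poly s
     (fun k => b k * (cos (k%:~R * r) - 1) - - a k * sin (k%:~R * r))
     (fun k => b k * sin (k%:~R * r) + - a k * (cos (k%:~R * r) - 1)) t)//.
  by apply: eq_bigr => k _; rewrite /A /B; ring.
rewrite ge0_integralZl//; last 3 first.
- by apply: measurable_funTS; exact/measurable_EFinP.
- by move=> t _; rewrite lee_fin addr_ge0 ?sqr_ge0.
- by rewrite lee_fin invr_ge0 sqr_ge0.
rewrite iA -EFinM sumEFin lee_fin mulrCA mulr_sumr mulr_sumr; apply: ler_sum => k _.
have -> : A k ^+ 2 + B k ^+ 2 = (a k ^+ 2 + b k ^+ 2) * (4 * sin (k%:~R * r / 2) ^+ 2).
  have := cos_half (k%:~R * r); have := cos2Dsin2 (k%:~R * r); rewrite /A /B.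
  move: (sin (k%:~R * r / 2)) (cos _) (sin _) => q x y h1 h2.
  have -> : 4 * q ^+ 2 = (x - 1) ^+ 2 + y ^+ 2 by rewrite -(mulr1 2) in h2 *; nra.
  by ring.
rewrite /c -[leRHS]mulrA ler_wpM2l//; first by lra.
rewrite mulrCA ler_wpM2l ?addr_ge0 ?sqr_ge0// mulrC.
exact: sin_kernel_le.
Qed.

End TrigGagliardo.

(** * Pairing integrable kernels with bounded test functions *)

Section TorusPairing.
Variable R : realType.
Local Notation mu := (@lebesgue_measure R).
Implicit Types (V psi : R * R -> R).

Definition pairing V psi : R := \int[plane]_(x in @torus_square R) (V x * psi x).

Definition tame psi := measurable_fun setT psi /\ exists B, forall x, `|psi x| <= B.

Definition torus_integrable V := plane.-integrable (@torus_square R) (EFin \o V).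

(* measurable_torus_square for the structure carried by plane: the two product
   structures on R * R are convertible but not unified. *)
Lemma measurable_prod_square :
  measurable (@torus_square R : set (measurableTypeR R * measurableTypeR R)).
Proof. exact: measurable_torus_square. Qed.

Lemma tame_cst (c : R) : tame (fun=> c).
Proof. by split => //; exists `|c|. Qed.

Lemma tameM psi1 psi2 : tame psi1 -> tame psi2 -> tame (fun x => psi1 x * psi2 x).
Proof.
move=> [m1 [B1 H1]] [m2 [B2 H2]]; split; first exact: measurable_funM.
by exists (B1 * B2) => x; rewrite normrM ler_pM.
Qed.

Lemma tameD psi1 psi2 : tame psi1 -> tame psi2 -> tame (fun x => psi1 x + psi2 x).
Proof.
move=> [m1 [B1 H1]] [m2 [B2 H2]]; split; first exact: measurable_funD.
by exists (B1 + B2) => x; apply: le_trans (ler_normD _ _) _; exact: lerD.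
Qed.

Lemma tame_sum (I : Type) (s : seq I) (F : I -> R * R -> R) :
  (forall i, tame (F i)) -> tame (fun x => \sum_(i <- s) F i x).
Proof.
move=> H; elim: s => [|i s IH].
  by under eq_fun do rewrite big_nil; exact: tame_cst.
by under eq_fun do rewrite big_cons; exact: tameD.
Qed.

Lemma tame_fst (p : R -> R) B : measurable_fun setT p -> (forall t, `|p t| <= B) ->
  tame (fun x => p x.1).
Proof.
move=> mp pB; split; last by exists B.
by apply: (measurableT_comp mp); exact: measurable_fst.
Qed.

Lemma tame_snd (p : R -> R) B : measurable_fun setT p -> (forall t, `|p t| <= B) ->
  tame (fun x => p x.2).
Proof.
move=> mp pB; split; last by exists B.
by apply: (measurableT_comp mp); exact: measurable_snd.
Qed.

Lemma tame_swap psi : tame psi -> tame (fun x => psi (x.2, x.1)).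
Proof.
move=> [m [B H]]; split; last by exists B.
have ms : measurable_fun [set: R * R] (fun x : R * R => (x.2, x.1)).
  by apply: measurable_fun_pair; [exact: measurable_snd|exact: measurable_fst].
exact: (measurableT_comp m ms).
Qed.

Lemma torus_integrableZl V (c : R) : torus_integrable V -> torus_integrable (fun x => c * V x).
Proof.
move=> iV.
have mD := measurable_prod_square.
exact: (integrableZl mD c iV).
Qed.

Lemma integrable_tame V psi : torus_integrable V -> tame psi ->
  torus_integrable (fun x => V x * psi x).
Proof.
move=> iV [m [B H]]; have mD := @measurable_torus_square R.
have mV : measurable_fun (@torus_square R) V by case/integrableP : iV => /measurable_EFinP.
apply: (@le_integrable _ _ _ plane _ mD _ (fun x => (B * V x)%:E)).
- by apply/measurable_EFinP; apply: measurable_funM => //; exact: measurable_funTS.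
- move=> x _; rewrite lee_fin !normrM mulrC ler_wpM2r//.
  by apply: le_trans (H x) (ler_norm _).
- exact: torus_integrableZl.
Qed.

Lemma pairing_sum (I : Type) (s : seq I) V (c : I -> R) (F : I -> R * R -> R) :
  torus_integrable V -> (forall i, tame (F i)) ->
  pairing V (fun x => \sum_(i <- s) c i * F i x) = \sum_(i <- s) c i * pairing V (F i).
Proof.
move=> iV tF; have mD := @measurable_torus_square R.
elim: s => [|i s IH].
  rewrite big_nil /pairing; under eq_Rintegral do rewrite big_nil mulr0.
  by rewrite Rintegral_cst// mul0r.
rewrite big_cons -IH /pairing.
have tc j : tame (fun x => c j * F j x) by apply: tameM => //; exact: tame_cst.
rewrite -RintegralZl//; last exact: integrable_tame.
rewrite -RintegralD//; last 2 first.
- exact: (torus_integrableZl (c i) (integrable_tame iV (tF i))).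
- by apply: (integrable_tame iV); exact: tame_sum.
by apply: eq_Rintegral => x _; rewrite big_cons; ring.
Qed.

Lemma pairingZl V psi (c : R) : torus_integrable V -> tame psi ->
  pairing V (fun x => c * psi x) = c * pairing V psi.
Proof.
move=> iV tp; have := pairing_sum [:: tt] (fun=> c) iV (fun=> tp).
by rewrite big_seq1 => <-; congr pairing; apply/funext => x; rewrite big_seq1.
Qed.

Lemma pairingB V psi1 psi2 : torus_integrable V -> tame psi1 -> tame psi2 ->
  pairing V (fun x => psi1 x - psi2 x) = pairing V psi1 - pairing V psi2.
Proof.
move=> iV t1 t2.
have := @pairing_sum _ [:: true; false] V (fun b => if b then 1 else -1) (fun b => if b then psi1 else psi2) iV.
rewrite !big_cons !big_nil !addr0 mul1r mulN1r => <-; last by case.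
by congr pairing; apply/funext => x; rewrite !big_cons big_nil; ring.
Qed.

(** Fubini in the two orders; the symmetry of the kernel becomes the Hermitian symmetry of the
    matrix. *)
Lemma pairing_swap V psi : torus_integrable V -> tame psi ->
  (forall x, V (x.2, x.1) = V x) ->
  pairing V (fun x => psi (x.2, x.1)) = pairing V psi.
Proof.
move=> iV tp Vs; have mD := @measurable_torus_square R.
pose F := (EFin \o (fun x => V x * psi x)) \_ (@torus_square R).
pose G := (EFin \o (fun x => V x * psi (x.2, x.1))) \_ (@torus_square R).
have iF : plane.-integrable setT F by rewrite /F; apply/(integrable_mkcond _ _).1 => //; exact: integrable_tame.
have iG : plane.-integrable setT G.
  by rewrite /G; apply/(integrable_mkcond _ _).1 => //; apply: integrable_tame => //; exact: tame_swap.
have FG x y : G (x, y) = F (y, x).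
  rewrite /F /G !patchE; have -> : ((x, y) \in @torus_square R) = ((y, x) \in @torus_square R).
    by apply/idP/idP; rewrite !inE => -[? ?]; split.
  by case: ifP => //= _; rewrite -(Vs (x, y)).
rewrite /pairing /Rintegral; congr fine.
rewrite integral_mkcond [RHS]integral_mkcond -/F -/G.
rewrite -[LHS](integral12_prod_meas1 (m1 := mu) (m2 := mu) iG).
rewrite -[RHS](integral21_prod_meas1 (m1 := mu) (m2 := mu) iF).
by apply: eq_integral => x _; apply: eq_integral => y _; rewrite FG.
Qed.

End TorusPairing.

Section ArcLogForm.
Variable R : realType.

(** The half-width of the square has to contain the images of the arcs and, for Parseval, to be a
    whole number of periods. *)
Lemma lift_natmul_bound (u v : R) : exists2 N, (0 < N)%N & `|u| <= 2 * pi * N%:R /\ `|v| <= 2 * pi * N%:R.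
Proof.
have p0 := pi_gt0 R; have p2 : 1 <= 2 * pi :> R by have := pi_ge2 R; lra.
pose n := (Num.truncn (`|u| + `|v|)).+1; exists n => //.
have : `|u| + `|v| < n%:R by apply: truncnS_gt.
have n0 : 0 <= n%:R :> R by [].
have : n%:R <= 2 * pi * n%:R :> R by rewrite ler_peMl.
by have := normr_ge0 u; have := normr_ge0 v => ? ? ? ?; split; lra.
Qed.

(** The real part of p (x.1) times the conjugate of p (x.2), for the complex trigonometric
    polynomial p with coefficients a + i b. *)
Definition trig_form (s : seq int) (a b : int -> R) (x : R * R) : R :=
  trig_poly s a b x.1 * trig_poly s a b x.2
  + trig_poly s b (fun k => - a k) x.1 * trig_poly s b (fun k => - a k) x.2.

Lemma tame_trig_poly_mul s a b :
  tame (fun x : R * R => trig_poly s a b x.1 * trig_poly s a b x.2).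
Proof.
have [B HB] := trig_poly_bounded s a b.
have m : measurable_fun setT (trig_poly s a b) by apply: continuous_measurable_fun; exact: continuous_trig_poly.
by apply: tameM; [exact: (tame_fst m HB)|exact: (tame_snd m HB)].
Qed.

Lemma trig_form_expand s a b x : trig_form s a b x =
  \sum_(k <- s) \sum_(l <- s) ((a k * a l + b k * b l) * cos (k%:~R * x.1 - l%:~R * x.2)
     + (a k * b l - b k * a l) * sin (k%:~R * x.1 - l%:~R * x.2)).
Proof.
rewrite /trig_form /trig_poly !big_distrlr/= -big_split/=; apply: eq_bigr => k _.
rewrite -big_split/=; apply: eq_bigr => l _.
by rewrite cosB sinB; ring.
Qed.

(** The energy bound is applied to primitives of the real and imaginary parts. Their coefficients
    are divided by i k, so |k| becomes |k|^-1, the weight that the factors sqrt |k| of the matrix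
    compensate. *)
Lemma arc_log_form_bound f g M : circle_lift f -> circle_lift g ->
  cancel f g -> cancel g f -> 1 < M -> doubling g M pi ->
  exists2 K, 0 < K & forall s a b, uniq s -> 0 \notin s ->
    0 <= pairing (arc_log f) (trig_form s a b) <=
    K * \sum_(k <- s) `|k%:~R|^-1 * (a k ^+ 2 + b k ^+ 2).
Proof.
move=> lf lg fK gK M1 gd; have p0 := pi_gt0 R.
have [N N0 [T1 T2]] := lift_natmul_bound (g (- (2 * pi))) (g (4 * pi)).
set T := 2 * pi * N%:R in T1 T2.
have T0 : 0 < T by rewrite /T !mulr_gt0 ?ltr0n.
have [C C0 HC] := energy_le_gagliardo lg M1 gd T1 T2.
have K0 : 0 < C * (8 * pi * T) by rewrite mulr_gt0// mulr_gt0// mulr_gt0.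
exists (C * (8 * pi * T)) => // s a b us s0.
have iA := arc_log_integrable lf lg fK gK M1 gd.
pose A k := b k / k%:~R; pose B k := - (a k / k%:~R).
have kn0 k : k \in s -> k%:~R != 0 :> R.
  by move=> ks; rewrite intr_eq0; apply: contraNneq s0 => <-.
have dP1 (t : R) : is_derive t 1 (trig_poly s A B) (trig_poly s a b t) by exact: is_derive_trig_poly.
have dP2 (t : R) : is_derive t 1 (trig_poly s B (fun k => - A k)) (trig_poly s b (fun k => - a k) t).
  have := is_derive_trig_poly b (fun k => - a k) t s0.
  have -> : (fun k : int => - a k / k%:~R) = B by apply/funext => k; rewrite mulNr.
  by [].
have [B1 HB1] := trig_poly_bounded s a b.
have [B2 HB2] := trig_poly_bounded s b (fun k => - a k).
have [_ e1] := arc_log_energy lf lg fK gK M1 gd (@continuous_trig_poly _ _ _ _) (@trig_polyD2pi _ _ _ _) HB1 dP1.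
have [_ e2] := arc_log_energy lf lg fK gK M1 gd (@continuous_trig_poly _ _ _ _) (@trig_polyD2pi _ _ _ _) HB2 dP2.
have L1 := derive_bound_lipschitz dP1 HB1.
have L2 := derive_bound_lipschitz dP2 HB2.
have c1 : continuous (trig_poly s A B) by exact: continuous_trig_poly.
have c2 : continuous (trig_poly s B (fun k => - A k)) by exact: continuous_trig_poly.
have f1 := energy_lty lg M1 gd c1 L1.
have f2 := energy_lty lg M1 gd c2 L2.
have -> : pairing (arc_log f) (trig_form s a b) =
    fine (energy g (trig_poly s A B)) + fine (energy g (trig_poly s B (fun k => - A k))).
  rewrite -e1 -e2 -/(Rintegral _ _ _) /pairing -RintegralD//.
  - by apply: eq_Rintegral => x _; rewrite /trig_form mulrDr.
  - exact: measurable_torus_square.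
  - exact: (integrable_tame iA (tame_trig_poly_mul s a b)).
  - exact: (integrable_tame iA (tame_trig_poly_mul s b (fun k => - a k))).
have g1 := energy_ge0 g (trig_poly s A B).
have g2 := energy_ge0 g (trig_poly s B (fun k => - A k)).
have h3 := trig_poly_gagliardo_le A B us N0 (erefl T).
have := leeD (HC _ _ c1 L1) (HC _ _ c2 L2).
rewrite -ge0_muleDr; [|by apply: integral_ge0 => y _; rewrite lee_fin gagliardo_ge0..].
have C0' : (0 <= C%:E)%E by rewrite lee_fin ltW.
move=> /le_trans; move/(_ _ (lee_wpmul2l C0' h3)); rewrite -EFinM.
move: (energy g (trig_poly s A B)) (energy g (trig_poly s B (fun k => - A k))) f1 f2 g1 g2.
move=> {e1 e2 HC} x1 x2 f1 f2 g1 g2.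
have n1 : x1 \is a fin_num by rewrite ge0_fin_numE.
have n2 : x2 \is a fin_num by rewrite ge0_fin_numE.
rewrite -(fineK n1) -(fineK n2) in g1 g2 *; rewrite !lee_fin in g1 g2.
move: (fine _) (fine _) g1 g2 => x y g1 g2; rewrite -EFinD lee_fin => h4.
apply/andP; split; first exact: addr_ge0.
apply: le_trans h4 _; rewrite -(mulrA C) ler_pM2l//.
rewrite ler_pM2l; last by rewrite mulr_gt0// mulr_gt0.
rewrite le_eqVlt; apply/orP; left; apply/eqP.
rewrite big_seq [RHS]big_seq; apply: eq_bigr => k ks.
have k0 := kn0 k ks; have n0 : `|k%:~R| != 0 :> R by rewrite normr_eq0.
rewrite /A /B sqrrN !expr_div_n -mulrDl -(real_normK (num_real (k%:~R : R))).
by move: `|k%:~R| n0 => q q0; field.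
Qed.

End ArcLogForm.

(** * Bounded Hermitian matrices *)

Section ComplexSquaredNorm.
Local Open Scope complex_scope.
Local Open Scope ring_scope.
Variable R : realType.
Implicit Types (x y z : R[i]).

Definition sqn z : R := complex.Re z ^+ 2 + complex.Im z ^+ 2.

Lemma sqn_ge0 z : 0 <= sqn z.
Proof. by rewrite addr_ge0// sqr_ge0. Qed.

Lemma normc_sqr z : ComplexField.Normc.normc z ^+ 2 = sqn z.
Proof. by case: z => a b /=; rewrite sqr_sqrtr// addr_ge0// sqr_ge0. Qed.

Lemma sqn0 : sqn 0 = 0.
Proof. by rewrite /sqn/= expr0n addr0. Qed.

Lemma sqnN z : sqn (- z) = sqn z.
Proof. by case: z => a b; rewrite /sqn/= !sqrrN. Qed.

Lemma sqnD_le x y : sqn (x + y) <= 2 * (sqn x + sqn y).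
Proof.
case: x => a b; case: y => c d; rewrite /sqn/=.
by have := sqr_ge0 (a - c); have := sqr_ge0 (b - d); lra.
Qed.

Lemma Re_sum (I : Type) (s : seq I) (F : I -> R[i]) :
  complex.Re (\sum_(k <- s) F k) = \sum_(k <- s) complex.Re (F k).
Proof. by apply: (big_morph (@complex.Re R)) => // -[a b] [c d]. Qed.

Lemma Im_sum (I : Type) (s : seq I) (F : I -> R[i]) :
  complex.Im (\sum_(k <- s) F k) = \sum_(k <- s) complex.Im (F k).
Proof. by apply: (big_morph (@complex.Im R)) => // -[a b] [c d]. Qed.

Lemma cauchy_schwarz_sum (I : Type) (s : seq I) (a p q : I -> R) :
  (forall k, 0 <= p k) -> (forall k, 0 <= q k) -> (forall k, a k ^+ 2 <= p k * q k) ->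
  (\sum_(k <- s) a k) ^+ 2 <= (\sum_(k <- s) p k) * (\sum_(k <- s) q k).
Proof.
move=> p0 q0 H; elim: s => [|k s IH]; first by rewrite !big_nil expr0n mulr0.
rewrite !big_cons.
have X0 : 0 <= \sum_(k <- s) p k by apply: sumr_ge0.
have Y0 : 0 <= \sum_(k <- s) q k by apply: sumr_ge0.
move: (\sum_(_ <- _) a _) (\sum_(_ <- _) p _) (\sum_(_ <- _) q _) IH X0 Y0 => S X Y IH X0 Y0.
move: (a k) (p k) (q k) (H k) (p0 k) (q0 k) => u v w h v0 w0.
suff K : 2 * (u * S) <= v * Y + X * w by rewrite sqrrD !mulrDl !mulrDr -mulr_natl; lra.
apply: le_trans (ler_norm _) _.
rewrite -(@ler_pXn2r _ 2)// ?nnegrE//; last by rewrite addr_ge0// mulr_ge0.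
rewrite real_normK ?num_real//.
have : (u * S) ^+ 2 <= (v * w) * (X * Y).
  by rewrite exprMn; apply: ler_pM => //; exact: sqr_ge0.
have := sqr_ge0 (v * Y - X * w); nra.
Qed.

(** Real and imaginary parts are bounded separately, whence the factor 2. *)
Lemma sqn_inner_le (I : Type) (s : seq I) (x g : I -> R[i]) :
  sqn (\sum_(k <- s) x k * (g k)^*) <=
  2 * ((\sum_(k <- s) sqn (x k)) * (\sum_(k <- s) sqn (g k))).
Proof.
rewrite {1}/sqn Re_sum Im_sum mulr_natl mulr2n; apply: lerD; apply: cauchy_schwarz_sum => k;
  rewrite ?sqn_ge0//; case: (x k) => a b; case: (g k) => c d; rewrite /sqn/=.
- have := sqr_ge0 (a * d - b * c); lra.
- have := sqr_ge0 (a * c + b * d); lra.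
Qed.

Lemma complex_cvgP (u : nat -> R[i]^o) (l : R[i]^o) :
  u @ \oo --> l <-> (forall e : R, 0 < e -> \forall n \near \oo, sqn (u n - l) < e).
Proof.
have N z (e : R) : 0 < e -> (`|z| < e%:C) = (sqn z < e ^+ 2).
  move=> e0; rewrite normc_def ltcR -/(sqn z) -[X in _ = (_ < X)](sqr_sqrtr (sqr_ge0 e)).
  by rewrite sqrtr_sqr gtr0_norm// -(ltr_pXn2r (n := 2)) ?nnegrE ?sqrtr_ge0 ?ltW// sqr_sqrtr// sqn_ge0.
split.
  move=> /cvgrPdist_lt H e e0.
  have s0 : 0 < Num.sqrt e by rewrite sqrtr_gt0.
  have := H (Num.sqrt e)%:C; rewrite ltcR => /(_ s0).
  by apply: filterS => n; rewrite distrC N// sqr_sqrtr// ltW.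
move=> H; apply/cvgrPdist_lt => e e0.
(* A positive element of [R[i]] is real. *)
have er : e = (complex.Re e)%:C.
  by move: e0; rewrite ltcE/= => /andP[/eqP h _]; rewrite [e]complexE h mulr0 addr0.
have r0 : 0 < complex.Re e by move: e0; rewrite {1}er ltcR.
have := H (complex.Re e ^+ 2) (exprn_gt0 _ r0).
by apply: filterS => n; rewrite distrC er N.
Qed.

Lemma cvg_Re_Im (u : nat -> R[i]^o) (l : R[i]^o) : u @ \oo --> l ->
  ((fun n => complex.Re (u n)) @ \oo --> complex.Re l) /\
  ((fun n => complex.Im (u n)) @ \oo --> complex.Im l).
Proof.
move=> /complex_cvgP H; split; apply/cvgrPdist_lt => e e0;
  have := H _ (exprn_gt0 2 e0); apply: filterS => n;
  case: (u n) => a b; case: l {H} => c d; rewrite /sqn/= => h;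
  rewrite -(@ltr_pXn2r _ 2)// ?nnegrE ?ltW// real_normK ?num_real//.
  by have := sqr_ge0 (b - d); lra.
by have := sqr_ge0 (a - c); lra.
Qed.

Lemma cauchy_real_cvg (u : nat -> R) :
  (forall e, 0 < e -> exists N, forall n, (N <= n)%N -> (u n - u N) ^+ 2 < e) -> cvgn u.
Proof.
move=> H; apply/cauchy_cvgP; apply: cauchy_exP => e e0.
have [N HN] := H _ (exprn_gt0 2 e0); exists (u N).
exists N => // n /= /HN h; rewrite /ball/= -(@ltr_pXn2r _ 2)// ?nnegrE ?ltW//.
by rewrite real_normK ?num_real// -sqrrN opprB.
Qed.

Lemma cauchy_complex_cvg (u : nat -> R[i]^o) :
  (forall e, 0 < e -> exists N, forall n, (N <= n)%N -> sqn (u n - u N) < e) ->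
  cvg (u @ \oo).
Proof.
move=> H.
have cR : cvgn (fun n => complex.Re (u n)).
  apply: cauchy_real_cvg => e /H[N HN]; exists N => n /HN; apply: le_lt_trans.
  by case: (u n) => a b; case: (u N) => c d; rewrite /sqn/= lerDl sqr_ge0.
have cI : cvgn (fun n => complex.Im (u n)).
  apply: cauchy_real_cvg => e /H[N HN]; exists N => n /HN; apply: le_lt_trans.
  by case: (u n) => a b; case: (u N) => c d; rewrite /sqn/= lerDr sqr_ge0.
apply/cvg_ex; exists (Complex (limn (fun n => complex.Re (u n))) (limn (fun n => complex.Im (u n)))).
apply/complex_cvgP => e e0.
have e2 : 0 < Num.sqrt (e / 2) by rewrite sqrtr_gt0 divr_gt0.
move/cvgrPdist_lt : cR => /(_ _ e2) h1; move/cvgrPdist_lt : cI => /(_ _ e2) h2.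
have lt2 (x : R) : `|x| < Num.sqrt (e / 2) -> x ^+ 2 < e / 2.
  move=> h; have ee : 0 <= e / 2 by rewrite divr_ge0// ltW.
  by rewrite -(real_normK (num_real x)) -(sqr_sqrtr ee) ltr_pXn2r// ?nnegrE ltW.
apply: filterS2 h1 h2 => n /lt2 + /lt2.
move: (limn _) (limn _) => a b; case: (u n) => c d /=.
by rewrite /sqn/=; lra.
Qed.

(** Bounds uniform in the truncation pass to the limit, for one finite set of rows at a time. *)
Lemma cvg_sum_sqn_le (I : Type) (s : seq I) (u : nat -> I -> R[i]^o) (l c : I -> R[i]^o) B :
  (forall k, (fun n => u n k) @ \oo --> l k) ->
  (\forall n \near \oo, \sum_(k <- s) sqn (u n k - c k) <= B) ->
  \sum_(k <- s) sqn (l k - c k) <= B.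
Proof.
move=> ul H.
have cs : (fun n => \sum_(k <- s) sqn (u n k - c k)) @ \oo --> \sum_(k <- s) sqn (l k - c k).
  elim: s {H} => [|k s IH].
    by under eq_fun do rewrite big_nil; rewrite big_nil; exact: cvg_cst.
  under eq_fun do rewrite big_cons; rewrite big_cons; apply: cvgD => //.
  have [h1 h2] := cvg_Re_Im (ul k).
  have e z : sqn (z - c k) = (complex.Re z - complex.Re (c k)) ^+ 2 + (complex.Im z - complex.Im (c k)) ^+ 2.
    by case: z => a b; case: (c k) => a' b'.
  rewrite e; under eq_fun do rewrite e.
  by apply: cvgD; rewrite expr2; under eq_fun do rewrite expr2; apply: cvgM; apply: cvgB => //; exact: cvg_cst.
rewrite -(cvg_lim _ cs)//; apply: limr_le => //; by apply/cvg_ex; eexists; exact: cs.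
Qed.

End ComplexSquaredNorm.

Section BoundedIndex.
Variable R : realType.
Implicit Types (m n : nat) (s : seq Zstar).

Definition index_seq m : seq Zstar :=
  undup (pmap insub ([seq Posz n | n <- iota 0 m.+1] ++ [seq - Posz n | n <- iota 0 m.+1])).

Lemma index_seq_uniq m : uniq (index_seq m).
Proof. exact: undup_uniq. Qed.

Lemma mem_index_seq m (k : Zstar) : (k \in index_seq m) = (`|val k| <= m)%N.
Proof.
rewrite mem_undup mem_pmap; apply/mapP/idP => [[z zin hz]|km].
  have -> : val k = z by move: hz; case: insubP => // u _ <- [->].
  move: zin; rewrite mem_cat => /orP[] /mapP[j]; rewrite mem_iota => /andP[_ jm] ->;
  by rewrite ?abszN absz_nat.
exists (val k); last by rewrite valK.
rewrite mem_cat; apply/orP; case: (ltrP (val k) 0) => hk.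
  right; apply/mapP; exists `|val k|%N; first by rewrite mem_iota/= add0n ltnS.
  by rewrite ltz0_abs// opprK.
by left; apply/mapP; exists `|val k|%N; [rewrite mem_iota/= add0n ltnS|rewrite gez0_abs].
Qed.

Lemma bounded_index_seq (V : nmodType) (F : Zstar -> V) m :
  \sum_(k \in @bounded_index m) F k = \sum_(k <- index_seq m) F k.
Proof.
rewrite [RHS]fsbig_seq ?index_seq_uniq//; suff -> : @bounded_index m = [set` index_seq m] by [].
by apply/seteqP; split => k; rewrite /bounded_index/= mem_index_seq.
Qed.

Definition index_tail m n : seq Zstar := [seq k <- index_seq n | (m < `|val k|)%N].

Lemma index_tail_uniq m n : uniq (index_tail m n).
Proof. by rewrite filter_uniq// index_seq_uniq. Qed.

Lemma index_seq_split (V : nmodType) (F : Zstar -> V) m n : (m <= n)%N ->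
  \sum_(k <- index_seq n) F k = \sum_(k <- index_seq m) F k + \sum_(k <- index_tail m n) F k.
Proof.
move=> mn; rewrite (bigID (fun k : Zstar => (`|val k| <= m)%N))/=; congr (_ + _).
  rewrite -big_filter; apply: perm_big; apply: uniq_perm.
  - by rewrite filter_uniq// index_seq_uniq.
  - exact: index_seq_uniq.
  move=> k; rewrite mem_filter !mem_index_seq andb_idr//.
  by move=> /leq_trans; apply.
by rewrite /index_tail big_filter; apply: eq_bigl => k; rewrite ltnNge.
Qed.

Lemma esum_seq_le (f : Zstar -> R) s : uniq s -> (forall k, 0 <= f k) ->
  ((\sum_(k <- s) f k)%:E <= \esum_(k in [set: Zstar]) (f k)%:E)%E.
Proof.
move=> us f0; apply: esum_ge; exists [set` s].
  by split => //; exact: finite_seq.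
by rewrite -fsbig_seq// sumEFin.
Qed.

Lemma esum_le_bound (f : Zstar -> R) (B : R) :
  (forall s, uniq s -> \sum_(k <- s) f k <= B) ->
  (\esum_(k in [set: Zstar]) (f k)%:E <= B%:E)%E.
Proof.
move=> H; apply: ub_ereal_sup => _ [X [fX _] <-].
by rewrite fsbig_finite//= sumEFin lee_fin; apply: H; exact: finmap.fset_uniq.
Qed.

Implicit Types (h g : Zstar -> R[i]).

Lemma ell2_fin h : ell2 h ->
  exists2 E, (\esum_(k in [set: Zstar]) (sqn (h k))%:E)%E = E%:E &
    forall s, uniq s -> \sum_(k <- s) sqn (h k) <= E.
Proof.
rewrite /ell2/= /summable => hfin; have {}hfin : (\esum_(k in [set: Zstar]) (sqn (h k))%:E < +oo)%E.
  by move: hfin; under eq_esum do rewrite normc_sqr gee0_abs ?lee_fin ?sqn_ge0//.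
move: hfin; set E := esum _ _ => hfin.
have E0 : (0 <= E)%E by apply: esum_ge0 => k _; rewrite lee_fin sqn_ge0.
have EE : E = (fine E)%:E by rewrite fineK// ge0_fin_numE.
exists (fine E) => // s us; rewrite -lee_fin -EE.
by apply: esum_seq_le => // k; exact: sqn_ge0.
Qed.

Lemma ell2_normE h : ell2_norm h = Num.sqrt (fine (\esum_(k in [set: Zstar]) (sqn (h k))%:E)%E).
Proof.
by rewrite /ell2_norm; congr (Num.sqrt (fine _)); apply: eq_esum => k _; rewrite normc_sqr.
Qed.

Lemma ell2_bound h B : (forall s, uniq s -> \sum_(k <- s) sqn (h k) <= B) ->
  ell2 h /\ ell2_norm h <= Num.sqrt B.
Proof.
move=> H; have le := esum_le_bound H.
have E0 : (0 <= \esum_(k in [set: Zstar]) (sqn (h k))%:E)%E.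
  by apply: esum_ge0 => k _; rewrite lee_fin sqn_ge0.
split.
  rewrite /ell2/= /summable.
  under eq_esum do rewrite normc_sqr gee0_abs ?lee_fin ?sqn_ge0//.
  by apply: le_lt_trans le _; rewrite ltry.
rewrite ell2_normE ler_wsqrtr// -lee_fin fineK// ge0_fin_numE//.
by apply: le_lt_trans le _; rewrite ltry.
Qed.

Lemma ell2_tail h : ell2 h -> forall e : R, 0 < e ->
  exists N, forall n, (N <= n)%N -> \sum_(k <- index_tail N n) sqn (h k) < e.
Proof.
move=> /ell2_fin[E _ HE] e e0.
pose u n := \sum_(k <- index_seq n) sqn (h k).
have nd : {homo u : n m / (n <= m)%N >-> n <= m}.
  move=> n m nm; rewrite /u (index_seq_split _ nm) lerDl.
  by apply: sumr_ge0 => k _; exact: sqn_ge0.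
have cu : cvgn u.
  apply: nondecreasing_is_cvgn => //; exists E => _ [n _ <-].
  by apply: HE; exact: index_seq_uniq.
have h1 n := nondecreasing_cvgn_le nd cu n.
move/cvgrPdist_lt : cu => /(_ _ e0)[N _ HN]; exists N => n Nn.
have := HN N (leqnn N); move: (h1 n) => {}h1.
rewrite /u (index_seq_split _ Nn) -/(u N) in h1.
move=> h2; have := le_lt_trans (ler_norm _) h2; rewrite -/(u N); lra.
Qed.

End BoundedIndex.

(** * From a bounded Hermitian form to a bounded operator *)

Section HermitianForm.
Local Open Scope complex_scope.
Local Open Scope ring_scope.
Variable R : realType.
Variables (A : Zstar -> Zstar -> R[i]) (C : R).
Hypothesis C0 : 0 < C.
Hypothesis Aherm : forall k l, A l k = (A k l)^*.
Hypothesis Abound : forall (s : seq Zstar) (h : Zstar -> R[i]), uniq s ->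
  `|\sum_(k <- s) \sum_(l <- s) complex.Re ((h k)^* * A k l * h l)| <= C * \sum_(k <- s) sqn (h k).
Implicit Types (h g : Zstar -> R[i]) (s : seq Zstar).

(* Polarization: test the form on h + e A h and h - e A h with e = 1 / C. *)
Let square_bound s h : uniq s ->
  \sum_(k <- s) sqn (\sum_(l <- s) A k l * h l) <= C ^+ 2 * \sum_(k <- s) sqn (h k).
Proof.
move=> us; pose y k := \sum_(l <- s) A k l * h l; pose e := C^-1.
have c0 := C0.
have e0 : 0 < e by rewrite invr_gt0.
pose b g f := \sum_(k <- s) \sum_(l <- s) complex.Re ((g k)^* * A k l * f l).
have byh : b y h = \sum_(k <- s) sqn (y k).
  apply: eq_bigr => k _; rewrite -Re_sum; under eq_bigr do rewrite -mulrA.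
  by rewrite -mulr_sumr -/(y k); case: (y k) => u v; rewrite /sqn/=; ring.
have bhy : b h y = b y h.
  rewrite /b exchange_big/=; apply: eq_bigr => k _; apply: eq_bigr => l _.
  rewrite (Aherm k l); case: (A k l) => u v; case: (h l) => a c; case: (y k) => a' c'.
  by rewrite /=; ring.
pose hp k := h k + e%:C * y k; pose hm k := h k - e%:C * y k.
have Q : b hp hp - b hm hm = 2 * e * (b h y + b y h).
  rewrite /b -sumrB -big_split/= mulr_sumr; apply: eq_bigr => k _.
  rewrite -sumrB -big_split/= mulr_sumr; apply: eq_bigr => l _.
  rewrite /hp /hm; case: (h k) => a1 a2; case: (h l) => b1 b2; case: (y k) => c1 c2.
  by case: (y l) => d1 d2; case: (A k l) => m1 m2 /=; ring.
have N : \sum_(k <- s) sqn (hp k) + \sum_(k <- s) sqn (hm k) =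
    2 * (\sum_(k <- s) sqn (h k) + e ^+ 2 * \sum_(k <- s) sqn (y k)).
  rewrite mulr_sumr -!big_split/= mulr_sumr; apply: eq_bigr => k _.
  by rewrite /hp /hm; case: (h k) => a1 a2; case: (y k) => c1 c2; rewrite /sqn/=; ring.
have := Abound hp us; have := Abound hm us; rewrite -/(b hp hp) -/(b hm hm) !ler_norml.
move=> /andP[l1 _] /andP[_ l2].
rewrite bhy byh -/y in Q *; move: (\sum_(k <- s) sqn (y k)) (\sum_(k <- s) sqn (h k)) Q N => Y H Q N.
have h4 : 4 * e * Y <= 2 * C * (H + e ^+ 2 * Y).
  have -> : 4 * e * Y = b hp hp - b hm hm by rewrite Q; ring.
  by rewrite (mulrC 2) -mulrA -N mulrDr; lra.
have : C * (4 * e * Y) <= C * (2 * C * (H + e ^+ 2 * Y)) by rewrite ler_pM2l.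
have -> : C * (4 * e * Y) = 4 * Y by rewrite /e; field; rewrite gt_eqF.
have -> : C * (2 * C * (H + e ^+ 2 * Y)) = 2 * (C ^+ 2 * H) + 2 * Y by rewrite /e; field; rewrite gt_eqF.
by lra.
Qed.

(** Both index sets are embedded in their union and [h] is extended by 0, which reduces to the
    square case. *)
Let rect_bound s s' h : uniq s -> uniq s' ->
  \sum_(k <- s) sqn (\sum_(l <- s') A k l * h l) <= C ^+ 2 * \sum_(l <- s') sqn (h l).
Proof.
move=> us us'; pose S := undup (s ++ s').
have uS : uniq S by exact: undup_uniq.
pose h' k := if k \in s' then h k else 0.
have sub (V : nmodType) (F : Zstar -> V) t : uniq t -> {subset t <= S} ->
    \sum_(k <- S) (if k \in t then F k else 0) = \sum_(k <- t) F k.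
  move=> ut tS; rewrite -big_mkcond/= -big_filter; apply: perm_big; apply: uniq_perm => //.
    by rewrite filter_uniq.
  by move=> k; rewrite mem_filter andb_idr//; exact: tS.
have sS : {subset s <= S} by move=> k ks; rewrite mem_undup mem_cat ks.
have s'S : {subset s' <= S} by move=> k ks; rewrite mem_undup mem_cat ks orbT.
have := square_bound h' uS.
have -> : \sum_(k <- S) sqn (h' k) = \sum_(l <- s') sqn (h l).
  rewrite -(sub _ _ _ us' s'S); apply: eq_bigr => k _; rewrite /h'; case: ifP => // _; exact: sqn0.
have e k : \sum_(l <- S) A k l * h' l = \sum_(l <- s') A k l * h l.
  rewrite -(sub _ _ _ us' s'S); apply: eq_bigr => l _; rewrite /h'; case: ifP => // _; exact: mulr0.
under eq_bigr do rewrite e.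
apply: le_trans; rewrite -(sub _ _ _ us sS); apply: ler_sum => k _.
by case: ifP => // _; exact: sqn_ge0.
Qed.

Let rps h k m : row_partial_sum A h k m = \sum_(l <- index_seq m) A k l * h l.
Proof. exact: bounded_index_seq. Qed.

Let row_tail h (s : seq Zstar) N n : uniq s -> (N <= n)%N ->
  \sum_(k <- s) sqn (row_partial_sum A h k n - row_partial_sum A h k N) <=
  C ^+ 2 * \sum_(l <- index_tail N n) sqn (h l).
Proof.
move=> us Nn; have := rect_bound h us (index_tail_uniq N n); congr (_ <= _).
by apply: eq_bigr => k _; rewrite !rps (index_seq_split _ Nn) addrAC subrr add0r.
Qed.

Let c2 : 0 < C ^+ 2. Proof. exact: exprn_gt0. Qed.

Let row_cvg h k : ell2 h -> cvg (row_partial_sum A h k m @[m --> \oo]).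
Proof.
move=> eh; apply: cauchy_complex_cvg => e e0.
have [N HN] := ell2_tail eh (divr_gt0 e0 c2); exists N => n Nn.
have := @row_tail h [:: k] N n isT Nn; rewrite big_seq1 => /le_lt_trans; apply.
by have := HN n Nn; rewrite ltr_pdivlMr// mulrC.
Qed.

(** [N] is independent of the finite set [s]: the truncated products converge to the action in norm,
    not only entry by entry. *)
Let action_tail h : ell2 h -> forall e, 0 < e ->
  exists N, forall n s, (N <= n)%N -> uniq s ->
   \sum_(k <- s) sqn (matrix_action A h k - row_partial_sum A h k n) <= e.
Proof.
move=> eh e e0; have e4 : 0 < e / 4 by rewrite divr_gt0.
have [N HN] := ell2_tail eh (divr_gt0 e4 c2); exists N => n s Nn us.
have tl m : (N <= m)%N -> \sum_(k <- s) sqn (row_partial_sum A h k m - row_partial_sum A h k N) <= e / 4.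
  move=> Nm; apply: le_trans (row_tail h us Nm) _.
  by have := HN m Nm; rewrite ltr_pdivlMr// mulrC => /ltW.
have tl0 : \sum_(k <- s) sqn (matrix_action A h k - row_partial_sum A h k N) <= e / 4.
  apply: (@cvg_sum_sqn_le _ _ _ (fun m k => row_partial_sum A h k m)).
    by move=> k; exact: row_cvg.
  by exists N => // m /= Nm; exact: tl.
have tri k : sqn (matrix_action A h k - row_partial_sum A h k n) <=
   2 * (sqn (matrix_action A h k - row_partial_sum A h k N)
        + sqn (row_partial_sum A h k n - row_partial_sum A h k N)).
  rewrite -(sqnN (row_partial_sum A h k n - _)); apply: le_trans (sqnD_le _ _).
  by rewrite le_eqVlt; apply/orP; left; apply/eqP; congr sqn; ring.
apply: le_trans (ler_sum _ (fun k _ => tri k)) _.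
rewrite -mulr_sumr big_split/=; have := tl n Nn; lra.
Qed.

Let action_bound h (E : R) (s : seq Zstar) : ell2 h ->
  (forall t, uniq t -> \sum_(l <- t) sqn (h l) <= E) -> uniq s ->
  \sum_(k <- s) sqn (matrix_action A h k) <= C ^+ 2 * E.
Proof.
move=> eh HE us.
have -> : \sum_(k <- s) sqn (matrix_action A h k) = \sum_(k <- s) sqn (matrix_action A h k - 0).
  by under [RHS]eq_bigr do rewrite subr0.
apply: (@cvg_sum_sqn_le _ _ _ (fun m k => row_partial_sum A h k m)).
  by move=> k; exact: row_cvg.
apply: nearW => m; under eq_bigr do rewrite subr0 rps.
apply: le_trans (rect_bound h us (index_seq_uniq m)) _.
by rewrite ler_pM2l//; apply: HE; exact: index_seq_uniq.
Qed.

Let action_ell2 h : ell2 h -> ell2 (matrix_action A h) /\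
  ell2_norm (matrix_action A h) <= C * ell2_norm h.
Proof.
move=> eh; have [E EE HE] := ell2_fin eh.
have [|e1 e2] := @ell2_bound R (matrix_action A h) (C ^+ 2 * E).
  by move=> s us; exact: action_bound.
split => //; apply: le_trans e2 _.
by rewrite ell2_normE EE/= sqrtrM ?sqr_ge0// sqrtr_sqr gtr0_norm.
Qed.

Let action_linear (a : R[i]) h g : ell2 h -> ell2 g ->
  matrix_action A (fun k => a * h k + g k) =
  (fun k => a * matrix_action A h k + matrix_action A g k).
Proof.
move=> eh eg; apply/funext => k.
have e : row_partial_sum A (fun k => a * h k + g k) k =
    (fun m => a *: row_partial_sum A h k m + row_partial_sum A g k m).
  apply/funext => m; rewrite !rps -[_ *: _]/(a * _) mulr_sumr -big_split/=.
  by apply: eq_bigr => l _; ring.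
have c : row_partial_sum A (fun k => a * h k + g k) k @ \oo -->
    (a *: (matrix_action A h k : R[i]^o) + matrix_action A g k : R[i]^o).
  by rewrite e; apply: cvgD; [apply: cvgZr; exact: row_cvg|exact: row_cvg].
by rewrite [LHS]/matrix_action (cvg_lim _ c).
Qed.

Let inner_cvg h g : ell2 h -> ell2 g ->
  cvg ((\sum_(k <- index_seq m) h k * (g k)^* : R[i]^o) @[m --> \oo]).
Proof.
move=> eh eg; apply: cauchy_complex_cvg => e e0.
have [E _ HE] := ell2_fin eg.
have E0 : 0 <= E by have := HE [::] isT; rewrite big_nil.
have E1 : 0 < 2 * (1 + E) by lra.
have [N HN] := ell2_tail eh (divr_gt0 e0 E1); exists N => n Nn.
rewrite (index_seq_split _ Nn) addrAC subrr add0r.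
apply: le_lt_trans (sqn_inner_le _ _ _) _.
have := HE _ (index_tail_uniq N n); have := HN n Nn; rewrite ltr_pdivlMr//.
have X0 : 0 <= \sum_(k <- index_tail N n) sqn (h k) by apply: sumr_ge0 => k _; exact: sqn_ge0.
move: (\sum_(k <- index_tail N n) sqn (h k)) (\sum_(k <- index_tail N n) sqn (g k)) X0 => X G X0.
nra.
Qed.

Let action_self_adjoint : self_adjoint (matrix_action A).
Proof.
move=> h g eh eg; rewrite /ell2_inner.
pose x := matrix_action A h; pose y := matrix_action A g.
have [ex _] := action_ell2 eh; have [ey _] := action_ell2 eg.
under eq_fun do rewrite bounded_index_seq; under [in RHS]eq_fun do rewrite bounded_index_seq.
pose L m := \sum_(k <- index_seq m) x k * (g k)^* : R[i]^o.
pose K m := \sum_(k <- index_seq m) h k * (y k)^* : R[i]^o.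
have cL : cvg (L @ \oo) by exact: inner_cvg.
suff : K @ \oo --> lim (L @ \oo) by move=> /cvg_lim -> //.
apply/complex_cvgP => e e0.
have /complex_cvgP HL := cL.
have [Eh _ HEh] := ell2_fin eh; have [Eg _ HEg] := ell2_fin eg.
have Eh0 : 0 <= Eh by have := HEh [::] isT; rewrite big_nil.
have Eg0 : 0 <= Eg by have := HEg [::] isT; rewrite big_nil.
(* Two uses of [sqnD_le] and the factor 2 of [sqn_inner_le] multiply [d] by 8, so 16 leaves half of
   [e] for the convergence of [L]. *)
pose d := e / (16 * (1 + Eh + Eg)).
have d0 : 0 < d by rewrite divr_gt0//; lra.
have de : 16 * (d * (1 + Eh + Eg)) = e by rewrite /d; field; rewrite gt_eqF//; lra.
have [N1 H1] := action_tail eh d0; have [N2 H2] := action_tail eg d0.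
have e4 : 0 < e / 4 by rewrite divr_gt0.
near=> m.
(* Both truncated inner products are close to this finite double sum, [L] by summing along rows and
   [K], thanks to Hermitian symmetry, along columns. *)
pose D := \sum_(k <- index_seq m) \sum_(l <- index_seq m) A k l * h l * (g k)^*.
have iu := index_seq_uniq m.
have LD : sqn (L m - D) <= 2 * (d * Eg).
  have -> : L m - D = \sum_(k <- index_seq m) (x k - row_partial_sum A h k m) * (g k)^*.
    rewrite /L /D -sumrB; apply: eq_bigr => k _.
    by rewrite rps mulrBl mulr_suml.
  apply: le_trans (sqn_inner_le _ _ _) _; rewrite ler_pM2l//.
  apply: ler_pM; [by apply: sumr_ge0 => k _; exact: sqn_ge0|by apply: sumr_ge0 => k _; exact: sqn_ge0| |exact: HEg].
  by apply: H1 => //; near: m; exact: nbhs_infty_ge.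
have KD : sqn (K m - D) <= 2 * (Eh * d).
  have -> : K m - D = \sum_(l <- index_seq m) h l * (y l - row_partial_sum A g l m)^*.
    rewrite /K /D exchange_big/= -sumrB; apply: eq_bigr => l _.
    rewrite rps rmorphB mulrBr; congr (_ - _); rewrite rmorph_sum/= mulr_sumr.
    by apply: eq_bigr => k _; rewrite rmorphM/= -Aherm; ring.
  apply: le_trans (sqn_inner_le _ _ _) _; rewrite ler_pM2l//.
  apply: ler_pM; [by apply: sumr_ge0 => k _; exact: sqn_ge0|by apply: sumr_ge0 => k _; exact: sqn_ge0|exact: HEh|].
  by apply: H2 => //; near: m; exact: nbhs_infty_ge.
have l1 : sqn (L m - lim (L @ \oo)) < e / 4 by near: m; exact: HL.
have -> : K m - lim (L @ \oo) = (K m - D - (L m - D)) + (L m - lim (L @ \oo)) by ring.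
apply: le_lt_trans (sqnD_le _ _) _.
have := sqnD_le (K m - D) (- (L m - D)); rewrite sqnN; nra.
Unshelve. all: by end_near.
Qed.

Theorem hermitian_bounded_self_adjoint : acts_as_bounded_self_adjoint A.
Proof.
split => [h eh k||]; [exact: row_cvg| |exact: action_self_adjoint].
split => [h eh|a h g eh eg|]; [by have [] := action_ell2 eh|exact: action_linear|].
by exists C => h eh; have [] := action_ell2 eh.
Qed.

End HermitianForm.

(** * The welding Grunsky matrix as an operator *)

Section GrunskyMatrix.
Variable R : realType.
Implicit Types (phi : circle R -> circle R) (f : R -> R).

Lemma qs_lift phi : QS phi -> exists f g M,
  [/\ circle_lift f, circle_lift g, cancel f g, cancel g f &
   (forall t, phi (cis t) = cis (f t)) /\ (1 < M /\ doubling g M pi)].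
Proof.
move=> [hphi qs]; have [f lf fphi] := homeo_lift hphi.
have [M M1 fd] := qs_lift_doubling lf fphi qs.
have [g [lg fK gK]] := circle_lift_inv lf.
have [K K1 gd] := doubling_inv lf lg fK gK M1 fd.
by exists f, g, K.
Qed.

Lemma doubling_id : doubling (@id R) 2 pi.
Proof. by move=> x h /andP[h0 _]; split; lra. Qed.

Lemma sin_half_lift0 f s t : circle_lift f -> sin ((s - t) / 2) = 0 :> R ->
  sin ((f s - f t) / 2) = 0.
Proof.
move=> lf s0; have : cos (s - t) = 1 by rewrite cos_half s0; ring.
move=> /cos_eq1_intmul[n hn].
have -> : s = t + n%:~R * (2 * pi) by lra.
rewrite circle_liftD2piZ// addrAC subrr add0r -[n%:~R * _]add0r.
apply/eqP; rewrite -normr_eq0 (@sqr_sin_half_eq _ _ 0) ?(periodic_intmul (@cosD2pi' R))//.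
by rewrite mul0r sin0 normr0.
Qed.

(** The identity holds at every point: where [s] and [t] agree modulo 2 pi, both sines vanish
    together and all the logarithms are 0 by convention. *)
Lemma log_quotientE phi f s t : circle_lift f -> (forall t, phi (cis t) = cis (f t)) ->
  log_quotient phi s t = 2^-1 * (arc_log id (s, t) - arc_log f (s, t)).
Proof.
move=> lf fphi; rewrite /log_quotient !fphi ComplexField.Normc.normcM ComplexField.Normc.normcV.
rewrite -[cval (cis (f s))]/(expi (f s)) -[cval (cis (f t))]/(expi (f t)) !normc_expiB.
rewrite /arc_log /=.
have [s0|s0] := eqVneq (sin ((s - t) / 2)) 0.
  rewrite (sin_half_lift0 lf s0) s0 normr0 !mulr0 mul0r ln0//; ring.
have f0 : sin ((f s - f t) / 2) != 0.
  have [g [lg fK gK]] := circle_lift_inv lf; apply: contra_neq s0 => /(sin_half_lift0 lg).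
  by rewrite !fK.
have p1 : 0 < `|sin ((s - t) / 2)| by rewrite normr_gt0.
have p2 : 0 < `|sin ((f s - f t) / 2)| by rewrite normr_gt0.
rewrite -mulf_div divff// mul1r lnM ?posrE ?invr_gt0// lnV ?posrE//.
by field.
Qed.

Lemma log_quotient_swap phi s t : log_quotient phi t s = log_quotient phi s t.
Proof.
rewrite /log_quotient -(opprB (cval _)) -(opprB (expi s)) invrN mulrNN.
by congr (ln (ComplexField.Normc.normc _)).
Qed.

Definition log_quotient2 phi (x : R * R) : R := log_quotient phi x.1 x.2.

Lemma log_quotient2E phi f : circle_lift f -> (forall t, phi (cis t) = cis (f t)) ->
  log_quotient2 phi = (fun x => 2^-1 * (arc_log id x - arc_log f x)).
Proof. by move=> lf fphi; apply/funext => -[s t]; exact: log_quotientE. Qed.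

Lemma arc_log_id_integrable : torus_integrable (@arc_log R id).
Proof.
have l := @circle_lift_id R.
by apply: (arc_log_integrable l l _ _ _ doubling_id) => //; lra.
Qed.

Lemma log_quotient_integrable phi : QS phi -> torus_integrable (log_quotient2 phi).
Proof.
move=> /qs_lift[f [g [M [lf lg fK gK [fphi [M1 gd]]]]]].
rewrite (log_quotient2E lf fphi); apply: torus_integrableZl.
have mD := @measurable_prod_square R.
exact: (integrableB mD arc_log_id_integrable (arc_log_integrable lf lg fK gK M1 gd)).
Qed.

(** The minus sign is that of the second index in the matrix entry lambda_(k, -l). *)
Definition cos_wave (k l : int) (x : R * R) : R := cos (k%:~R * x.1 - l%:~R * x.2).
Definition sin_wave (k l : int) (x : R * R) : R := sin (k%:~R * x.1 - l%:~R * x.2).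

Let mphase (k l : int) : measurable_fun setT (fun x : R * R => k%:~R * x.1 - l%:~R * x.2).
Proof.
have m1 : measurable_fun [set: R * R] (fun xy : R * R => xy.1) by exact: measurable_fst.
have m2 : measurable_fun [set: R * R] (fun xy : R * R => xy.2) by exact: measurable_snd.
by apply: measurable_funB; exact: measurable_funM.
Qed.

Lemma tame_cos_wave k l : tame (cos_wave k l).
Proof.
split; last by exists 1 => x; rewrite ler_norml cos_geN1 cos_le1.
apply: measurableT_comp; last exact: mphase.
by apply: continuous_measurable_fun; exact: continuous_cos.
Qed.

Lemma tame_sin_wave k l : tame (sin_wave k l).
Proof.
split; last by exists 1 => x; rewrite ler_norml sin_geN1 sin_le1.
apply: measurableT_comp; last exact: mphase.
by apply: continuous_measurable_fun; exact: continuous_sin.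
Qed.

Definition weight (k : int) : R := Num.sqrt `|k%:~R|.

Lemma weight_sqr k : weight k ^+ 2 = `|k%:~R|.
Proof. by rewrite sqr_sqrtr. Qed.

Lemma weight_gt0 k : k != 0 -> 0 < weight k.
Proof. by move=> k0; rewrite sqrtr_gt0 normr_gt0 intr_eq0. Qed.

Lemma welding_grunskyE phi (k l : Zstar) : QS phi ->
  welding_grunsky phi k l =
  Complex (((2 * pi) ^+ 2)^-1 * (weight (val k) * weight (val l) *
     pairing (log_quotient2 phi) (cos_wave (val k) (val l))))
   (- (((2 * pi) ^+ 2)^-1 * (weight (val k) * weight (val l) *
     pairing (log_quotient2 phi) (sin_wave (val k) (val l))))).
Proof.
move=> qphi; have iu := log_quotient_integrable qphi.
have w : Num.sqrt `|val k * - val l|%:~R = weight (val k) * weight (val l).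
  by rewrite /weight -sqrtrM// -normrM mulrN normrN intr_norm intrM.
rewrite /welding_grunsky /welding_coef /log_fourier w /torus_integral.
set a := (X in Complex X _); set b := (X in Complex _ X).
have -> : a = pairing (log_quotient2 phi) (cos_wave (val k) (val l)).
  rewrite /a /pairing; apply: eq_Rintegral => x _.
  rewrite /expi /= mul0r subr0 /log_quotient2 /cos_wave cosN.
  by rewrite mulrNz mulNr.
have -> : b = - pairing (log_quotient2 phi) (sin_wave (val k) (val l)).
  rewrite -mulN1r -(pairingZl _ iu); last exact: tame_sin_wave.
  rewrite /b /pairing; apply: eq_Rintegral => x _.
  rewrite /expi /= mul0r addr0 /log_quotient2 /sin_wave sinN.
  by rewrite mulrNz mulNr mulN1r.
by apply/eqP; rewrite eq_complex /=; apply/andP; split; apply/eqP; ring.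
Qed.

Lemma welding_grunsky_hermitian phi (k l : Zstar) : QS phi ->
  welding_grunsky phi l k = (welding_grunsky phi k l)^*.
Proof.
move=> qphi; rewrite !welding_grunskyE//=.
have iu := log_quotient_integrable qphi.
have us x : log_quotient2 phi (x.2, x.1) = log_quotient2 phi x by exact: log_quotient_swap.
have c : pairing (log_quotient2 phi) (cos_wave (val l) (val k)) =
    pairing (log_quotient2 phi) (cos_wave (val k) (val l)).
  rewrite -(pairing_swap iu (tame_cos_wave (val k) (val l)) us).
  by congr pairing; apply/funext => x; rewrite /cos_wave/= -cosN opprB.
have s : pairing (log_quotient2 phi) (sin_wave (val l) (val k)) =
    - pairing (log_quotient2 phi) (sin_wave (val k) (val l)).
  rewrite -(pairing_swap iu (tame_sin_wave (val k) (val l)) us).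
  rewrite -mulN1r -(pairingZl _ iu); last by apply: tame_swap; exact: tame_sin_wave.
  by congr pairing; apply/funext => x; rewrite /sin_wave/= mulN1r -sinN opprB.
by apply/eqP; rewrite eq_complex /= c s; apply/andP; split; apply/eqP; ring.
Qed.

(** Coefficients on all of [int], with the factor sqrt |k| of the matrix moved into them and 0 at
    the excluded index. *)
Let ext (h : Zstar -> R) (k : int) : R := if insub k is Some z then weight k * h z else 0.

Let ext_val h (k : Zstar) : ext h (val k) = weight (val k) * h k.
Proof. by rewrite /ext valK. Qed.

Lemma tame_trig_form s (a b : int -> R) : tame (trig_form s a b).
Proof. by apply: tameD; exact: tame_trig_poly_mul. Qed.

Lemma grunsky_form_pairing phi (s : seq Zstar) (h : Zstar -> R[i]) : QS phi ->
  \sum_(k <- s) \sum_(l <- s) complex.Re ((h k)^* * welding_grunsky phi k l * h l) =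
  ((2 * pi) ^+ 2)^-1 * pairing (log_quotient2 phi)
    (trig_form (map val s) (ext (fun k => complex.Re (h k))) (ext (fun k => complex.Im (h k)))).
Proof.
move=> qphi; have iu := log_quotient_integrable qphi.
set a := ext _; set b := ext _.
have -> : trig_form (map val s) a b = (fun x => \sum_(k <- s) 1 * \sum_(l <- s) 1 *
    \sum_(c <- [:: true; false])
     (if c then a (val k) * a (val l) + b (val k) * b (val l)
      else a (val k) * b (val l) - b (val k) * a (val l)) *
     (if c then cos_wave (val k) (val l) x else sin_wave (val k) (val l) x)).
  apply/funext => x; rewrite trig_form_expand big_map; apply: eq_bigr => k _.
  rewrite mul1r big_map; apply: eq_bigr => l _.
  by rewrite !big_cons big_nil addr0 mul1r.
have tc (k l : Zstar) (c : bool) : tame (fun x => if c then cos_wave (val k) (val l) x else sin_wave (val k) (val l) x).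
  by case: c; [exact: tame_cos_wave|exact: tame_sin_wave].
have tc' (k l : Zstar) : tame (fun x => \sum_(c <- [:: true; false])
     (if c then a (val k) * a (val l) + b (val k) * b (val l)
      else a (val k) * b (val l) - b (val k) * a (val l)) *
     (if c then cos_wave (val k) (val l) x else sin_wave (val k) (val l) x)).
  by apply: tame_sum => c; apply: tameM; [exact: tame_cst|exact: tc].
rewrite (@pairing_sum _ _ s _ (fun=> 1) _ iu); last first.
  by move=> k; apply: tame_sum => l; apply: tameM; [exact: tame_cst|exact: tc'].
rewrite mulr_sumr; apply: eq_bigr => k _; rewrite mul1r.
rewrite (@pairing_sum _ _ s _ (fun=> 1) _ iu); last exact: tc'.
rewrite mulr_sumr; apply: eq_bigr => l _; rewrite mul1r.
rewrite (pairing_sum _ _ iu); last exact: tc.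
rewrite !big_cons big_nil addr0 welding_grunskyE// /a /b !ext_val.
by case: (h k) => a1 a2; case: (h l) => b1 b2 /=; ring.
Qed.

(** The forms of both kernels lie between 0 and a multiple of the squared norm, so their difference
    is bounded by the sum of the constants. The weights sqrt |k| cancel |k|^-1 exactly. *)
Lemma grunsky_form_bound phi : QS phi -> exists2 C, 0 < C &
  forall (s : seq Zstar) (h : Zstar -> R[i]), uniq s ->
  `|\sum_(k <- s) \sum_(l <- s) complex.Re ((h k)^* * welding_grunsky phi k l * h l)|
    <= C * \sum_(k <- s) sqn (h k).
Proof.
move=> qphi; have [f [g [M [lf lg fK gK [fphi [M1 gd]]]]]] := qs_lift qphi.
have lid := @circle_lift_id R.
have two1 : (1 < 2 :> R) by lra.
have [K1 K10 H1] := arc_log_form_bound lid lid (fun=> erefl) (fun=> erefl) two1 doubling_id.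
have [K2 K20 H2] := arc_log_form_bound lf lg fK gK M1 gd.
have p0 := pi_gt0 R.
pose c : R := ((2 * pi) ^+ 2)^-1.
have c0 : 0 < c by rewrite invr_gt0 exprn_gt0// mulr_gt0.
exists (c * (K1 + K2)) => [|s h us]; first by rewrite mulr_gt0 ?addr_gt0.
rewrite grunsky_form_pairing//; set a := ext _; set b := ext _.
have u's : uniq (map val s) by rewrite map_inj_uniq//; exact: val_inj.
have s0 : 0 \notin map val s.
  by apply/negP => /mapP[[k k0] _ /= e]; move: k0; rewrite -e eqxx.
have S : \sum_(k <- map val s) `|k%:~R|^-1 * (a k ^+ 2 + b k ^+ 2) = \sum_(k <- s) sqn (h k).
  rewrite big_map; apply: eq_bigr => k _; rewrite /a /b !ext_val !exprMn weight_sqr -mulrDr.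
  by rewrite mulKf// normr_eq0 intr_eq0; exact: (valP k).
have := H1 _ a b u's s0; have := H2 _ a b u's s0; rewrite S.
have N0 : 0 <= \sum_(k <- s) sqn (h k) by apply: sumr_ge0 => k _; exact: sqn_ge0.
have -> : pairing (log_quotient2 phi) (trig_form (map val s) a b) =
    2^-1 * (pairing (arc_log id) (trig_form (map val s) a b) - pairing (arc_log f) (trig_form (map val s) a b)).
  have tt := tame_trig_form (map val s) a b.
  have i1 := integrable_tame arc_log_id_integrable tt.
  have i2 := integrable_tame (arc_log_integrable lf lg fK gK M1 gd) tt.
  have mD := @measurable_prod_square R.
  rewrite /pairing -RintegralB// -RintegralZl//; last exact: (integrableB mD i1 i2).
  by apply: eq_Rintegral => x _; rewrite (log_quotient2E lf fphi) /=; ring.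
move: (pairing _ _) (pairing _ _) (\sum_(k <- s) sqn (h k)) N0 => x y N N0 /andP[y0 yN] /andP[x0 xN].
rewrite normrM gtr0_norm// -mulrA ler_pM2l// ler_norml.
by apply/andP; split; nra.
Qed.

Theorem welding_grunsky_bounded phi : QS phi ->
  acts_as_bounded_self_adjoint (welding_grunsky phi).
Proof.
move=> qphi; have [C C0 HC] := grunsky_form_bound qphi.
apply: (hermitian_bounded_self_adjoint C0) => // k l.
exact: welding_grunsky_hermitian.
Qed.

End GrunskyMatrix.

(** * Recovering cross ratios *)

Section CosineBump.
Variable R : realType.
Local Notation mu := (@lebesgue_measure R).

(* A trigonometric polynomial, hence controlled by Fourier coefficients, which
   becomes an approximate identity after division by its integral. *)
Definition cos_bump n (t : R) : R := ((1 + cos t) / 2) ^+ n.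

Lemma bump_base (t : R) : 0 <= (1 + cos t) / 2 <= 1.
Proof. by have := cos_geN1 t; have := cos_le1 t => ? ?; apply/andP; split; lra. Qed.

Lemma bump_ge0 n t : 0 <= cos_bump n t.
Proof. by rewrite exprn_ge0//; have /andP[] := bump_base t. Qed.

Lemma bump_le1 n t : cos_bump n t <= 1.
Proof. by rewrite exprn_ile1//; have /andP[] := bump_base t. Qed.

Lemma bumpD2pi n t : cos_bump n (t + 2 * pi) = cos_bump n t.
Proof. by rewrite /cos_bump cosD2pi'. Qed.

Lemma continuous_bump n a : continuous (fun t => cos_bump n (t - a)).
Proof.
move=> t; apply: (@continuous_comp _ _ _ (fun t => (1 + cos (t - a)) / 2) (fun x => x ^+ n)); last exact: exprn_continuous.
apply: cvgM; last exact: cvg_cst.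
apply: cvgD; first exact: cvg_cst.
apply: (@continuous_comp _ _ _ (fun t => t - a) cos); last exact: continuous_cos.
by apply: cvgB; [exact: cvg_id|exact: cvg_cst].
Qed.

Lemma bump_cos_sum n : exists L : seq (R * int), forall t,
  cos_bump n t = \sum_(p <- L) p.1 * cos (p.2%:~R * t).
Proof.
elim: n => [|n [L HL]].
  exists [:: (1, 0)] => t; by rewrite big_seq1 /cos_bump expr0 mul0r cos0 mulr1.
exists (flatten [seq [:: (p.1 / 2, p.2); (p.1 / 4, p.2 + 1); (p.1 / 4, p.2 - 1)] | p <- L]) => t.
rewrite big_flatten big_map /cos_bump exprSr -/(cos_bump n t) HL big_distrl/=; apply: eq_bigr => -[g k] _ /=.
rewrite !big_cons big_nil/= addr0.
have -> : (k + 1)%:~R * t = k%:~R * t + t by rewrite intrD mulrDl mul1r.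
have -> : (k - 1)%:~R * t = k%:~R * t - t by rewrite intrB mulrBl mul1r.
rewrite cosD cosB.
by field.
Qed.

(** The constant terms cancel in the difference, so only frequencies that the matrix sees remain. *)
Lemma bump_diff_cos n (a b : R) : exists L : seq (R * int), (forall p, p \in L -> p.2 != 0) /\
  forall t, cos_bump n (t - a) - cos_bump n (t - b) =
    \sum_(p <- L) p.1 * (cos (p.2%:~R * (t - a)) - cos (p.2%:~R * (t - b))).
Proof.
have [L HL] := bump_cos_sum n; exists [seq p <- L | p.2 != 0]; split.
  by move=> p; rewrite mem_filter => /andP[].
move=> t; rewrite !HL -sumrB big_filter [LHS](bigID (fun p => p.2 != 0))/= [X in _ + X]big1 ?addr0.
  by apply: eq_bigr => p _; rewrite [RHS]mulrBr.
by move=> p /negPn/eqP ->; rewrite !mul0r subrr.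
Qed.

Lemma tame_bump n a c : tame (fun x : R * R => cos_bump n (x.1 - a) * cos_bump n (x.2 - c)).
Proof.
have H b : measurable_fun setT (fun t : R => cos_bump n (t - b)) /\ forall t : R, `|cos_bump n (t - b)| <= 1.
  split; first by apply: continuous_measurable_fun; exact: continuous_bump.
  by move=> t; rewrite ger0_norm ?bump_ge0// bump_le1.
by apply: tameM; [exact: (tame_fst (H a).1 (H a).2)|exact: (tame_snd (H c).1 (H c).2)].
Qed.

Section Annihilation.
Variable V : R * R -> R.
Hypothesis iV : torus_integrable V.
Hypothesis V0 : forall k l : int, k != 0 -> l != 0 ->
  pairing V (cos_wave k l) = 0 /\ pairing V (sin_wave k l) = 0.

Let pairing_cos_cos (k l : int) (a c : R) : k != 0 -> l != 0 ->
  pairing V (fun x => cos (k%:~R * (x.1 - a)) * cos (l%:~R * (x.2 - c))) = 0.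
Proof.
move=> k0 l0; have nl0 : - l != 0 by rewrite oppr_eq0.
pose F (i : 'I_4) : R * R -> R := match val i with
  | 0 => cos_wave k l | 1 => sin_wave k l | 2 => cos_wave k (- l) | _ => sin_wave k (- l) end%N.
pose t1 := k%:~R * a - l%:~R * c; pose t2 := k%:~R * a + l%:~R * c.
pose C (i : 'I_4) : R := match val i with
  | 0 => cos t1 / 2 | 1 => sin t1 / 2 | 2 => cos t2 / 2 | _ => sin t2 / 2 end%N.
have -> : (fun x : R * R => cos (k%:~R * (x.1 - a)) * cos (l%:~R * (x.2 - c))) =
    (fun x => \sum_i C i * F i x).
  apply/funext => x; rewrite !big_ord_recl big_ord0 /C /F/= /cos_wave /sin_wave /t1 /t2.
  rewrite mulrNz !mulNr opprK !mulrBr !(cosB, cosD, sinB, sinD).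
  move: (cos (k%:~R * x.1)) (sin (k%:~R * x.1)) (cos (l%:~R * x.2)) (sin (l%:~R * x.2)) => A1 A2 A3 A4.
  move: (cos (k%:~R * a)) (sin (k%:~R * a)) (cos (l%:~R * c)) (sin (l%:~R * c))
    (cos2Dsin2 (k%:~R * a)) (cos2Dsin2 (l%:~R * c)) => B1 B2 B3 B4 e1 e2.
  by field.
rewrite (pairing_sum _ _ iV); last first.
  by case=> -[|[|[|j]]] hj; rewrite /F /=; [exact: tame_cos_wave|exact: tame_sin_wave|exact: tame_cos_wave|exact: tame_sin_wave].
apply: big1 => -[[|[|[|j]]] hj] _; rewrite /F /=; apply/eqP; rewrite mulf_eq0; apply/orP; right; apply/eqP.
- by have [] := V0 k0 l0.
- by have [] := V0 k0 l0.
- by have [] := V0 k0 nl0.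
- by have [] := V0 k0 nl0.
Qed.

Let tame_cos_cos (k l : int) (a c : R) :
  tame (fun x : R * R => cos (k%:~R * (x.1 - a)) * cos (l%:~R * (x.2 - c))).
Proof.
have H (m : int) (b : R) : measurable_fun setT (fun t : R => cos (m%:~R * (t - b))) /\ forall t : R, `|cos (m%:~R * (t - b))| <= 1.
  split; last by move=> t; rewrite ler_norml cos_geN1 cos_le1.
  apply: measurableT_comp; first by apply: continuous_measurable_fun; exact: continuous_cos.
  by apply: measurable_funM => //; exact: measurable_funB.
by apply: tameM; [exact: (tame_fst (H k a).1 (H k a).2)|exact: (tame_snd (H l c).1 (H l c).2)].
Qed.

(** The mixed second difference is a product of two differences of bumps. Expanding both leaves
    products of cosines of nonzero frequencies, each a combination of four annihilated waves. *)
Lemma pairing_bump_cross n (a b c d : R) :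
  pairing V (fun x => cos_bump n (x.1 - a) * cos_bump n (x.2 - c))
  - pairing V (fun x => cos_bump n (x.1 - a) * cos_bump n (x.2 - d))
  - (pairing V (fun x => cos_bump n (x.1 - b) * cos_bump n (x.2 - c))
  - pairing V (fun x => cos_bump n (x.1 - b) * cos_bump n (x.2 - d))) = 0.
Proof.
have tB (F G : R * R -> R) : tame F -> tame G -> tame (fun x => F x - G x).
  move=> tF [mG [B HB]]; apply: tameD tF _; split; first exact: measurable_funN.
  by exists B => x; rewrite normrN.
rewrite -!pairingB//; try exact: tame_bump; try (by apply: tB; exact: tame_bump).
have [L [L0 HL]] := bump_diff_cos n a b; have [M [M0 HM]] := bump_diff_cos n c d.
pose cc (p q : R * int) a c x : R := cos (p.2%:~R * ((x : R * R).1 - a)) * cos (q.2%:~R * (x.2 - c)).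
pose sg (i : bool * bool) : R := (-1) ^+ (i.1 + i.2)%N.
pose T := [:: (false, false); (false, true); (true, false); (true, true)].
pose G p q (i : bool * bool) := cc p q (if i.1 then b else a) (if i.2 then d else c).
transitivity (pairing V (fun x => \sum_(p <- L) 1 * \sum_(q <- M) (p.1 * q.1) * \sum_(i <- T) sg i * G p q i x)).
  congr pairing; apply/funext => x.
  transitivity ((cos_bump n (x.1 - a) - cos_bump n (x.1 - b)) * (cos_bump n (x.2 - c) - cos_bump n (x.2 - d))).
    by ring.
  rewrite HL HM big_distrlr/=; apply: eq_bigr => p _; rewrite mul1r; apply: eq_bigr => q _.
  rewrite /T !big_cons big_nil /sg /G /cc/= expr0 expr1 sqrrN expr1n; ring.
have tG p q i : tame (G p q i) by exact: tame_cos_cos.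
have tS p q : tame (fun x => \sum_(i <- T) sg i * G p q i x).
  by apply: tame_sum => i; apply: tameM => //; exact: tame_cst.
have tSS p : tame (fun x => \sum_(q <- M) (p.1 * q.1) * \sum_(i <- T) sg i * G p q i x).
  by apply: tame_sum => q; apply: tameM => //; exact: tame_cst.
rewrite (@pairing_sum _ _ L _ (fun=> 1) _ iV)//; rewrite big_seq big1// => p pL.
rewrite mul1r (@pairing_sum _ _ M _ (fun q => p.1 * q.1) _ iV)//; rewrite big_seq big1// => q qM.
rewrite (pairing_sum _ _ iV)// big1 ?mulr0// => i _.
by rewrite /G pairing_cos_cos ?mulr0//; [exact: L0|exact: M0].
Qed.

End Annihilation.
End CosineBump.

Section TorusProduct.
Variable R : realType.
Local Notation mu := (@lebesgue_measure R).

Lemma torus_integral_mul (p q : R -> R) : continuous p -> continuous q ->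
  torus_integrable (fun x => p x.1 * q x.2) /\
  \int[plane]_(x in @torus_square R) (p x.1 * q x.2) =
    (\int[mu]_(s in `[0, 2 * pi]) p s) * (\int[mu]_(s in `[0, 2 * pi]) q s).
Proof.
move=> cp cq; pose I : set R := `[0, 2 * pi]%classic.
have mI : measurable I by exact: measurable_itv.
have H (h : R -> R) : continuous h -> mu.-integrable setT (EFin \o (fun s => h s * \1_I s)) /\
   \int[mu]_s (h s * \1_I s) = \int[mu]_(s in `[0, 2 * pi]) h s.
  move=> ch; have e : (EFin \o h) \_ I = EFin \o (fun s => h s * \1_I s).
    by apply/funext => s; rewrite patchE /= indicE; case: ifP; rewrite ?mulr1 ?mulr0.
  split; first by rewrite -e; apply/(integrable_mkcond _ _).1 => //; exact: continuous_integrable_itv.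
  by rewrite /Rintegral [in RHS]integral_mkcond -/I e.
have [i1 e1] := H p cp; have [i2 e2] := H q cq.
have [i e] := plane_integral_mul i1 i2.
have E : (fun x : R * R => ((p x.1 * \1_I x.1) * (q x.2 * \1_I x.2))%:E) =
    (EFin \o (fun x => p x.1 * q x.2)) \_ (@torus_square R).
  apply/funext => x; rewrite patchE /= !indicE.
  have -> : (x \in @torus_square R) = (x.1 \in I) && (x.2 \in I).
    by apply/idP/andP; rewrite !inE.
  by case: (x.1 \in I); case: (x.2 \in I); rewrite /= ?mulr1 ?mulr0 ?mul0r.
split.
  rewrite /torus_integrable; apply/(integrable_mkcond _ _).2; first exact: measurable_torus_square.
  by rewrite -E.
rewrite /Rintegral [in LHS]integral_mkcond -E e/=.
by rewrite e1 e2.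
Qed.

Definition mass n : R := \int[mu]_(t in `[0, 2 * pi]) cos_bump n t.

Let ib n a : mu.-integrable `[0, 2 * pi] (EFin \o (fun t => cos_bump n (t - a))).
Proof. by apply: continuous_integrable_itv; exact: continuous_bump. Qed.

Let mb n a : measurable_fun setT (fun t : R => (cos_bump n (t - a))%:E : \bar R).
Proof. by apply/measurable_EFinP; apply: continuous_measurable_fun; exact: continuous_bump. Qed.

Lemma mass_shift n a : \int[mu]_(t in `[0, 2 * pi]) cos_bump n (t - a) = mass n.
Proof.
rewrite /mass /Rintegral; congr fine.
have p0 := pi_gt0 R; have p2 : 0 < 2 * pi :> R by lra.
have per (t : R) : (cos_bump n (t + 2 * pi - a))%:E = (cos_bump n (t - a))%:E by rewrite addrAC bumpD2pi.
have := integral_periodic 0 a p2 (mb n a) per; rewrite add0r => ->.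
rewrite -(@ge0_integral_shift _ a `[a, a + 2 * pi]%classic)//=; last 2 first.
- by apply: measurable_funTS; exact: mb.
- by move=> t; rewrite lee_fin bump_ge0.
rewrite (_ : (fun x => x + a) @^-1` `[a, a + 2 * pi]%classic = `[0, 2 * pi]%classic).
  by apply: eq_integral => t _; rewrite addrK.
by apply/seteqP; split => t /=; rewrite !in_itv/= => /andP[? ?]; apply/andP; split; lra.
Qed.

Let le_cos (x y : R) : 0 <= x <= pi -> 0 <= y <= pi -> x <= y -> cos y <= cos x.
Proof.
move=> hx hy; rewrite le_eqVlt => /orP[/eqP ->//|xy].
by rewrite ltW// ltr_cos// in_itv.
Qed.

Lemma mass_ge n e : 0 < e <= pi -> e * ((1 + cos e) / 2) ^+ n <= mass n.
Proof.
move=> /andP[e0 epi]; have p0 := pi_gt0 R.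
have mI (x : R) : measurable (`[0, x]%classic : set R) by exact: measurable_itv.
have mb0 D : measurable D -> measurable_fun D (fun t : R => (cos_bump n t)%:E : \bar R).
  move=> mD; apply: measurable_funTS; have := mb n 0.
  by under eq_fun do rewrite subr0.
have fin : (\int[mu]_(t in `[0%R, (2 * pi)%R]) (cos_bump n t)%:E)%E \is a fin_num.
  have := ib n 0; have -> : (fun t : R => cos_bump n (t - 0)) = (fun t => cos_bump n t) by apply/funext => t; rewrite subr0.
  by move=> /integrable_fin_num; apply; exact: mI.
rewrite -lee_fin /mass /Rintegral fineK//.
apply: (@le_trans _ _ (\int[mu]_(t in `[0%R, e]) (cos_bump n t)%:E)%E); last first.
  apply: ge0_subset_integral => //.
  - by apply: mb0; exact: mI.
  - by move=> t _; rewrite lee_fin bump_ge0.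
  - by move=> t /=; rewrite !in_itv/= => /andP[? ?]; apply/andP; split; lra.
apply: (@le_trans _ _ (\int[mu]_(t in `[0%R, e]) (((1 + cos e) / 2) ^+ n)%:E)%E).
  rewrite integral_cst; last exact: mI.
  by rewrite /= lebesgue_measure_itv/= lte_fin e0 -EFinB subr0 -EFinM lee_fin mulrC.
apply: ge0_le_integral => //.
- by apply: mb0; exact: mI.
move=> t /=; rewrite in_itv/= => /andP[t0 te]; rewrite lee_fin.
have /andP[b1 b2] := bump_base e; have /andP[b3 b4] := bump_base t.
have : cos e <= cos t by apply: le_cos => //; apply/andP; split; lra.
by move=> h; rewrite /cos_bump lerXn2r ?nnegrE//; lra.
Qed.

Lemma mass_gt0 n : 0 < mass n.
Proof.
have p0 := pi_gt0 R; have p4 := pi_ge2 R.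
have h : 0 < (1 : R) <= pi by apply/andP; split; lra.
apply: lt_le_trans (mass_ge n h); rewrite mul1r exprn_gt0//.
have : 0 < cos (1 / 2 : R).
  by apply: cos_gt0_pihalf; apply/andP; split; lra.
have := cos2Dsin2 (1 / 2 : R); have := cos_half (1 : R); move: (cos 1) (cos (1 / 2)) (sin (1 / 2)) => x y z; nra.
Qed.

(* cos (e / 2) ^ 2 < cos (e / 4) ^ 4, so at distance e from 0 the bump decays
   faster than its squared mass. *)
Lemma bump_tail_negligible (e W eps : R) : 0 < e < pi -> 0 < eps ->
  exists N, forall n, (N <= n)%N -> ((1 + cos e) / 2) ^+ n * W <= eps * mass n ^+ 2.
Proof.
move=> /andP[e0 epi] eps0.
pose q := (1 + cos e) / 2; pose r := (1 + cos (e / 2)) / 2.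
have c0 : 0 < cos (e / 2) by apply: cos_gt0_pihalf; apply/andP; split; lra.
have c1 : cos (e / 2) < 1.
  have := cos_half (e / 2); have : 0 < sin (e / 2 / 2) by apply: sin_gt0_pi; apply/andP; split; lra.
  by move=> s0; have := exprn_gt0 2 s0; lra.
have qE : q = cos (e / 2) ^+ 2.
  by rewrite /q; have := cos_half e; have := cos2Dsin2 (e / 2) => h1 h2; lra.
have q0 : 0 < q by rewrite qE exprn_gt0.
have r0 : 0 < r by rewrite /r; lra.
have qr : q < r ^+ 2 by rewrite qE /r; nra.
pose x := q / r ^+ 2.
have r2 : 0 < r ^+ 2 by rewrite exprn_gt0.
have x0 : 0 <= x by rewrite divr_ge0// ltW.
have x01 : `|x| < 1 by rewrite ger0_norm// /x ltr_pdivrMr// mul1r.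
have K0 : 0 < eps * (e / 2) ^+ 2 / (`|W| + 1).
  by rewrite divr_gt0 ?mulr_gt0 ?exprn_gt0 ?divr_gt0// ltr_wpDl.
have := cvg_expr x01; move/cvgrPdist_lt => /(_ _ K0)[N _ HN]; exists N => n Nn.
have := HN n Nn; rewrite sub0r normrN ger0_norm; last by rewrite exprn_ge0// divr_ge0// ltW.
rewrite ltr_pdivlMr; last by rewrite ltr_wpDl.
rewrite /x expr_div_n => h.
have e2 : 0 < e / 2 <= pi by apply/andP; split; lra.
have := mass_ge n e2; rewrite -/r => m1.
have rn : 0 < r ^+ n by rewrite exprn_gt0.
have m2 : (e / 2) ^+ 2 * (r ^+ 2) ^+ n <= mass n ^+ 2.
  rewrite exprAC -exprMn lerXn2r ?nnegrE//; first by rewrite mulr_ge0// ltW//; lra.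
  by rewrite ltW// mass_gt0.
have qn : 0 <= q ^+ n by rewrite exprn_ge0// ltW.
apply: le_trans (ler_wpM2l qn (ler_norm W)) _.
apply: (@le_trans _ _ (q ^+ n * (`|W| + 1))); first by rewrite ler_wpM2l// lerDl.
apply: (@le_trans _ _ (eps * ((e / 2) ^+ 2 * (r ^+ 2) ^+ n))); last by rewrite ler_pM2l.
have rr : 0 < (r ^+ 2) ^+ n by rewrite exprn_gt0.
move: h; rewrite mulrAC ltr_pdivrMr// => /ltW; by rewrite !mulrA.
Qed.

Lemma bump_far n (e t : R) : 0 < e <= pi -> e <= `|t| -> `|t| <= 2 * pi - e ->
  cos_bump n t <= ((1 + cos e) / 2) ^+ n.
Proof.
move=> /andP[e0 epi] t1 t2; have p0 := pi_gt0 R.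
have /andP[b1 b2] := bump_base e; have /andP[b3 b4] := bump_base t.
suff h : cos t <= cos e by rewrite /cos_bump lerXn2r ?nnegrE//; lra.
rewrite -(cos_norm t); move: `|t| t1 t2 => u t1 t2.
have [upi|upi] := leP u pi.
  by apply: le_cos => //; apply/andP; split; lra.
rewrite -(cosN u) -(cosD2pi' (- u)); apply: le_cos; try (apply/andP; split); lra.
Qed.

End TorusProduct.

(** * Point values of a kernel from its pairings with bumps *)

Section PointwiseRecovery.
Variable R : realType.
Variable V : R * R -> R.
Hypothesis iV : torus_integrable V.
Implicit Types (a b c d : R).

Definition eps_continuous (F : R * R -> R) a c := forall e : R, 0 < e -> exists2 r : R, 0 < r &
  forall s t, `|s - a| < r -> `|t - c| < r -> `|F (s, t) - F (a, c)| <= e.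

(** Near the centre, continuity controls V - V (a, c). Elsewhere the product of bumps is at most
    q^n, and q^n times the L1 norm of V - V (a, c) is negligible against the squared mass, so
    integrability alone takes care of the singularities. *)
Lemma pairing_bump_cvg a c : 0 < a < 2 * pi -> 0 < c < 2 * pi -> eps_continuous V a c ->
  forall e : R, 0 < e -> exists N, forall n, (N <= n)%N ->
  `|pairing V (fun x => cos_bump n (x.1 - a) * cos_bump n (x.2 - c)) - mass R n ^+ 2 * V (a, c)| <=
    e * mass R n ^+ 2.
Proof.
move=> /andP[a0 a2] /andP[c0 c2] cV eps eps0; have p0 := pi_gt0 R.
have eps2 : 0 < eps / 2 by rewrite divr_gt0.
have [r r0 Hr] := cV _ eps2.
(* [e] is below the distances of [a] and [c] to the ends of the period, so that no other peak of the
   periodic bumps comes within [e] of the square. *)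
have [e e0 [er ea ea' ec ec']] : exists2 e : R, 0 < e &
    [/\ e <= r, e < a, e < 2 * pi - a, e < c & e < 2 * pi - c].
  exists (Num.min r (Num.min (Num.min a (2 * pi - a)) (Num.min c (2 * pi - c))) / 2).
    by rewrite divr_gt0// !lt_min; do ! (apply/andP; split); lra.
  set m := Num.min r _; have : m <= m by [].
  have m0 : 0 < m by rewrite !lt_min; do ! (apply/andP; split); lra.
  rewrite {2}/m !le_min => /andP[h1 /andP[/andP[h2 h3] /andP[h4 h5]]].
  by split; lra.
have epi : 0 < e < pi by rewrite e0/=; lra.
have epi' : 0 < e <= pi by rewrite e0/=; lra.
pose V0 := V (a, c); pose U x := V x - V0.
have mD := @measurable_prod_square R.
have one : torus_integrable (fun _ : R * R => 1 : R).
  have cst1 : continuous (fun _ : R => 1 : R) by move=> ?; exact: cvg_cst.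
  have [h _] := torus_integral_mul cst1 cst1.
  by have -> : (fun _ : R * R => 1 : R) = (fun x => 1 * 1) by apply/funext => x; rewrite mulr1.
have iV0 : torus_integrable (fun _ : R * R => V0).
  have := torus_integrableZl V0 one.
  by have -> : (fun _ : R * R => V0 * 1) = (fun=> V0) by apply/funext => x; rewrite mulr1.
have iU : torus_integrable U by exact: (integrableB mD iV iV0).
have iaU : torus_integrable (fun x => `|U x|) by exact: (integrable_norm iU).
pose W := \int[plane]_(x in @torus_square R) `|U x|.
pose q := (1 + cos e) / 2.
have [N HN] := bump_tail_negligible W epi eps2; exists N => n Nn.
pose B (x : R * R) := cos_bump n (x.1 - a) * cos_bump n (x.2 - c).
have tB : tame B by exact: tame_bump.
have B0 x : 0 <= B x by rewrite mulr_ge0// bump_ge0.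
have [iB eB] := torus_integral_mul (@continuous_bump R n a) (@continuous_bump R n c).
rewrite !mass_shift -expr2 in eB.
have -> : pairing V B - mass R n ^+ 2 * V (a, c) = \int[plane]_(x in @torus_square R) (U x * B x).
  rewrite -eB mulrC -RintegralZl// /pairing -RintegralB//.
  - by apply: eq_Rintegral => x _; rewrite /U /V0 mulrBl.
  - exact: (integrable_tame iV tB).
  - exact: (torus_integrableZl (V (a, c)) iB).
apply: le_trans (le_normr_Rintegral mD (integrable_tame iU tB)) _.
have iR : torus_integrable (fun x => eps / 2 * B x + q ^+ n * `|U x|).
  exact: (integrableD mD (torus_integrableZl (eps / 2) iB) (torus_integrableZl (q ^+ n) iaU)).
apply: (@le_trans _ _ (\int[plane]_(x in @torus_square R) (eps / 2 * B x + q ^+ n * `|U x|))).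
  apply: (le_Rintegral mD _ iR); first exact: (integrable_norm (integrable_tame iU tB)).
  move=> [s t] /= [] /=; rewrite !in_itv/= => /andP[s1 s2] /andP[t1 t2].
  rewrite normrM (ger0_norm (B0 _)).
  have qn : 0 <= q ^+ n by rewrite exprn_ge0//; have /andP[] := bump_base e.
  have b1 := @bump_ge0 R n (s - a); have b2 := @bump_ge0 R n (t - c).
  have b3 := @bump_le1 R n (s - a); have b4 := @bump_le1 R n (t - c).
  have far : e <= `|s - a| \/ e <= `|t - c| -> B (s, t) <= q ^+ n.
    have w (x y : R) : 0 <= x <= 2 * pi -> e < y -> e < 2 * pi - y -> `|x - y| <= 2 * pi - e.
      by clear; move=> /andP[? ?] ? ?; rewrite ler_norml; apply/andP; split; lra.
    case=> h; rewrite /B /=.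
      have := bump_far n epi' h (w _ _ _ ea ea'); rewrite s1 s2 => /(_ isT) hb.
      by apply: le_trans (ler_piMr _ b4) _.
    have := bump_far n epi' h (w _ _ _ ec ec'); rewrite t1 t2 => /(_ isT) hb.
    by apply: le_trans (ler_piMl _ b3) _.
  have [h1|h1] := leP e `|s - a|.
    apply: ler_wpDl; first by rewrite mulr_ge0// ltW.
    by rewrite mulrC ler_wpM2r//; apply: far; left.
  have [h2|h2] := leP e `|t - c|.
    apply: ler_wpDl; first by rewrite mulr_ge0// ltW.
    by rewrite mulrC ler_wpM2r//; apply: far; right.
  apply: ler_wpDr; first by rewrite mulr_ge0.
  by rewrite ler_wpM2r//; apply: Hr; [exact: lt_le_trans h1 er|exact: lt_le_trans h2 er].
rewrite RintegralD//; last 2 first.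
- exact: (torus_integrableZl (eps / 2) iB).
- exact: (torus_integrableZl (q ^+ n) iaU).
rewrite !RintegralZl// eB -/W; have := HN n Nn; rewrite -/q; lra.
Qed.

Lemma annihilated_cross a b c d : (forall k l : int, k != 0 -> l != 0 ->
    pairing V (cos_wave k l) = 0 /\ pairing V (sin_wave k l) = 0) ->
  0 < a < 2 * pi -> 0 < b < 2 * pi -> 0 < c < 2 * pi -> 0 < d < 2 * pi ->
  eps_continuous V a c -> eps_continuous V a d -> eps_continuous V b c -> eps_continuous V b d ->
  V (a, c) - V (a, d) - (V (b, c) - V (b, d)) = 0.
Proof.
move=> V0 ha hb hc hd cac cad cbc cbd.
set X := (X in X = 0); apply/eqP; rewrite -normr_le0; apply/ler_addgt0Pr => e e0; rewrite add0r.
have e4 : 0 < e / 4 by rewrite divr_gt0.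
have [N1 H1] := pairing_bump_cvg ha hc cac e4; have [N2 H2] := pairing_bump_cvg ha hd cad e4.
have [N3 H3] := pairing_bump_cvg hb hc cbc e4; have [N4 H4] := pairing_bump_cvg hb hd cbd e4.
pose n := (N1 + N2 + N3 + N4)%N.
have l4 : (N4 <= n)%N by exact: leq_addl.
have l3 : (N3 <= n)%N by exact: leq_trans (leq_addl _ _) (leq_addr _ _).
have l12 : (N1 + N2 <= n)%N by exact: leq_trans (leq_addr _ _) (leq_addr _ _).
have l2 : (N2 <= n)%N by exact: leq_trans (leq_addl _ _) l12.
have l1 : (N1 <= n)%N by exact: leq_trans (leq_addr _ _) l12.
have h1 := H1 n l1; have h2 := H2 n l2; have h3 := H3 n l3; have h4 := H4 n l4.
have := pairing_bump_cross iV V0 n a b c d.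
have m0 : 0 < mass R n ^+ 2 by rewrite exprn_gt0// mass_gt0.
move: h1 h2 h3 h4; rewrite !ler_norml.
move: (mass R n ^+ 2) m0 => m m0.
move: (pairing _ _) (pairing _ _) (pairing _ _) (pairing _ _) => x1 x2 x3 x4.
move=> /andP[? ?] /andP[? ?] /andP[? ?] /andP[? ?] xs.
by apply/andP; split; rewrite -(ler_pM2l m0) /X; lra.
Qed.

End PointwiseRecovery.

(** * Equal matrices give equal cross ratios *)

Section CrossRatio.
Variable R : realType.
Implicit Types (f : R -> R) (a b c d x y : R).

Definition half_chord f x y : R := sin ((f x - f y) / 2).

Lemma half_chordC f x y : half_chord f y x = - half_chord f x y.
Proof. by rewrite /half_chord -sinN -mulNr opprB. Qed.

Lemma half_chord_gt0 f x y : circle_lift f -> 0 < y -> y < x -> x < 2 * pi -> 0 < half_chord f x y.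
Proof.
move=> [cf fi fT] y0 yx x2; apply: sin_half_gt0.
have := fi _ _ yx; have : f x < f (y + 2 * pi) by apply: fi; lra.
by rewrite fT => ? ?; apply/andP; split; lra.
Qed.

(** A lift preserves order and keeps the points of one period within 2 pi, so the sign depends only
    on the order of [x] and [y]. It is the same for all lifts, which restores the signs that the
    logarithms lose. *)
Lemma half_chord_sg f x y : circle_lift f -> 0 < x < 2 * pi -> 0 < y < 2 * pi -> x != y ->
  half_chord f x y = Num.sg (x - y) * `|half_chord f x y| /\ half_chord f x y != 0.
Proof.
move=> lf /andP[x0 x2] /andP[y0 y2]; rewrite neq_lt => /orP[xy|yx].
  have h := half_chord_gt0 lf x0 xy y2; rewrite half_chordC.
  by rewrite normrN gtr0_norm// ltr0_sg ?subr_lt0// mulN1r oppr_eq0 gt_eqF.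
have h := half_chord_gt0 lf y0 yx x2.
by rewrite gtr0_norm// gtr0_sg ?subr_gt0// mul1r gt_eqF.
Qed.

Lemma arc_log_eps_continuous f a c : circle_lift f -> half_chord f a c != 0 ->
  eps_continuous (arc_log f) a c.
Proof.
move=> [cf _ _] h e e0.
have cF : {for (a, c), continuous (arc_log f)}.
  have cin : {for (a, c), continuous (fun x : R * R => (f x.1 - f x.2) / 2)}.
    apply: cvgM; last exact: cvg_cst.
    apply: cvgB.
      by apply: (@continuous_comp _ _ _ fst f); [exact: cvg_fst|exact: cf].
    by apply: (@continuous_comp _ _ _ snd f); [exact: cvg_snd|exact: cf].
  apply: cvgM; first exact: cvg_cst.
  apply: (@continuous_comp _ _ _ (fun x : R * R => `|sin ((f x.1 - f x.2) / 2)|) (@ln R)).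
    have cs : {for (a, c), continuous (fun x : R * R => sin ((f x.1 - f x.2) / 2))}.
      by apply: (@continuous_comp _ _ _ _ sin); [exact: cin|exact: continuous_sin].
    exact: (cvg_norm cs).
  by apply: continuous_ln; rewrite normr_gt0.
have /cvgrPdist_le /(_ e e0) : arc_log f @ (a, c) --> arc_log f (a, c) by exact: cF.
move=> /nbhs_ballP[r r0 Hr]; exists r => // s t sa tc.
rewrite distrC; apply: (Hr (s, t)); split => /=; rewrite /ball/= distrC//.
Qed.

Lemma eps_continuousB (F G : R * R -> R) (k : R) a c : 0 < k -> eps_continuous F a c -> eps_continuous G a c ->
  eps_continuous (fun x : R * R => k * (F x - G x)) a c.
Proof.
move=> k0 cF cG e e0; have e2 : 0 < e / k / 2 by rewrite !divr_gt0.
have [r1 r10 H1] := cF _ e2; have [r2 r20 H2] := cG _ e2.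
exists (Num.min r1 r2); first by rewrite lt_min r10.
move=> s t; rewrite !lt_min => /andP[s1 s2] /andP[t1 t2].
have := H1 _ _ s1 t1; have := H2 _ _ s2 t2.
rewrite -mulrBr normrM gtr0_norm// -ler_pdivlMl//.
set u := F _; set u' := F _; set v := G _; set v' := G _ => h2 h1.
have -> : u - v - (u' - v') = (u - u') - (v - v') by ring.
by apply: le_trans (ler_normB _ _) _; lra.
Qed.

Lemma welding_eq_cross phi1 phi2 f1 f2 a b c d : QS phi1 -> QS phi2 ->
  circle_lift f1 -> circle_lift f2 ->
  (forall t, phi1 (cis t) = cis (f1 t)) -> (forall t, phi2 (cis t) = cis (f2 t)) ->
  welding_grunsky phi1 = welding_grunsky phi2 ->
  0 < a < 2 * pi -> 0 < b < 2 * pi -> 0 < c < 2 * pi -> 0 < d < 2 * pi ->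
  a != c -> a != d -> b != c -> b != d ->
  half_chord f1 a c * half_chord f1 b d * (half_chord f2 a d * half_chord f2 b c) =
  half_chord f2 a c * half_chord f2 b d * (half_chord f1 a d * half_chord f1 b c).
Proof.
move=> q1 q2 l1 l2 e1 e2 W ha hb hc hd ac ad bc bd; have p0 := pi_gt0 R.
have i1 := log_quotient_integrable q1; have i2 := log_quotient_integrable q2.
pose V (x : R * R) := log_quotient2 phi1 x - log_quotient2 phi2 x.
have mD := @measurable_prod_square R.
have iV : torus_integrable V by exact: (integrableB mD i1 i2).
have VB psi : tame psi -> pairing V psi = pairing (log_quotient2 phi1) psi - pairing (log_quotient2 phi2) psi.
  move=> tp; rewrite /pairing -(RintegralB mD (integrable_tame i1 tp) (integrable_tame i2 tp)).
  by apply: eq_Rintegral => x _; rewrite /V mulrBl.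
have V0 (k l : int) : k != 0 -> l != 0 ->
    pairing V (cos_wave k l) = 0 /\ pairing V (sin_wave k l) = 0.
  move=> k0 l0; have := congr1 (fun A => A (exist _ k k0) (exist _ l l0)) W.
  rewrite (welding_grunskyE _ _ q1) (welding_grunskyE _ _ q2) => -[ec es].
  have w0 : ((2 * pi) ^+ 2)^-1 * (weight R k * weight R l) != 0.
    by rewrite mulf_neq0 ?invr_eq0 ?expf_neq0 ?mulf_neq0 ?gt_eqF ?weight_gt0//; lra.
  rewrite !VB; [|exact: tame_sin_wave|exact: tame_cos_wave].
  split; apply/eqP; rewrite subr_eq0; apply/eqP; apply: (mulfI w0); first by rewrite -!mulrA in ec *.
  by apply: oppr_inj; rewrite -!mulrA in es *.
have VE : V = (fun x : R * R => 2^-1 * (arc_log f2 x - arc_log f1 x)).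
  by apply/funext => x; rewrite /V (log_quotient2E l1 e1) (log_quotient2E l2 e2); ring.
have cV x y : 0 < x < 2 * pi -> 0 < y < 2 * pi -> x != y -> eps_continuous V x y.
  move=> hx hy xy; rewrite VE; apply: eps_continuousB; first by rewrite invr_gt0.
    by apply: arc_log_eps_continuous => //; have [] := half_chord_sg l2 hx hy xy.
  by apply: arc_log_eps_continuous => //; have [] := half_chord_sg l1 hx hy xy.
have := annihilated_cross iV V0 ha hb hc hd (cV _ _ ha hc ac) (cV _ _ ha hd ad) (cV _ _ hb hc bc) (cV _ _ hb hd bd).
rewrite VE /arc_log /= -!/(half_chord _ _ _).
have [s1 n1] := half_chord_sg l1 ha hc ac; have [s2 n2] := half_chord_sg l1 hb hd bd.
have [s3 n3] := half_chord_sg l2 ha hd ad; have [s4 n4] := half_chord_sg l2 hb hc bc.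
have [s5 n5] := half_chord_sg l2 ha hc ac; have [s6 n6] := half_chord_sg l2 hb hd bd.
have [s7 n7] := half_chord_sg l1 ha hd ad; have [s8 n8] := half_chord_sg l1 hb hc bc.
rewrite -!normr_gt0 in n1 n2 n3 n4 n5 n6 n7 n8.
move: s1 s2 s3 s4 s5 s6 s7 s8 n1 n2 n3 n4 n5 n6 n7 n8.
move: `|half_chord f1 a c| `|half_chord f1 b d| `|half_chord f2 a d| `|half_chord f2 b c|.
move: `|half_chord f2 a c| `|half_chord f2 b d| `|half_chord f1 a d| `|half_chord f1 b c|.
move=> u5 u6 u7 u8 u1 u2 u3 u4 -> -> -> -> -> -> -> -> n1 n2 n3 n4 n5 n6 n7 n8 h.
have : ln (u1 * u2 * (u3 * u4)) = ln (u5 * u6 * (u7 * u8)).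
  by rewrite !lnM ?posrE ?mulr_gt0//; lra.
move=> /ln_inj; rewrite !posrE => /(_ _ _)/= E.
have {}E : u1 * u2 * (u3 * u4) = u5 * u6 * (u7 * u8) by apply: E; rewrite !mulr_gt0.
(* Each of the four pairs occurs once on either side, so the signs, common to [f1] and [f2],
   agree. *)
set sac := Num.sg (a - c); set sbd := Num.sg (b - d); set sad := Num.sg _; set sbc := Num.sg _.
transitivity (sac * sbd * (sad * sbc) * (u1 * u2 * (u3 * u4))); first by ring.
by rewrite E; ring.
Qed.

End CrossRatio.

(** * Moebius transformations *)

Section MoebiusFromCrossRatio.
Variable R : realType.
Implicit Types (f : R -> R) (x y t : R).

(** i e^(i m), the direction of a chord whose endpoints have mean argument [m]. *)
Let phase (m : R) : R[i] := Complex (- sin m) (cos m).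

Lemma expiB_half_chord f x y : expi (f x) - expi (f y) =
  Complex (2 * half_chord f x y) 0 * phase ((f x + f y) / 2).
Proof.
rewrite /half_chord; set h := (f x - f y) / 2; set m := (f x + f y) / 2.
have -> : f x = m + h by rewrite /m /h; field.
have -> : f y = m - h by rewrite /m /h; field.
rewrite /expi /phase cosD cosB sinD sinB.
by apply/eqP; rewrite eq_complex /=; apply/andP; split; apply/eqP; ring.
Qed.

Let phaseM m1 m2 m3 m4 : m1 + m2 = m3 + m4 -> phase m1 * phase m2 = phase m3 * phase m4.
Proof.
have H u v : phase u * phase v = Complex (- cos (u + v)) (- sin (u + v)).
  by rewrite /phase cosD sinD; apply/eqP; rewrite eq_complex /=; apply/andP; split; apply/eqP; ring.
by move=> e; rewrite !H e.
Qed.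

(** The chord directions cancel: the mean arguments of the pairs (a, c), (b, d) have the same sum as
    those of (a, d), (b, c). The complex cross ratio is thus the real one of the half chords. *)
Lemma expi_cross f1 f2 (a b c d : R) :
  half_chord f1 a c * half_chord f1 b d * (half_chord f2 a d * half_chord f2 b c) =
  half_chord f2 a c * half_chord f2 b d * (half_chord f1 a d * half_chord f1 b c) ->
  (expi (f1 a) - expi (f1 c)) * (expi (f1 b) - expi (f1 d)) *
    ((expi (f2 a) - expi (f2 d)) * (expi (f2 b) - expi (f2 c))) =
  (expi (f2 a) - expi (f2 c)) * (expi (f2 b) - expi (f2 d)) *
    ((expi (f1 a) - expi (f1 d)) * (expi (f1 b) - expi (f1 c))).
Proof.
move=> h; rewrite !expiB_half_chord.
have p1 : phase ((f1 a + f1 c) / 2) * phase ((f1 b + f1 d) / 2) =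
    phase ((f1 a + f1 d) / 2) * phase ((f1 b + f1 c) / 2) by apply: phaseM; field.
have p2 : phase ((f2 a + f2 d) / 2) * phase ((f2 b + f2 c) / 2) =
    phase ((f2 a + f2 c) / 2) * phase ((f2 b + f2 d) / 2) by apply: phaseM; field.
have R4 (c1 c2 c3 c4 m1 m2 m3 m4 : R[i]) : c1 * m1 * (c2 * m2) * (c3 * m3 * (c4 * m4)) =
    c1 * c2 * (c3 * c4) * (m1 * m2 * (m3 * m4)) by ring.
have E4 (c1 c2 c3 c4 d1 d2 d3 d4 m1 m2 m3 m4 n1 n2 n3 n4 : R[i]) :
    c1 * c2 * (c3 * c4) = d1 * d2 * (d3 * d4) -> m1 * m2 = n3 * n4 -> m3 * m4 = n1 * n2 ->
    c1 * m1 * (c2 * m2) * (c3 * m3 * (c4 * m4)) = d1 * n1 * (d2 * n2) * (d3 * n3 * (d4 * n4)).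
  by move=> ec e1 e2; rewrite [LHS]R4 [RHS]R4 ec e1 e2; congr (_ * _); exact: mulrC.
apply: E4 => //.
have M (u v : R) : Complex u 0 * Complex v 0 = Complex (u * v) 0 :> R[i].
  by apply/eqP; rewrite eq_complex /=; apply/andP; split; apply/eqP; ring.
rewrite !M; apply: (congr1 (fun u => Complex u 0)).
have H4 (u1 u2 u3 u4 : R) : 2 * u1 * (2 * u2) * (2 * u3 * (2 * u4)) = 16 * (u1 * u2 * (u3 * u4)) by ring.
by rewrite !H4 h.
Qed.

Lemma expi_lift_neq f x y : circle_lift f -> 0 < x < 2 * pi -> 0 < y < 2 * pi -> x != y ->
  expi (f x) - expi (f y) != 0.
Proof.
move=> lf hx hy xy; have [_ h0] := half_chord_sg lf hx hy xy.
apply: contra_neq h0 => e; have := normc_expiB (f x) (f y); rewrite e ComplexField.Normc.normc0.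
move=> /esym/eqP; rewrite mulf_eq0 pnatr_eq0/= normr_eq0 => /eqP.
by [].
Qed.

Lemma sqn_expiB_le x y : sqn (expi x - expi y) <= (x - y) ^+ 2.
Proof.
rewrite -normc_sqr normc_expiB -(real_normK (num_real (x - y))) ler_pXn2r ?nnegrE//.
have := abs_sin_le ((x - y) / 2); rewrite normrM (ger0_norm (_ : 0 <= 2^-1))//; lra.
Qed.

Lemma expi_cvg f (u : nat -> R) (l : R) : continuous f -> u @ \oo --> l ->
  (fun n => expi (f (u n)) : R[i]^o) @ \oo --> (expi (f l) : R[i]^o).
Proof.
move=> cf ul; apply/complex_cvgP => e e0.
have cfu : (fun n => f (u n)) @ \oo --> f l by apply: (cvg_comp _ _ ul); exact: cf.
have s0 : 0 < Num.sqrt e by rewrite sqrtr_gt0.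
move/cvgrPdist_lt : cfu => /(_ _ s0); apply: filterS => n h.
apply: le_lt_trans (sqn_expiB_le _ _) _.
rewrite -(sqr_sqrtr (ltW e0)) -sqrrN opprB -(real_normK (num_real (_ - _))).
by rewrite ltr_pXn2r// ?nnegrE ?ltW.
Qed.

Lemma homeo_plus_comp_inv (phi1 phi2 psi : circle R -> circle R) f1 f2 g2 :
  homeo_plus phi1 -> homeo_plus phi2 -> circle_lift f1 -> circle_lift g2 ->
  (forall t, phi1 (cis t) = cis (f1 t)) -> (forall t, phi2 (cis t) = cis (f2 t)) ->
  cancel g2 f2 -> cancel phi2 psi -> cancel psi phi2 -> continuous psi ->
  homeo_plus (phi1 \o psi).
Proof.
move=> [[c1 [psi1 [K1 K1' cpsi1]]] _] [[c2 _] _] [cf1 fi1 _] [cg2 gi2 _] e1 e2 gK K2 K2' cpsi.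
split; [split|].
- by move=> x; apply: continuous_comp; [exact: cpsi|exact: c1].
- exists (phi2 \o psi1); split.
  + by move=> x /=; rewrite K1 K2'.
  + by move=> x /=; rewrite K2 K1'.
  + by move=> x; apply: continuous_comp; [exact: cpsi1|exact: c2].
exists (f1 \o g2); last by move=> x y xy /=; apply: fi1; exact: gi2.
split; first by move=> x; apply: continuous_comp; [exact: cg2|exact: cf1].
by move=> t /=; rewrite -e1 -[in LHS](gK t) -e2 K2.
Qed.

Lemma welding_eq_moebius phi1 phi2 : QS phi1 -> QS phi2 ->
  welding_grunsky phi1 = welding_grunsky phi2 ->
  exists2 mu : circle R -> circle R, Mob mu & phi1 = mu \o phi2.
Proof.
move=> q1 q2 W; have p2 := pi_ge2 R.
have [f1 l1 e1] := homeo_lift q1.1; have [f2 l2 e2] := homeo_lift q2.1.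
have [g2 [lg2 fK gK]] := circle_lift_inv l2.
have [[_ [psi [K2 K2' cpsi]]] _] := q2.1.
pose w t := expi (f1 t); pose z t := expi (f2 t).
have hb : 0 < (1 : R) < 2 * pi by apply/andP; split; lra.
have hc : 0 < (2 : R) < 2 * pi by apply/andP; split; lra.
have hd : 0 < (3 : R) < 2 * pi by apply/andP; split; lra.
have bc : (1 : R) != 2 by apply/eqP; lra.
have bd : (1 : R) != 3 by apply/eqP; lra.
have cd : (2 : R) != 3 by apply/eqP; lra.
have wcd := expi_lift_neq l1 hc hd cd; have zcd := expi_lift_neq l2 hc hd cd.
have wbd := expi_lift_neq l1 hb hd bd; have zbd := expi_lift_neq l2 hb hd bd.
have wbc := expi_lift_neq l1 hb hc bc; have zbc := expi_lift_neq l2 hb hc bc.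
(* The parameters 1, 2, 3 give three reference points; [F t = 0] below is the cross ratio identity
   with the fourth point at [t], cleared of denominators. *)
pose K := (w 1 - w 3) * (z 1 - z 2); pose K' := (z 1 - z 3) * (w 1 - w 2).
have K0 : K != 0 by rewrite mulf_neq0.
have K'0 : K' != 0 by rewrite mulf_neq0.
pose F t := K * ((w t - w 2) * (z t - z 3)) - K' * ((z t - z 2) * (w t - w 3)).
have F0 t : 0 < t < 2 * pi -> F t = 0.
  move=> ht; apply/eqP; rewrite /F subr_eq0; apply/eqP.
  have [->|tc] := eqVneq t 2; first by rewrite !subrr !(mul0r, mulr0).
  have [->|td] := eqVneq t 3; first by rewrite !subrr !(mul0r, mulr0).
  have := expi_cross (welding_eq_cross q1 q2 l1 l2 e1 e2 W ht hb hc hd tc td bc bd).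
  rewrite -/(w _) -/(w _) -/(w _) -/(w _) -/(z _) -/(z _) -/(z _) -/(z _) /K /K' => H.
  transitivity ((w t - w 2) * (w 1 - w 3) * ((z t - z 3) * (z 1 - z 2))); first by ring.
  by rewrite H; ring.
(* The cross ratio identity is available on the open period; continuity gives the remaining point of
   the circle. *)
have F00 : F 0 = 0.
  have u0 : (fun n => n.+1%:R^-1 : R) @ \oo --> (0 : R) by exact: cvg_harmonic.
  have cw : (fun n => w n.+1%:R^-1 : R[i]^o) @ \oo --> (w 0 : R[i]^o).
    by apply: (expi_cvg _ u0); have [] := l1.
  have cz : (fun n => z n.+1%:R^-1 : R[i]^o) @ \oo --> (z 0 : R[i]^o).
    by apply: (expi_cvg _ u0); have [] := l2.
  have cF : (fun n => F n.+1%:R^-1 : R[i]^o) @ \oo --> (F 0 : R[i]^o).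
    have k (x : R[i]) : (fun _ : nat => x : R[i]^o) @ \oo --> (x : R[i]^o) by exact: cvg_cst.
    exact: (cvgB (cvgM (k K) (cvgM (cvgB cw (k (w 2))) (cvgB cz (k (z 3)))))
      (cvgM (k K') (cvgM (cvgB cz (k (z 2))) (cvgB cw (k (w 3)))))).
  have e : (fun n => F n.+1%:R^-1 : R[i]^o) = cst 0.
    apply/funext => n; apply: F0; rewrite invr_gt0 ltr0Sn/=.
    have h : n.+1%:R^-1 <= 1 :> R by rewrite invf_le1// ler1n.
    by apply: le_lt_trans h _; lra.
  rewrite e in cF.
  have c0 : (fun _ : nat => 0 : R[i]^o) @ \oo --> (0 : R[i]^o) by exact: cvg_cst.
  exact: (cvg_unique (@norm_hausdorff _ _) cF c0).
have key p : K * ((cval (phi1 p) - w 2) * (cval (phi2 p) - z 3)) =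
    K' * ((cval (phi2 p) - z 2) * (cval (phi1 p) - w 3)).
  have [t /andP[t0 t2] ->] := cis_surj p; rewrite e1 e2.
  apply/eqP; rewrite -subr_eq0; apply/eqP; rewrite -[LHS]/(F t).
  move: t0; rewrite le_eqVlt => /orP[/eqP <-//|t0]; by apply: F0; rewrite t0.
exists (phi1 \o psi); last by apply/funext => p /=; rewrite K2.
split; first exact: (homeo_plus_comp_inv q1.1 q2.1 l1 lg2 e1 e2 gK K2 K2' cpsi).
(* The coefficients come from solving [F = 0] for w as a function of z. *)
exists (K * w 2 - K' * w 3), (- K * w 2 * z 3 + K' * w 3 * z 2), (K - K'), (- K * z 3 + K' * z 2).
split.
  rewrite (_ : _ - _ = K * K' * ((w 2 - w 3) * (z 2 - z 3))); last by ring.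
  by rewrite !mulf_neq0.
move=> p; have := key (psi p); rewrite K2' /=.
move: (cval (phi1 (psi p))) (cval p) => W' Z' H.
(* A zero denominator would make K (Z' - z 3) and K' (Z' - z 2) equal; the relation [H] then forces
   both to vanish, although z 2 and z 3 differ. *)
have D : (K - K') * Z' + (- K * z 3 + K' * z 2) != 0.
  apply/eqP => D0.
  have E : K * (Z' - z 3) = K' * (Z' - z 2).
    by apply/eqP; rewrite -subr_eq0 -D0; apply/eqP; ring.
  have E2 : K * (Z' - z 3) * (w 2 - w 3) = 0.
    have -> : K * (Z' - z 3) * (w 2 - w 3) =
       K * (Z' - z 3) * (W' - w 3) - K * ((W' - w 2) * (Z' - z 3)) by ring.
    by rewrite H E; ring.
  clearbody K K'; move/eqP: E2; rewrite !mulf_eq0 (negbTE K0) (negbTE wcd) orbF/= subr_eq0 => /eqP ZE.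
  move/eqP: E; rewrite ZE subrr mulr0 eq_sym mulf_eq0 (negbTE K'0)/=.
  by rewrite -opprB oppr_eq0 (negbTE zcd).
split; [exact: D|apply: (mulIf D); rewrite (divfK D)].
apply/eqP; rewrite -subr_eq0; apply/eqP.
transitivity (K * ((W' - w 2) * (Z' - z 3)) - K' * ((Z' - z 2) * (W' - w 3))); first by ring.
by rewrite H subrr.
Qed.

End MoebiusFromCrossRatio.

(** * Sums of functions of one variable are invisible to the matrix *)

Section SeparatedKernels.
Variable R : realType.
Local Notation mu := (@lebesgue_measure R).
Implicit Types (F G : R * R -> R) (p q A : R -> R).

Definition null_integral F := torus_integrable F /\ \int[plane]_(x in @torus_square R) F x = 0.

Let mD := @measurable_prod_square R.

Lemma null_integralD F G : null_integral F -> null_integral G -> null_integral (fun x => F x + G x).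
Proof.
move=> [iF F0] [iG G0]; split; first exact: (integrableD mD iF iG).
by rewrite RintegralD// F0 G0 addr0.
Qed.

Lemma null_integralZ c F : null_integral F -> null_integral (fun x => c * F x).
Proof.
move=> [iF F0]; split; first exact: torus_integrableZl.
by rewrite RintegralZl// F0 mulr0.
Qed.

Lemma eq_null_integral F G : F =1 G -> null_integral F -> null_integral G.
Proof. by move=> /funext ->. Qed.

Definition mean0 p := continuous p /\ \int[mu]_(s in `[0, 2 * pi]) p s = 0.

Lemma mean0_of_derivative (p P : R -> R) : (forall t : R, is_derive t 1 P (p t)) ->
  continuous p -> P (2 * pi) = P 0 -> mean0 p.
Proof.
move=> dP cp PP; split => //; have p0 := pi_gt0 R; have p2 : 0 < 2 * pi :> R by lra.
rewrite /Rintegral (FTC2_is_derive p2 (fun x _ => dP x)) ?PP ?subrr//.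
exact: continuous_subspaceT.
Qed.

Lemma mean0_cos (k : int) : k != 0 -> mean0 (fun t => cos (k%:~R * t)).
Proof.
move=> k0; have k0' : k%:~R != 0 :> R by rewrite intr_eq0.
apply: (@mean0_of_derivative _ (fun t => 0 * cos (k%:~R * t) - (- k%:~R^-1) * sin (k%:~R * t))).
- move=> t; apply: is_derive_eq (is_derive_wave _ _ _ _) _.
  by move: (cos _) (sin _) => x y; field.
- by apply: is_derive_continuous => t; exact: is_derive_cosM.
- by rewrite -[2 * pi](add0r (2 * pi)) sin_intD2pi cos_intD2pi.
Qed.

Lemma mean0_sin (k : int) : k != 0 -> mean0 (fun t => sin (k%:~R * t)).
Proof.
move=> k0; have k0' : k%:~R != 0 :> R by rewrite intr_eq0.
apply: (@mean0_of_derivative _ (fun t => - k%:~R^-1 * cos (k%:~R * t) - 0 * sin (k%:~R * t))).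
- move=> t; apply: is_derive_eq (is_derive_wave _ _ _ _) _.
  by move: (cos _) (sin _) => x y; field.
- by apply: is_derive_continuous => t; exact: is_derive_sinM.
- by rewrite -[2 * pi](add0r (2 * pi)) sin_intD2pi cos_intD2pi.
Qed.

(** Each of the three terms is a product of functions of one variable, one factor of which has mean
    0. *)
Lemma separated_null (c0 : R) A p q : continuous A -> mean0 p -> mean0 q ->
  null_integral (fun x => (c0 - A x.1 - A x.2) * (p x.1 * q x.2)).
Proof.
move=> cA [cp p0] [cq q0].
have cM (g h : R -> R) : continuous g -> continuous h -> continuous (fun t : R => g t * h t : R).
  by move=> cg ch t; apply: cvgM; [exact: cg|exact: ch].
have n1 : null_integral (fun x => p x.1 * q x.2).
  by have [i e] := torus_integral_mul cp cq; split; rewrite // e p0 mul0r.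
have n2 : null_integral (fun x => (A x.1 * p x.1) * q x.2).
  by have [i e] := torus_integral_mul (cM _ _ cA cp) cq; split; rewrite // e q0 mulr0.
have n3 : null_integral (fun x => p x.1 * (A x.2 * q x.2)).
  by have [i e] := torus_integral_mul cp (cM _ _ cA cq); split; rewrite // e p0 mul0r.
have := null_integralD (null_integralZ c0 n1)
  (null_integralD (null_integralZ (-1) n2) (null_integralZ (-1) n3)).
by apply: eq_null_integral => x; ring.
Qed.

Lemma separated_wave_null (c0 : R) A (k l : int) : continuous A -> k != 0 -> l != 0 ->
  null_integral (fun x => (c0 - A x.1 - A x.2) * cos_wave k l x) /\
  null_integral (fun x => (c0 - A x.1 - A x.2) * sin_wave k l x).
Proof.
move=> cA k0 l0; split.
  have := null_integralD (separated_null c0 cA (mean0_cos k0) (mean0_cos l0))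
    (separated_null c0 cA (mean0_sin k0) (mean0_sin l0)).
  by apply: eq_null_integral => x; rewrite /cos_wave cosB; ring.
have := null_integralD (separated_null c0 cA (mean0_sin k0) (mean0_cos l0))
  (null_integralZ (-1) (separated_null c0 cA (mean0_cos k0) (mean0_sin l0))).
by apply: eq_null_integral => x; rewrite /sin_wave sinB; ring.
Qed.

Lemma pairing_ae_separated (u1 u2 : R * R -> R) (H : R * R -> R) psi :
  torus_integrable u1 -> torus_integrable u2 -> tame psi ->
  null_integral (fun x => H x * psi x) ->
  {ae plane, forall x, torus_square x -> u1 x = u2 x + H x} ->
  pairing u1 psi = pairing u2 psi.
Proof.
move=> i1 i2 tp [iH H0] ae.
have j1 := integrable_tame i1 tp; have j2 := integrable_tame i2 tp.
have i3 : torus_integrable (fun x => u2 x * psi x + H x * psi x) by exact: (integrableD mD j2 iH).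
have -> : pairing u2 psi = \int[plane]_(x in @torus_square R) (u2 x * psi x + H x * psi x).
  by rewrite RintegralD// H0 addr0.
rewrite /pairing /Rintegral; congr fine.
apply: ae_eq_integral => //.
- by case/integrableP : j1.
- by case/integrableP : i3.
apply: (@filterS _ _ (ae_filter_ringOfSetsType plane)) ae => x Hx xD.
by rewrite Hx// mulrDl.
Qed.

End SeparatedKernels.

Section MoebiusInvariance.
Variable R : realType.
Notation normc := ComplexField.Normc.normc.

Lemma ln_normc_affine_continuous (c d : R[i]) (f : R -> R) : continuous f ->
  (forall t, c * expi (f t) + d != 0) -> continuous (fun t => ln (normc (c * expi (f t) + d))).
Proof.
move=> cf nz t; apply: (@continuous_comp _ _ _ (fun t => normc (c * expi (f t) + d)) (@ln R)); last first.
  apply: continuous_ln; rewrite lt_neqAle eq_sym; apply/andP; split.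
    by apply: contra_neq (nz t) => /ComplexField.Normc.eq0_normc.
  by case: (_ + _) => a b; exact: sqrtr_ge0.
case: c nz => c1 c2; case: d => d1 d2 nz.
have ccos : continuous (fun t => cos (f t)).
  by move=> u; apply: (@continuous_comp _ _ _ f cos); [exact: cf|exact: continuous_cos].
have csin : continuous (fun t => sin (f t)).
  by move=> u; apply: (@continuous_comp _ _ _ f sin); [exact: cf|exact: continuous_sin].
have k (x : R) : continuous (fun _ : R => x) by move=> u; exact: cvg_cst.
have sq (g : R -> R) : continuous g -> continuous (fun t => g t ^+ 2).
  by move=> cg u; apply: (@continuous_comp _ _ _ g (fun x => x ^+ 2)); [exact: cg|exact: exprn_continuous].
apply: (@continuous_comp _ _ _ (fun t => (c1 * cos (f t) - c2 * sin (f t) + d1) ^+ 2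
   + (c1 * sin (f t) + c2 * cos (f t) + d2) ^+ 2) Num.sqrt); last exact: sqrt_continuous.
have g1 : continuous (fun t => c1 * cos (f t) - c2 * sin (f t) + d1).
  move=> u; apply: cvgD; last exact: k.
  by apply: cvgB; apply: cvgM; [exact: k|exact: ccos|exact: k|exact: csin].
have g2 : continuous (fun t => c1 * sin (f t) + c2 * cos (f t) + d2).
  move=> u; apply: cvgD; last exact: k.
  by apply: cvgD; apply: cvgM; [exact: k|exact: csin|exact: k|exact: ccos].
exact: (cvgD (sq _ g1 t) (sq _ g2 t)).
Qed.

Lemma moebius_welding_eq (phi1 phi2 mu : circle R -> circle R) : QS phi1 -> QS phi2 ->
  Mob mu -> phi1 = mu \o phi2 -> welding_grunsky phi1 = welding_grunsky phi2.
Proof.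
move=> q1 q2 [_ [a [b [c [d [det Hmu]]]]]] e.
have [f2 l2 e2] := homeo_lift q2.1; have [cf2 _ _] := l2.
have nz t : c * expi (f2 t) + d != 0 by have [] := Hmu (cis (f2 t)).
pose A t := ln (normc (c * expi (f2 t) + d)).
have cA : continuous A by exact: ln_normc_affine_continuous.
pose c0 := ln (normc (a * d - b * c)).
have npos (z : R[i]) : z != 0 -> 0 < normc z.
  move=> z0; rewrite lt_neqAle eq_sym; apply/andP; split.
    by apply: contra_neq z0 => /ComplexField.Normc.eq0_normc.
  by case: {z0} z => x y; exact: sqrtr_ge0.
(* On the diagonal both log quotients are 0 by convention while the separated term need not vanish,
   hence an identity almost everywhere. *)
have ae : {ae plane, forall x : R * R, torus_square x ->
    log_quotient2 phi1 x = log_quotient2 phi2 x + (c0 - A x.1 - A x.2)}.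
  have := ae_half_chord_neq0 (@circle_lift_id R).
  apply: (@filterS _ _ (ae_filter_ringOfSetsType plane)) => -[s t] H xD; have {H} := H xD => /= st0.
  rewrite /log_quotient2 /log_quotient /= e /= !e2.
  have [Ds ->] := Hmu (cis (f2 s)); have [Dt ->] := Hmu (cis (f2 t)).
  rewrite -[cval (cis (f2 s))]/(expi (f2 s)) -[cval (cis (f2 t))]/(expi (f2 t)) in Ds Dt *.
  have -> : (a * expi (f2 s) + b) / (c * expi (f2 s) + d) - (a * expi (f2 t) + b) / (c * expi (f2 t) + d)
     = (a * d - b * c) * (expi (f2 s) - expi (f2 t)) /
       ((c * expi (f2 s) + d) * (c * expi (f2 t) + d)).
    move: (expi (f2 s)) (expi (f2 t)) Ds Dt => z w Ds Dt.
    by field; apply/andP; split.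
  have pos1 : 0 < normc (expi s - expi t) by rewrite normc_expiB mulr_gt0// normr_gt0.
  have pos2 : 0 < normc (expi (f2 s) - expi (f2 t)).
    rewrite normc_expiB mulr_gt0// normr_gt0.
    have [g [lg fK gK]] := circle_lift_inv l2; apply: contra_neq st0 => /(sin_half_lift0 lg).
    by rewrite !fK.
  have pos3 := npos _ det; have pos4 := npos _ Ds; have pos5 := npos _ Dt.
  rewrite !ComplexField.Normc.normcM !ComplexField.Normc.normcV !ComplexField.Normc.normcM.
  rewrite /c0 /A.
  move: pos1 pos2 pos3 pos4 pos5.
  move: (normc (expi s - expi t)) (normc (expi (f2 s) - expi (f2 t))) (normc (a * d - b * c)) => x1 x2 x3.
  move: (normc (c * expi (f2 s) + d)) (normc (c * expi (f2 t) + d)) => x4 x5 h1 h2 h3 h4 h5.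
  by rewrite !(lnM, lnV) ?posrE ?mulr_gt0 ?invr_gt0 ?mulr_gt0//; ring.
have i1 := log_quotient_integrable q1; have i2 := log_quotient_integrable q2.
apply/funext => k; apply/funext => l; rewrite !welding_grunskyE//.
have [n1 n2] := separated_wave_null c0 cA (valP k) (valP l).
have -> := pairing_ae_separated i1 i2 (tame_cos_wave R (val k) (val l)) n1 ae.
by have -> := pairing_ae_separated i1 i2 (tame_sin_wave R (val k) (val l)) n2 ae.
Qed.

Lemma Mob_id : Mob (@id (circle R)).
Proof.
split.
  split; first by split; [move=> x; exact: cvg_id|exists id; split => // x; exact: cvg_id].
  by exists id => //; split => // x; exact: cvg_id.
exists 1, 0, 0, 1; split; first by rewrite mulr1 mul0r subr0 oner_neq0.
by move=> z; rewrite mul0r add0r oner_neq0 mul1r addr0 divr1.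
Qed.

Lemma homeo_plus_comp (phi psi : circle R -> circle R) :
  homeo_plus phi -> homeo_plus psi -> homeo_plus (phi \o psi).
Proof.
move=> [[c1 [p1 [K1 K1' d1]]] [f1 [cf1 e1] i1]] [[c2 [p2 [K2 K2' d2]]] [f2 [cf2 e2] i2]].
split; [split|].
- by move=> x; apply: continuous_comp; [exact: c2|exact: c1].
- exists (p2 \o p1); split; [exact: (can_comp K1 K2)|exact: (can_comp K2' K1')|].
  by move=> x; apply: continuous_comp; [exact: d1|exact: d2].
exists (f1 \o f2); last by move=> x y xy /=; apply: i1; exact: i2.
split; first by move=> x; apply: continuous_comp; [exact: cf2|exact: cf1].
by move=> t /=; rewrite e2 e1.
Qed.

Lemma Mob_comp (mu nu : circle R -> circle R) : Mob mu -> Mob nu -> Mob (mu \o nu).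
Proof.
move=> [h1 [a [b [c [d [D1 H1]]]]]] [h2 [a' [b' [c' [d' [D2 H2]]]]]].
split; first exact: homeo_plus_comp.
exists (a * a' + b * c'), (a * b' + b * d'), (c * a' + d * c'), (c * b' + d * d'); split.
  by rewrite (_ : _ - _ = (a * d - b * c) * (a' * d' - b' * c')) ?mulf_neq0//; ring.
move=> z; have [n2 e2] := H2 z; have [n1 e1] := H1 (nu z).
have den : (c * a' + d * c') * cval z + (c * b' + d * d') =
    (c * cval (nu z) + d) * (c' * cval z + d').
  by rewrite e2; field.
have num : (a * a' + b * c') * cval z + (a * b' + b * d') =
    (a * cval (nu z) + b) * (c' * cval z + d').
  by rewrite e2; field.
split; first by rewrite den mulf_neq0.
by rewrite /= e1 den num; field; apply/andP; split.
Qed.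

Lemma Mob_coset_welding (phi1 phi2 : circle R -> circle R) : QS phi1 -> QS phi2 ->
  welding_grunsky phi1 = welding_grunsky phi2 <-> Mob_coset phi1 = Mob_coset phi2.
Proof.
move=> q1 q2; have sub (psi1 psi2 : circle R -> circle R) : QS psi1 -> QS psi2 ->
    welding_grunsky psi1 = welding_grunsky psi2 -> Mob_coset psi1 `<=` Mob_coset psi2.
  move=> p1 p2 /(welding_eq_moebius p1 p2)[mu mmu ->] _ [nu mnu <-].
  by exists (nu \o mu) => //; exact: Mob_comp.
split => [W|C]; first by apply/seteqP; split; [exact: sub q1 q2 W|exact: sub q2 q1 (esym W)].
have : Mob_coset phi2 phi1 by rewrite -C; exists id => //; exact: Mob_id.
by move=> [mu mmu e]; apply: (moebius_welding_eq q1 q2 mmu); rewrite e.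
Qed.

Lemma welding_descends : exists F : set (circle R -> circle R) -> Zstar -> Zstar -> R[i],
  (forall phi : circle R -> circle R, QS phi -> F (Mob_coset phi) = welding_grunsky phi) /\
  set_inj (@T1 R) F.
Proof.
(* A representative is chosen in each coset, and [Mob_coset_welding] makes the choice irrelevant;
   off [T1] the value 0 is a placeholder. *)
pose F (X : set (circle R -> circle R)) : Zstar -> Zstar -> R[i] :=
  if pselect (exists2 phi, QS phi & Mob_coset phi = X) is left e
  then welding_grunsky (s2val (cid2 e)) else fun _ _ => 0.
have HF phi : QS phi -> F (Mob_coset phi) = welding_grunsky phi.
  move=> q; rewrite /F; case: pselect => [e|[]]; last by exists phi.
  by case: cid2 => psi /= qpsi e'; apply/(Mob_coset_welding qpsi q).
exists F; split => // X Y /set_mem[phi1 q1 <-] /set_mem[phi2 q2 <-].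
by rewrite !HF// => /(Mob_coset_welding q1 q2).
Qed.

End MoebiusInvariance.

Theorem theorem1p3 (R : realType) :
  (forall phi : circle R -> circle R, QS phi ->
     acts_as_bounded_self_adjoint (welding_grunsky phi)) /\
  (forall phi1 phi2 : circle R -> circle R, QS phi1 -> QS phi2 ->
     (welding_grunsky phi1 = welding_grunsky phi2 <->
      exists2 mu : circle R -> circle R, Mob mu & phi1 = mu \o phi2)) /\
  (exists F : set (circle R -> circle R) -> Zstar -> Zstar -> R[i],
     (forall phi : circle R -> circle R, QS phi ->
        F (Mob_coset phi) = welding_grunsky phi) /\
     set_inj (@T1 R) F).
Proof.
split; first exact: welding_grunsky_bounded.
split; last exact: welding_descends.
move=> phi1 phi2 q1 q2; split; first exact: welding_eq_moebius.
by move=> [mu mmu e]; exact: moebius_welding_eq mmu e.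
Qed.
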